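(* Let $k$ be an algebraically closed field, let $e\ge 1$, let $\Lambda=kQ_e/I$ be the algebra described in the context, and let $\mathfrak{C}$ be a homogeneous tube of rank one of the stable Auslander-Reiten quiver of $\Lambda$. Then there is at most $1$ $\Omega$-orbit of modules in $\mathfrak{C}$ which have stable endomorphism ring isomorphic to $k$, and $R(\Lambda,V) \cong k[[t]]$ for all modules $V$ belonging to this $\Omega$-orbit.
   Context: Modules are finitely generated left modules; paths are composed from right to left. The algebra: $Q_e$ is the quiver with vertices $1,\dots,e$, arrows $\alpha_i:i\to i+1$ for $1\le i\le e-1$, $\alpha_e:e\to 1$, and a loop $\delta$ at $e$ (for $e=1$: one vertex with two loops $\alpha=\alpha_1$ and $\delta$; put $\alpha_0=\alpha_e$). $I$ is the ideal generated by $\alpha_i(\alpha_{i-1}\cdots\alpha_1\alpha_e\cdots\alpha_i)^2$ for $1\le i\le e$, $(\alpha_{e-1}\cdots\alpha_1\alpha_e)^2-\delta^2$, $\alpha_e\delta$, $\delta\alpha_{e-1}$ and $\delta^3$ (for $e=1$: $\alpha^3,\ \alpha^2-\delta^2,\ \alpha\delta,\ \delta\alpha,\ \delta^3$). $\Lambda=kQ_e/I$ is a symmetric special biserial algebra, the Brauer graph algebra of the star with $e$ edges in which the two endpoints of edge $e$ have multiplicity $2$ and all other vertices multiplicity $1$. The stable Auslander-Reiten quiver of $\Lambda$ is the disjoint union of one component $\mathbb{Z}\tilde{A}_{e,e}$ (the non-periodic component), two components $\mathbb{Z}A_\infty/\langle\tau^e\rangle$ consisting of string modules (the exceptional tubes),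 and infinitely many components $\mathbb{Z}A_\infty/\langle\tau\rangle$ (the homogeneous tubes of rank one). The modules in the homogeneous tubes of rank one are the band modules $B(n,\lambda)$, $n\ge1$, $\lambda\in k^*$ (one tube for each $\lambda$), where $B(n,\lambda)$ is the representation with $k^n$ at the vertices $1,\dots,e-1$, $k^n\oplus k^n$ at vertex $e$, and, for $e\ge2$, $\alpha_e(x,y)=x$, $\alpha_i=\mathrm{id}$ for $1\le i\le e-2$, $\alpha_{e-1}(x)=(0,x)$, $\delta(x,y)=(0,J_n(\lambda)x)$; for $e=1$, $\alpha(x,y)=(0,x)$ and $\delta(x,y)=(0,J_n(\lambda)x)$. Here $J_n(\lambda)$ is the $n\times n$ Jordan block with eigenvalue $\lambda$. $\Omega$ is the syzygy functor; the $\Omega$-orbit of $V$ is $\{\Omega^j(V): j\in\mathbb{Z}\}$ up to isomorphism (it may contain modules outside $\mathfrak{C}$). The stable endomorphism ring $\underline{\mathrm{End}}_\Lambda(V)$ is $\mathrm{End}_\Lambda(V)$ modulo endomorphisms factoring through a projective module. Universal deformation ring: Let $\hat{\mathcal{C}}$ be the category of complete local commutative Noetherian $k$-algebras $R$ with residue field $k$ (with a fixed projection to $k$), morphisms being local $k$-algebra homomorphisms inducing the identity on $k$. A lift of $V$ over $R$ is a pair $(M,\phi)$ where $M$ is a finitely generated $R\otimes_k\Lambda$-module free over $R$ and $\phi:k\otimes_R M\to V$ is a $\Lambda$-isomorphism. Lifts $(M,\phi)$, $(M',\phi')$ are isomorphic if there is an $R\otimes_k\Lambda$-isomorphism $f:M\to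 M'$ with $\phi=\phi'\circ(\mathrm{id}\otimes f)$. The universal deformation ring $R(\Lambda,V)$ is the object of $\hat{\mathcal{C}}$ representing the functor sending $R$ to the set of isomorphism classes of lifts of $V$ over $R$; it exists when $\Lambda$ is self-injective and $\underline{\mathrm{End}}_\Lambda(V)\cong k$. *)

(* Defs.v *)
From HB Require Import structures.
From mathcomp Require Import all_boot all_algebra generic_quotient.
From mathcomp Require Import finmap boolp.
From mathcomp.multinomials Require Import monalg.

Set Implicit Arguments.
Unset Strict Implicit.
Unset Printing Implicit Defensive.

Import GRing.Theory.
Local Open Scope ring_scope.

(* The quiver Q_e.  Vertices and the arrows alpha_i are numbered from 0, so the
   vertex i of the mathematical text is the ordinal i - 1 and ord_max is the
   vertex e.  Only e >= 1 is meaningful; e.-1.+1 = e makes 'I_e inhabited.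
   The arrow Some i is alpha_i : i -> i + 1 (cyclically), None is the loop. *)
Section Quiver.
Variable e : nat.

Definition vertex := 'I_e.-1.+1.
Definition arrow := option vertex.

Definition arrow_src (a : arrow) : vertex := if a is Some i then i else ord_max.
Definition arrow_tgt (a : arrow) : vertex :=
  if a is Some i then ordS i else ord_max.

(* A path is a source together with its arrows in order of traversal; the
   composite of p after q is therefore the word of q followed by that of p. *)
Fixpoint walk (v : vertex) (w : seq arrow) : bool :=
  if w is a :: w' then (arrow_src a == v) && walk (arrow_tgt a) w' else true.

Record qpath := QPath {
  path_val : vertex * seq arrow;
  path_valP : walk path_val.1 path_val.2 }.
HB.instance Definition _ := [isSub for path_val].
HB.instance Definition _ := [Choice of qpath by <:].

Definition path_src (p : qpath) : vertex := (path_val p).1.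
Definition path_word (p : qpath) : seq arrow := (path_val p).2.
Definition path_tgt (p : qpath) : vertex :=
  last (path_src p) (map arrow_tgt (path_word p)).

Lemma walk_cat v w1 w2 :
  walk v (w1 ++ w2) = walk v w1 && walk (last v (map arrow_tgt w1)) w2.
Proof. by elim: w1 v => //= a w1 IH v; rewrite IH andbA. Qed.

Definition triv_path (v : vertex) : qpath := @QPath (v, [::]) isT.

Lemma arrow_pathP (a : arrow) : walk (arrow_src a) [:: a].
Proof. by rewrite /= eqxx. Qed.
Definition arrow_path (a : arrow) : qpath :=
  @QPath (arrow_src a, [:: a]) (arrow_pathP a).

Definition path_comp (p q : qpath) : option qpath :=
  if path_src p == path_tgt q
  then insub (path_src q, path_word q ++ path_word p) else None.

Variant path_comp_spec (p q : qpath) : option qpath -> Type :=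
| PathComp r of path_src p = path_tgt q & path_src r = path_src q
    & path_word r = path_word q ++ path_word p & path_tgt r = path_tgt p
    : path_comp_spec p q (Some r)
| PathCompNone of path_src p <> path_tgt q : path_comp_spec p q None.

Lemma path_compP p q : path_comp_spec p q (path_comp p q).
Proof.
rewrite /path_comp; case: eqP => [pq|]; last by constructor.
case: insubP => [r _ rE|/negP[]].
  have sr : path_src r = path_src q by rewrite /path_src rE.
  have wr : path_word r = path_word q ++ path_word p by rewrite /path_word rE.
  constructor=> //; rewrite /path_tgt sr wr map_cat last_cat.
  by rewrite -[last _ (map _ (path_word q))]/(path_tgt q) -pq.
rewrite walk_cat (path_valP q) /=.
by rewrite -[last _ _]/(path_tgt q) -pq path_valP.
Qed.

Lemma qpathP p q : path_src p = path_src q -> path_word p = path_word q -> p = q.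
Proof.
move=> sE wE; apply: val_inj => /=; case: p q sE wE => [[v w] ?] [[v' w'] ?].
by rewrite /path_src /path_word /= => -> ->.
Qed.

Lemma path_compA p q r :
  obind (path_comp p) (path_comp q r) = obind (path_comp^~ r) (path_comp p q).
Proof.
case: (path_compP q r) => [qr Eqr sqr wqr tqr|Nqr] /=;
  case: (path_compP p q) => [pq Epq spq wpq tpq|Npq] //=.
- case: path_compP => [x _ sx wx _|]; last by rewrite tqr.
  case: path_compP => [y _ sy wy _|]; last by rewrite spq.
  by congr Some; apply: qpathP; rewrite ?sx ?sy // wx wy wqr wpq catA.
- by case: path_compP => // x; rewrite tqr.
- by case: path_compP => // x; rewrite spq.
Qed.

End Quiver.

Lemma malg_scaleU (k : fieldType) (K : choiceType) (c : k) (p : K) :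
  << c *g p >> = c *: << p >> :> {malg k[K]}.
Proof. by apply/malgP => q; rewrite mcoeffZ 2!mcoeffU mulrnAr mulr1. Qed.

Section BilinearExtension.
Variables (k : fieldType) (V : lmodType k) (I : Type) (b : I -> V).
Variable mul : V -> V -> V.
Hypothesis b_ind : forall P : V -> Prop,
  P 0 -> (forall x y, P x -> P y -> P (x + y)) ->
  (forall c x, P x -> P (c *: x)) -> (forall i, P (b i)) -> forall x, P x.
Hypothesis mulDl : left_distributive mul +%R.
Hypothesis mulDr : right_distributive mul +%R.
Hypothesis mulZl : forall c x y, c *: mul x y = mul (c *: x) y.
Hypothesis mulZr : forall c x y, c *: mul x y = mul x (c *: y).

Lemma bil_mul0l x : mul 0 x = 0.
Proof. by rewrite -[X in mul X _](scale0r (0 : V)) -mulZl scale0r. Qed.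

Lemma bil_mul0r x : mul x 0 = 0.
Proof. by rewrite -[X in mul _ X](scale0r (0 : V)) -mulZr scale0r. Qed.

Lemma bil_suml (J : finType) (F : J -> V) y :
  mul (\sum_v F v) y = \sum_v mul (F v) y.
Proof. by elim/big_rec2: _ => [|v a c _ <-]; rewrite ?bil_mul0l ?mulDl. Qed.

Lemma bil_sumr (J : finType) (F : J -> V) y :
  mul y (\sum_v F v) = \sum_v mul y (F v).
Proof. by elim/big_rec2: _ => [|v a c _ <-]; rewrite ?bil_mul0r ?mulDr. Qed.

Lemma bil_mulA :
  (forall i j l, mul (b i) (mul (b j) (b l)) = mul (mul (b i) (b j)) (b l)) ->
  associative mul.
Proof.
move=> bA x y z; elim/b_ind: x => [|x x' IH IH'|c x IH|i].
- by rewrite 3!bil_mul0l.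
- by rewrite 3!mulDl IH IH'.
- by rewrite -3!mulZl IH.
elim/b_ind: y => [|y y' IH IH'|c y IH|j].
- by rewrite bil_mul0l bil_mul0r bil_mul0l.
- by rewrite mulDl 2!mulDr mulDl IH IH'.
- by rewrite -mulZl -2!mulZr -mulZl IH.
elim/b_ind: z => [|z z' IH IH'|c z IH|l].
- by rewrite 3!bil_mul0r.
- by rewrite 3!mulDr IH IH'.
- by rewrite -3!mulZr IH.
exact: bA.
Qed.

Lemma bil_mulr_morph (phi : V -> k) :
  (forall x y, phi (x + y) = phi x + phi y) ->
  (forall c x, phi (c *: x) = c * phi x) ->
  (forall i j, phi (mul (b i) (b j)) = phi (b i) * phi (b j)) ->
  forall x y, phi (mul x y) = phi x * phi y.
Proof.
move=> pD pZ pb x y; have p0 : phi 0 = 0 by rewrite -(scale0r 0) pZ mul0r.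
elim/b_ind: x => [|x x' IH IH'|c x IH|i].
- by rewrite bil_mul0l p0 mul0r.
- by rewrite mulDl 2!pD IH IH' mulrDl.
- by rewrite -mulZl 2!pZ IH mulrA.
elim/b_ind: y => [|y y' IH IH'|c y IH|j]; last exact: pb.
- by rewrite bil_mul0r p0 mulr0.
- by rewrite mulDr 2!pD IH IH' mulrDr.
- by rewrite -mulZr 2!pZ IH mulrCA.
Qed.

Lemma bil_mul1l u : (forall i, mul u (b i) = b i) -> left_id u mul.
Proof.
move=> bu x; elim/b_ind: x => [|x x' IH IH'|c x IH|i]; last exact: bu.
- exact: bil_mul0r.
- by rewrite mulDr IH IH'.
- by rewrite -mulZr IH.
Qed.

Lemma bil_mul1r u : (forall i, mul (b i) u = b i) -> right_id u mul.
Proof.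
move=> bu x; elim/b_ind: x => [|x x' IH IH'|c x IH|i]; last exact: bu.
- exact: bil_mul0l.
- by rewrite mulDl IH IH'.
- by rewrite -mulZl IH.
Qed.

End BilinearExtension.

Definition path_alg (k : fieldType) (e : nat) := {malg k[qpath e]}.
HB.instance Definition _ k e := GRing.Lmodule.on (path_alg k e).

HB.lock Definition bpath (k : fieldType) (e : nat) (p : qpath e) : path_alg k e :=
  << p >>.
Canonical bpath_unlockable := Unlockable bpath.unlock.

(* Bilinear extension of composition: p * q is "q, then p", or 0. *)
HB.lock Definition path_mul (k : fieldType) (e : nat) (x y : path_alg k e) :
    path_alg k e :=
  \sum_(p <- msupp x) \sum_(q <- msupp y)
     (x@_p * y@_q) *: (if path_comp p q is Some r then bpath k r else 0).
Canonical path_mul_unlockable := Unlockable path_mul.unlock.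

Section PathAlgebra.
Variables (k : fieldType) (e : nat).
Local Notation path_alg := (path_alg k e).
Local Notation bpath := (@bpath k e).
Local Notation path_mul := (@path_mul k e).

Definition bcomp (p q : qpath e) : path_alg :=
  if path_comp p q is Some r then bpath r else 0.
Definition path_one : path_alg := \sum_v bpath (triv_path v).

Lemma path_mulw (d1 d2 : {fset qpath e}) (x y : path_alg) :
  (msupp x `<=` d1)%fset -> (msupp y `<=` d2)%fset ->
  path_mul x y = \sum_(p <- d1) \sum_(q <- d2) (x@_p * y@_q) *: bcomp p q.
Proof.
move=> le1 le2; rewrite path_mul.unlock (big_fset_incl _ le1) /=.
  apply: eq_bigr => p _; apply/big_fset_incl => // q _ /mcoeff_outdom ->.
  by rewrite mulr0 scale0r.
by move=> p _ /mcoeff_outdom px; rewrite big1 // => q _; rewrite px mul0r scale0r.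
Qed.

Lemma path_mulDl : left_distributive path_mul +%R.
Proof.
move=> x y z; have le := fsubset_refl (msupp z).
have lex := fsubsetUl (msupp x) (msupp y).
have ley := fsubsetUr (msupp x) (msupp y).
rewrite (path_mulw (msuppD_le x y) le) (path_mulw lex le) (path_mulw ley le).
rewrite -big_split; apply: eq_bigr => p _ /=; rewrite -big_split.
by apply: eq_bigr => q _ /=; rewrite mcoeffD mulrDl scalerDl.
Qed.

Lemma path_mulDr : right_distributive path_mul +%R.
Proof.
move=> z x y; have le := fsubset_refl (msupp z).
have lex := fsubsetUl (msupp x) (msupp y).
have ley := fsubsetUr (msupp x) (msupp y).
rewrite (path_mulw le (msuppD_le x y)) (path_mulw le lex) (path_mulw le ley).
rewrite -big_split; apply: eq_bigr => p _ /=; rewrite -big_split.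
by apply: eq_bigr => q _ /=; rewrite mcoeffD mulrDr scalerDl.
Qed.

Lemma path_scaleAl c x y : c *: path_mul x y = path_mul (c *: x) y.
Proof.
rewrite (path_mulw (msuppZ_le c x) (fsubset_refl _)) path_mul.unlock scaler_sumr.
apply: eq_bigr => p _; rewrite scaler_sumr.
by apply: eq_bigr => q _; rewrite mcoeffZ scalerA mulrA.
Qed.

Lemma path_scaleAr c x y : c *: path_mul x y = path_mul x (c *: y).
Proof.
rewrite (path_mulw (fsubset_refl _) (msuppZ_le c y)) path_mul.unlock scaler_sumr.
apply: eq_bigr => p _; rewrite scaler_sumr.
by apply: eq_bigr => q _; rewrite mcoeffZ scalerA mulrCA.
Qed.

Lemma path_mulUU p q : path_mul (bpath p) (bpath q) = bcomp p q.
Proof.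
rewrite bpath.unlock (path_mulw msuppU_le msuppU_le) !big_seq_fset1 !mcoeffUU.
by rewrite mul1r scale1r /bcomp.
Qed.

Lemma path_alg_ind (P : path_alg -> Prop) :
  P 0 -> (forall x y, P x -> P y -> P (x + y)) ->
  (forall c x, P x -> P (c *: x)) -> (forall p, P (bpath p)) -> forall x, P x.
Proof.
move=> P0 PD PZ Pp x; rewrite [x]monalgE; elim/big_ind: _ => // p _.
have -> : << x@_p *g p >> = x@_p *: bpath p :> path_alg.
  by rewrite bpath.unlock; exact: malg_scaleU.
by apply: PZ; apply: Pp.
Qed.

Lemma path_mul0l x : path_mul 0 x = 0.
Proof. exact: (bil_mul0l path_scaleAl). Qed.

Lemma path_mul0r x : path_mul x 0 = 0.
Proof. exact: (bil_mul0r path_scaleAr). Qed.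

Lemma path_mulA : associative path_mul.
Proof.
apply: (bil_mulA path_alg_ind path_mulDl path_mulDr path_scaleAl path_scaleAr).
move=> p q r; rewrite 2!path_mulUU /bcomp; have := path_compA p q r.
case: (path_comp q r) => [qr|]; case: (path_comp p q) => [pq|] /=.
- by rewrite 2!path_mulUU /bcomp => ->.
- by rewrite path_mulUU path_mul0l /bcomp => ->.
- by rewrite path_mulUU path_mul0r /bcomp => <-.
- by rewrite path_mul0r path_mul0l.
Qed.

Lemma path_mul1l : left_id path_one path_mul.
Proof.
apply: (bil_mul1l path_alg_ind path_mulDr path_scaleAr) => p.
rewrite (bil_suml path_mulDl path_scaleAl) (bigD1 (path_tgt p)) //= big1.
  rewrite addr0 path_mulUU /bcomp; case: path_compP => [r _ sr wr _|] //.
  by congr bpath; apply: qpathP; rewrite ?wr ?cats0.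
move=> v vp; rewrite path_mulUU /bcomp; case: path_compP => // r vE.
by case/eqP: vp.
Qed.

Lemma path_mul1r : right_id path_one path_mul.
Proof.
apply: (bil_mul1r path_alg_ind path_mulDl path_scaleAl) => p.
rewrite (bil_sumr path_mulDr path_scaleAr) (bigD1 (path_src p)) //= big1.
  rewrite addr0 path_mulUU /bcomp; case: path_compP => [r _ sr wr _|] //.
  by congr bpath; apply: qpathP; rewrite ?wr ?sr.
move=> v vp; rewrite path_mulUU /bcomp; case: path_compP => // r vE.
by case/eqP: vp.
Qed.

Lemma bpath_coeff p q : (bpath p)@_q = (p == q)%:R.
Proof. by rewrite bpath.unlock mcoeffU. Qed.

Lemma path_one_coeff v : path_one@_(triv_path v) = 1.
Proof.
rewrite /path_one.
rewrite (big_morph (mcoeff (triv_path v)) (id1 := 0) (op1 := +%R)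
  (mcoeffD (triv_path v)) (mcoeff0 (triv_path v))).
rewrite (bigD1 v) //= bpath_coeff eqxx big1 ?addr0 // => u uv.
rewrite bpath_coeff; case: eqP => // /(congr1 (@path_src e)).
by rewrite /path_src /= => uE; rewrite uE eqxx in uv.
Qed.

Lemma path_one_neq0 : path_one != 0.
Proof.
apply/eqP => /(congr1 (mcoeff (triv_path ord0))).
by rewrite path_one_coeff mcoeff0 => /eqP; rewrite oner_eq0.
Qed.

HB.instance Definition _ := GRing.Zmodule_isNzRing.Build path_alg
  path_mulA path_mul1l path_mul1r path_mulDl path_mulDr path_one_neq0.
HB.instance Definition _ :=
  GRing.Lmodule_isLalgebra.Build k path_alg path_scaleAl.
HB.instance Definition _ :=
  GRing.Lalgebra_isAlgebra.Build k path_alg path_scaleAr.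

End PathAlgebra.

Local Open Scope quotient_scope.

Section Quotient.
Variables (k : fieldType) (A : algType k) (S : A -> Prop).

(* The two-sided ideal generated by S, and the quotient of A by it; ring types
   are non-zero, hence the proof that the ideal is proper. *)
Inductive ideal_gen : A -> Prop :=
| ideal_gen_in x : S x -> ideal_gen x
| ideal_gen0 : ideal_gen 0
| ideal_genD x y : ideal_gen x -> ideal_gen y -> ideal_gen (x + y)
| ideal_genMl a x : ideal_gen x -> ideal_gen (a * x)
| ideal_genMr a x : ideal_gen x -> ideal_gen (x * a).

Definition ideal_pred : {pred A} := fun x => `[< ideal_gen x >].

Lemma ideal_predP x : reflect (ideal_gen x) (x \in ideal_pred).
Proof. exact: asboolP. Qed.

Lemma ideal_pred_zmod_closed : zmod_closed ideal_pred.
Proof.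
split=> [|x y /ideal_predP xI /ideal_predP yI]; apply/ideal_predP.
  exact: ideal_gen0.
by apply: ideal_genD => //; rewrite -mulN1r; apply: ideal_genMl.
Qed.
HB.instance Definition _ :=
  GRing.isZmodClosed.Build A ideal_pred ideal_pred_zmod_closed.

Definition quot_alg & ~ ideal_gen 1 : Type := Quotient.quot ideal_pred.

Hypothesis S1 : ~ ideal_gen 1.
Local Notation Q := (quot_alg S1).
HB.instance Definition _ := GRing.Zmodule.on Q.

Definition quot_proj (x : A) : Q := \pi_(Quotient.quot ideal_pred) x.
Definition quot_lift (x : Q) : A := repr (x : Quotient.quot ideal_pred).

Lemma quot_liftK x : quot_proj (quot_lift x) = x.
Proof. exact: reprK. Qed.

Lemma quot_projP x y : quot_proj x = quot_proj y <-> ideal_gen (x - y).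
Proof.
rewrite /quot_proj; split.
  by move/eqP; rewrite -Quotient.idealrBE => /ideal_predP.
by move=> xy; apply/eqP; rewrite -Quotient.idealrBE; apply/ideal_predP.
Qed.

Lemma quot_projB : zmod_morphism quot_proj.
Proof. by move=> x y; rewrite /quot_proj raddfB. Qed.
HB.instance Definition _ := GRing.isZmodMorphism.Build A Q quot_proj quot_projB.

Definition quot_one : Q := quot_proj 1.
Definition quot_mul (x y : Q) : Q := quot_proj (quot_lift x * quot_lift y).
Definition quot_scale (c : k) (x : Q) : Q := quot_proj (c *: quot_lift x).

Lemma quot_projM x y : quot_proj (x * y) = quot_mul (quot_proj x) (quot_proj y).
Proof.
apply/quot_projP; set x' := quot_lift _; set y' := quot_lift _.
have xx' : ideal_gen (x - x') by apply/quot_projP; rewrite quot_liftK.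
have yy' : ideal_gen (y - y') by apply/quot_projP; rewrite quot_liftK.
have -> : x * y - x' * y' = (x - x') * y + x' * (y - y').
  by rewrite mulrBl mulrBr addrA addrNK.
by apply: ideal_genD; [apply: ideal_genMr | apply: ideal_genMl].
Qed.

Lemma quot_projZ c x : quot_proj (c *: x) = quot_scale c (quot_proj x).
Proof.
apply/quot_projP; rewrite -scalerBr -mulr_algl; apply: ideal_genMl.
by apply/quot_projP; rewrite quot_liftK.
Qed.

Lemma quot_mulA : associative quot_mul.
Proof.
move=> x y z; rewrite -[x]quot_liftK -[y]quot_liftK -[z]quot_liftK.
by rewrite -!quot_projM mulrA.
Qed.

Lemma quot_mul1l : left_id quot_one quot_mul.
Proof. by move=> x; rewrite -[x]quot_liftK -quot_projM mul1r. Qed.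

Lemma quot_mul1r : right_id quot_one quot_mul.
Proof. by move=> x; rewrite -[x]quot_liftK -quot_projM mulr1. Qed.

Lemma quot_mulDl : left_distributive quot_mul +%R.
Proof.
move=> x y z; rewrite -[x]quot_liftK -[y]quot_liftK -[z]quot_liftK.
by rewrite -raddfD -!quot_projM -raddfD mulrDl.
Qed.

Lemma quot_mulDr : right_distributive quot_mul +%R.
Proof.
move=> x y z; rewrite -[x]quot_liftK -[y]quot_liftK -[z]quot_liftK.
by rewrite -raddfD -!quot_projM -raddfD mulrDr.
Qed.

Lemma quot_one_neq0 : quot_one != 0.
Proof.
apply/eqP => one0; apply: S1; rewrite -[1]subr0; apply/quot_projP.
by rewrite -/quot_one one0 raddf0.
Qed.

HB.instance Definition _ := GRing.Zmodule_isNzRing.Build Q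
  quot_mulA quot_mul1l quot_mul1r quot_mulDl quot_mulDr quot_one_neq0.

Lemma quot_scaleA a b x : quot_scale a (quot_scale b x) = quot_scale (a * b) x.
Proof. by rewrite -[x]quot_liftK -!quot_projZ scalerA. Qed.

Lemma quot_scale1 : left_id 1 quot_scale.
Proof. by move=> x; rewrite -[x]quot_liftK -quot_projZ scale1r. Qed.

Lemma quot_scaleDr : right_distributive quot_scale +%R.
Proof.
move=> c x y; rewrite -[x]quot_liftK -[y]quot_liftK.
by rewrite -raddfD -!quot_projZ -raddfD scalerDr.
Qed.

Lemma quot_scaleDl x : {morph quot_scale^~ x : a b / a + b}.
Proof.
move=> a b /=; rewrite -[x]quot_liftK -!quot_projZ.
by rewrite -raddfD scalerDl.
Qed.

HB.instance Definition _ := GRing.Zmodule_isLmodule.Build k Q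
  quot_scaleA quot_scale1 quot_scaleDr quot_scaleDl.

Lemma quot_scaleAl c (x y : Q) : c *: (x * y) = (c *: x) * y.
Proof.
rewrite -[x]quot_liftK -[y]quot_liftK.
change (quot_scale c (quot_mul (quot_proj (quot_lift x)) (quot_proj (quot_lift y)))
  = quot_mul (quot_scale c (quot_proj (quot_lift x))) (quot_proj (quot_lift y))).
by rewrite -quot_projM -!quot_projZ -quot_projM scalerAl.
Qed.

Lemma quot_scaleAr c (x y : Q) : c *: (x * y) = x * (c *: y).
Proof.
rewrite -[x]quot_liftK -[y]quot_liftK.
change (quot_scale c (quot_mul (quot_proj (quot_lift x)) (quot_proj (quot_lift y)))
  = quot_mul (quot_proj (quot_lift x)) (quot_scale c (quot_proj (quot_lift y)))).
by rewrite -quot_projM -!quot_projZ -quot_projM scalerAr.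
Qed.

HB.instance Definition _ := GRing.Lmodule_isLalgebra.Build k Q quot_scaleAl.
HB.instance Definition _ := GRing.Lalgebra_isAlgebra.Build k Q quot_scaleAr.

Lemma quot_proj_monoid : monoid_morphism quot_proj.
Proof. by split=> // x y; exact: quot_projM. Qed.
HB.instance Definition _ :=
  GRing.isMonoidMorphism.Build A Q quot_proj quot_proj_monoid.

Lemma quot_proj_scalable : scalable quot_proj.
Proof. by move=> c x; exact: quot_projZ. Qed.
HB.instance Definition _ :=
  GRing.isScalable.Build k A Q *:%R quot_proj quot_proj_scalable.

End Quotient.

Section StarAlgebra.
Variables (k : fieldType) (e : nat).
Local Notation kQ := (path_alg k e).

Definition alpha (i : vertex e) : kQ := bpath k (arrow_path (Some i)).
Definition delta : kQ := bpath k (arrow_path None).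

(* alpha_{i+n-1} ... alpha_{i+1} alpha_i, indices modulo e. *)
Fixpoint alpha_walk (i : vertex e) (n : nat) : kQ :=
  if n is n'.+1 then alpha (iter n' (@ordS _) i) * alpha_walk i n'
  else bpath k (triv_path i).

Definition alpha_cycle (i : vertex e) : kQ := alpha_walk i e.-1.+1.

Variant star_rel : kQ -> Prop :=
| star_rel_alpha i : star_rel (alpha i * alpha_cycle i ^+ 2)
| star_rel_sqr : star_rel (alpha_cycle ord_max ^+ 2 - delta ^+ 2)
| star_rel_alphadelta : star_rel (alpha ord_max * delta)
| star_rel_deltaalpha : star_rel (delta * alpha (ord_pred ord_max))
| star_rel_delta3 : star_rel (delta ^+ 3).

(* The coefficient of a trivial path is multiplicative and kills the relations,
   so the ideal I is proper. *)
Let eps (x : kQ) : k := mcoeff (triv_path ord0) x.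

Lemma eps_mul (x y : kQ) : eps (x * y) = eps x * eps y.
Proof.
apply: (bil_mulr_morph (@path_alg_ind k e) (@path_mulDl k e) (@path_mulDr k e)
  (@path_scaleAl k e) (@path_scaleAr k e) (phi := eps)).
- exact: mcoeffD.
- by move=> c z; exact: mcoeffZ.
move=> p q; rewrite path_mulUU /bcomp /eps !bpath_coeff.
case: path_compP => [r pq sr wr tr|npq].
  rewrite bpath_coeff -natrM mulnb; congr (nat_of_bool _)%:R.
  apply/eqP/andP => [rE|[/eqP pE /eqP qE]].
    move: wr sr; rewrite rE /path_word /path_src /=.
    case wq : (path_val q).2 => [|//]; case wp : (path_val p).2 => [|//] _ sq.
    have qE : q = triv_path ord0 by exact: qpathP.
    split; apply/eqP => //; apply: qpathP => //.
    by rewrite pq qE.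
  by apply: qpathP; rewrite ?sr ?wr ?pE ?qE.
rewrite mcoeff0; case: eqP => [pE|]; last by rewrite mul0r.
case: eqP => [qE|]; last by rewrite mulr0.
by case: npq; rewrite pE qE.
Qed.

Lemma eps_arrow a : eps (bpath k (arrow_path a)) = 0.
Proof.
by rewrite /eps bpath_coeff; case: eqP => // /(congr1 (@path_word e)).
Qed.

Lemma eps_star_rel x : star_rel x -> eps x = 0.
Proof.
have eC i : eps (alpha_cycle i) = 0.
  by rewrite /alpha_cycle /= eps_mul eps_arrow mul0r.
case=> [i||||].
- by rewrite eps_mul eps_arrow mul0r.
- have epsB y z : eps (y - z) = eps y - eps z by exact: mcoeffB.
  by rewrite epsB 2!expr2 2!eps_mul eC eps_arrow mul0r subr0.
- by rewrite eps_mul eps_arrow mul0r.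
- by rewrite eps_mul eps_arrow mul0r.
- by rewrite exprS eps_mul eps_arrow mul0r.
Qed.

Lemma star_ideal_proper : ~ ideal_gen star_rel 1.
Proof.
suff eps0 x : ideal_gen star_rel x -> eps x = 0.
  by move/eps0/eqP; rewrite /eps path_one_coeff oner_eq0.
elim=> {x} [x /eps_star_rel //|||a x _ IH|a x _ IH].
- exact: mcoeff0.
- move=> x y _ IHx _ IHy; have -> : eps (x + y) = eps x + eps y by exact: mcoeffD.
  by rewrite IHx IHy addr0.
- by rewrite eps_mul IH mulr0.
- by rewrite eps_mul IH mul0r.
Qed.

Definition Lambda := quot_alg star_ideal_proper.
HB.instance Definition _ := GRing.Algebra.on Lambda.

Definition L_idem (i : vertex e) : Lambda := quot_proj _ (bpath k (triv_path i)).
Definition L_arrow (a : arrow e) : Lambda := quot_proj _ (bpath k (arrow_path a)).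

End StarAlgebra.

Section Modules.
Variable A : pzRingType.

Definition fin_gen (V : lmodType A) : Prop :=
  exists (n : nat) (g : 'I_n -> V), forall v, exists a : 'I_n -> A,
    v = \sum_i a i *: g i.

Definition mod_iso (V W : lmodType A) : Prop :=
  exists f : {linear V -> W}, bijective f.

Definition surjective (T U : Type) (f : T -> U) : Prop :=
  forall y, exists x, f x = y.

Definition projective (P : lmodType A) : Prop :=
  forall (X Y : lmodType A) (g : {linear X -> Y}) (h : {linear P -> Y}),
    surjective g -> exists l : {linear P -> X}, forall p, g (l p) = h p.

Definition injective_module (I : lmodType A) : Prop :=
  forall (X Y : lmodType A) (i : {linear X -> Y}) (h : {linear X -> I}),
    injective i -> exists l : {linear Y -> I}, forall x, l (i x) = h x.

Definition submodule (V : lmodType A) (N : V -> Prop) : Prop :=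
  N 0 /\ forall a x y, N x -> N y -> N (a *: x + y).

Definition superfluous (V : lmodType A) (K : V -> Prop) : Prop :=
  forall N : V -> Prop, submodule N ->
    (forall x, exists y z, [/\ N y, K z & x = y + z]) -> forall x, N x.

Definition essential (V : lmodType A) (K : V -> Prop) : Prop :=
  forall N : V -> Prop, submodule N ->
    (forall x, N x -> K x -> x = 0) -> forall x, N x -> x = 0.

Definition projective_cover (P V : lmodType A) (p : {linear P -> V}) : Prop :=
  [/\ fin_gen P, projective P, surjective p & superfluous (fun x => p x = 0)].

Definition injective_hull (V I : lmodType A) (i : {linear V -> I}) : Prop :=
  [/\ fin_gen I, injective_module I, injective i
    & essential (fun x => exists v, i v = x)].

Definition short_exact (U V W : lmodType A)
    (i : {linear U -> V}) (p : {linear V -> W}) : Prop :=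
  [/\ injective i, surjective p & forall x, p x = 0 <-> exists u, i u = x].

Definition is_syzygy (V W : lmodType A) : Prop :=
  exists (P : lmodType A) (i : {linear W -> P}) (p : {linear P -> V}),
    projective_cover p /\ short_exact i p.

Definition is_cosyzygy (V W : lmodType A) : Prop :=
  exists (I : lmodType A) (i : {linear V -> I}) (p : {linear I -> W}),
    injective_hull i /\ short_exact i p.

(* Negative powers of the syzygy functor are iterated cokernels of injective
   hulls. *)
Fixpoint iter_rel (r : lmodType A -> lmodType A -> Prop) (n : nat)
    (V W : lmodType A) : Prop :=
  if n is n'.+1 then exists2 U, iter_rel r n' V U & r U W else mod_iso V W.

Definition is_Omega_power (j : int) (V W : lmodType A) : Prop :=
  match j with
  | Posz n => iter_rel is_syzygy n V W
  | Negz n => iter_rel is_cosyzygy n.+1 V W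
  end.

Definition in_Omega_orbit (V W : lmodType A) : Prop :=
  exists j : int, is_Omega_power j V W.

Definition factors_through_projective (V W : lmodType A)
    (f : {linear V -> W}) : Prop :=
  exists (P : lmodType A) (g : {linear V -> P}) (h : {linear P -> W}),
    [/\ fin_gen P, projective P & forall v, f v = h (g v)].

(* End(V) modulo the maps factoring through a projective is isomorphic, as a
   ring, to F: a surjective ring morphism from End(V) to F with that kernel. *)
Definition stable_End_iso (F : pzRingType) (V : lmodType A) : Prop :=
  exists r : {linear V -> V} -> F,
    [/\ forall f g : {linear V -> V}, r (f \+ g) = r f + r g,
        forall f g : {linear V -> V}, r (f \o g) = r f * r g,
        r idfun = 1,
        surjective r
      & forall f, r f = 0 <-> factors_through_projective f].

(* The stable Auslander-Reiten quiver of a self-injective algebra: its vertices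
   are the non-projective indecomposable finitely generated modules (up to
   isomorphism), with an arrow where there is an irreducible map. *)
Definition indecomposable (V : lmodType A) : Prop :=
  (exists v : V, v <> 0) /\
  forall X Y : lmodType A, mod_iso V (X * Y)%type ->
    (forall x : X, x = 0) \/ (forall y : Y, y = 0).

Definition split_mono (V W : lmodType A) (f : {linear V -> W}) : Prop :=
  exists r : {linear W -> V}, forall v, r (f v) = v.

Definition split_epi (V W : lmodType A) (f : {linear V -> W}) : Prop :=
  exists s : {linear W -> V}, forall w, f (s w) = w.

Definition irreducible_map (V W : lmodType A) (f : {linear V -> W}) : Prop :=
  [/\ ~ split_mono f, ~ split_epi f
    & forall (Z : lmodType A) (g : {linear V -> Z}) (h : {linear Z -> W}),
        fin_gen Z -> (forall v, f v = h (g v)) -> split_mono g \/ split_epi h].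

Definition AR_vertex (V : lmodType A) : Prop :=
  [/\ fin_gen V, indecomposable V & ~ projective V].

Definition AR_arrow (V W : lmodType A) : Prop :=
  exists f : {linear V -> W}, irreducible_map f.

Inductive AR_connected (V : lmodType A) : lmodType A -> Prop :=
| AR_connected_iso W : mod_iso V W -> AR_connected V W
| AR_connected_to U W :
    AR_connected V U -> AR_vertex W -> AR_arrow U W -> AR_connected V W
| AR_connected_from U W :
    AR_connected V U -> AR_vertex W -> AR_arrow W U -> AR_connected V W.

Definition AR_component (C : lmodType A -> Prop) : Prop :=
  exists2 V, AR_vertex V & forall W, C W <-> AR_connected V W.

End Modules.

Section LocalAlgebras.
Variable k : fieldType.

Definition is_ideal (R : comAlgType k) (I : R -> Prop) : Prop :=
  I 0 /\ forall a x y, I x -> I y -> I (a * x + y).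

Definition noetherian (R : comAlgType k) : Prop :=
  forall I : R -> Prop, is_ideal I -> exists (n : nat) (g : 'I_n -> R),
    forall x, I x <-> exists a : 'I_n -> R, x = \sum_i a i * g i.

Definition ideal_pow (R : comAlgType k) (I : R -> Prop) (n : nat) (x : R) : Prop :=
  exists (s : nat) (a : 'I_s -> R) (c : 'I_s -> 'I_n -> R),
    (forall i j, I (c i j)) /\ x = \sum_i a i * \prod_j c i j.

(* The canonical map from R to the inverse limit of the R / I ^ n is bijective:
   a compatible sequence (u n mod I ^ n) has a limit in R. *)
Definition adic_complete (R : comAlgType k) (I : R -> Prop) : Prop :=
  (forall x, (forall n, ideal_pow I n x) -> x = 0) /\
  (forall u : nat -> R, (forall n, ideal_pow I n (u n.+1 - u n)) ->
     exists l, forall n, ideal_pow I n (l - u n)).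

(* Complete local commutative Noetherian k-algebras with residue field k. *)
Record Chat := MkChat {
  chat_ring :> comAlgType k;
  residue : {lrmorphism chat_ring -> k^o};
  chat_local : forall x, residue x <> 0 -> exists y, x * y = 1;
  chat_noetherian : noetherian chat_ring;
  chat_complete : adic_complete (fun x => residue x = 0) }.

Definition Chat_hom (R S : Chat) :=
  {f : {lrmorphism R -> S} | forall x, residue S (f x) = residue R x}.

End LocalAlgebras.

Section Deformations.
Variables (k : fieldType) (A : algType k).

(* A module over the tensor product of R and A over k: an R-module together with
   a k-algebra morphism from A to its R-linear endomorphisms. *)
Record tensor_module (R : comAlgType k) := TensorModule {
  tmod_sort :> lmodType R;
  act : A -> {linear tmod_sort -> tmod_sort};
  act1 : forall m, act 1 m = m;
  actM : forall a b m, act (a * b) m = act a (act b m);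
  actD : forall a b m, act (a + b) m = act a m + act b m;
  actZ : forall c a m, act (c *: a) m = (c%:A : R) *: act a m }.

(* An A-module as a module over the tensor product of k and A; the coefficient
   ring k is written k^o when it is seen as an algebra over itself. *)
Section Restriction.
Variable V : lmodType A.
Definition restr : Type := V.
HB.instance Definition _ := GRing.Zmodule.on restr.
Definition restr_scale (c : k^o) (v : restr) : restr := (c%:A : A) *: (v : V).
Lemma restr_scaleA a b v : restr_scale a (restr_scale b v) = restr_scale (a * b) v.
Proof. by rewrite /restr_scale scalerA -scalerAl mul1r scalerA. Qed.
Lemma restr_scale1 : left_id 1 restr_scale.
Proof. by move=> v; rewrite /restr_scale !scale1r. Qed.
Lemma restr_scaleDr : right_distributive restr_scale +%R.
Proof. by move=> c v w; rewrite /restr_scale scalerDr. Qed.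
Lemma restr_scaleDl v : {morph restr_scale^~ v : a b / a + b}.
Proof. by move=> a b; rewrite /restr_scale !scalerDl. Qed.
HB.instance Definition _ := GRing.Zmodule_isLmodule.Build k^o restr
  restr_scaleA restr_scale1 restr_scaleDr restr_scaleDl.

Definition restr_act (a : A) (v : restr) : restr := a *: (v : V).
Lemma restr_act_linear a : linear (restr_act a).
Proof.
move=> c v w; rewrite /restr_act.
change (a *: ((c%:A : A) *: (v : V) + (w : V)) =
        (c%:A : A) *: (a *: (v : V)) + a *: (w : V)).
by rewrite scalerDr !scalerA -scalerAr mulr1 -scalerAl mul1r.
Qed.
HB.instance Definition _ a :=
  GRing.isLinear.Build k^o restr restr *:%R (restr_act a) (restr_act_linear a).

Definition restr_tmod : tensor_module k^o.
Proof.
refine (@TensorModule k^o restr restr_act _ _ _ _).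
- by move=> m; rewrite /= /restr_act scale1r.
- by move=> a b m; rewrite /= /restr_act scalerA.
- by move=> a b m; rewrite /= /restr_act scalerDl.
- move=> c a m; rewrite /= /restr_act.
  change ((c *: a) *: (m : V) = ((c * 1)%:A : A) *: (a *: (m : V))).
  by rewrite mulr1 scalerA -scalerAl mul1r.
Defined.
End Restriction.

Definition semilinear (R S : comAlgType k) (f : {lrmorphism R -> S})
    (M : lmodType R) (N : lmodType S) (b : M -> N) : Prop :=
  forall r x y, b (r *: x + y) = f r *: b x + b y.

(* b : M -> N exhibits N as the scalar extension of M along f, with the induced
   action of A: the universal property of the tensor product of S and M over R. *)
Definition is_base_change (R S : comAlgType k) (f : {lrmorphism R -> S})
    (M : tensor_module R) (N : tensor_module S) (b : M -> N) : Prop :=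
  [/\ semilinear f b,
      forall a x, b (act M a x) = act N a (b x)
    & forall (P : lmodType S) (g : M -> P), semilinear f g ->
        exists h : {linear N -> P}, (forall x, h (b x) = g x) /\
          forall h' : {linear N -> P}, (forall x, h' (b x) = g x) -> h' =1 h].

(* An isomorphism from the tensor product of k and M over R to V is given by the
   induced map lift_red : M -> V. *)
Record lift (V : lmodType A) (R : Chat k) := Lift {
  lift_mod :> tensor_module R;
  lift_free : exists (d : nat) (f : {linear 'rV[R]_d -> lift_mod}), bijective f;
  lift_red : lift_mod -> V;
  lift_redP : is_base_change (N := restr_tmod V) (residue R) lift_red }.

Arguments lift_red {V R} l x.

Definition lift_iso (V : lmodType A) (R : Chat k) (L L' : lift V R) : Prop :=
  exists f : {linear L -> L'},
    [/\ bijective f, forall a x, f (act L a x) = act L' a (f x)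
      & forall x, lift_red L' (f x) = lift_red L x].

Definition lift_pushforward (V : lmodType A) (R S : Chat k)
    (f : Chat_hom R S) (L : lift V R) (L' : lift V S) : Prop :=
  exists b : L -> L', is_base_change (sval f) b /\
    forall x, lift_red L' (b x) = lift_red L x.

(* R represents the functor of isomorphism classes of lifts of V: Phi is a natural
   bijection from Hom(R, -), given on representatives. *)
Definition is_universal_deformation_ring (V : lmodType A) (R : Chat k) : Prop :=
  exists Phi : forall S : Chat k, Chat_hom R S -> lift V S,
    [/\ forall S f g, lift_iso (Phi S f) (Phi S g) -> sval f =1 sval g,
        forall S (L : lift V S), exists f, lift_iso (Phi S f) L
      & forall S T (f : Chat_hom R S) (g : Chat_hom S T) (h : Chat_hom R T),
          (forall x, sval h x = sval g (sval f x)) ->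
          lift_pushforward g (Phi S f) (Phi T h)].

End Deformations.

(* The power series ring k[[t]]; fps_coef f n is the coefficient of t ^ n. *)
Record fps (k : fieldType) := FPS { fps_coef : nat -> k }.

Section PowerSeries.
Variable k : fieldType.
Local Notation fps := (fps k).
Implicit Types (f g h : fps) (c : k) (n : nat).

HB.instance Definition _ := gen_eqMixin fps.
HB.instance Definition _ := gen_choiceMixin fps.

Lemma fpsP f g : (forall n, fps_coef f n = fps_coef g n) -> f = g.
Proof. by case: f g => [f] [g] /= /funext ->. Qed.

Definition fps_zero : fps := FPS (fun=> 0).
Definition fps_opp f : fps := FPS (fun n => - fps_coef f n).
Definition fps_add f g : fps := FPS (fun n => fps_coef f n + fps_coef g n).
Definition fps_one : fps := FPS (fun n => (n == 0)%:R).
Definition fps_mul f g : fps :=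
  FPS (fun n => \sum_(i < n.+1) fps_coef f i * fps_coef g (n - i)).
Definition fps_scale c f : fps := FPS (fun n => c * fps_coef f n).

Lemma fps_addA : associative fps_add.
Proof. by move=> f g h; apply: fpsP => n; exact: addrA. Qed.
Lemma fps_addC : commutative fps_add.
Proof. by move=> f g; apply: fpsP => n; exact: addrC. Qed.
Lemma fps_add0 : left_id fps_zero fps_add.
Proof. by move=> f; apply: fpsP => n; exact: add0r. Qed.
Lemma fps_addN : left_inverse fps_zero fps_opp fps_add.
Proof. by move=> f; apply: fpsP => n; exact: addNr. Qed.
HB.instance Definition _ :=
  GRing.isZmodule.Build fps fps_addA fps_addC fps_add0 fps_addN.

Let trunc m f : {poly k} := \poly_(i < m.+1) fps_coef f i.

Lemma fps_mul_trunc m n f g : (n <= m)%N ->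
  fps_coef (fps_mul f g) n = (trunc m f * trunc m g)`_n.
Proof.
move=> nm; rewrite coefM; apply: eq_bigr => i _; rewrite !coef_poly !ltnS.
by rewrite (leq_trans (leq_ord i) nm) (leq_trans (leq_subr i n) nm).
Qed.

Lemma fps_mulC : commutative fps_mul.
Proof. by move=> f g; apply: fpsP => n; rewrite !(fps_mul_trunc _ _ (leqnn n)) mulrC. Qed.

Lemma fps_mulA : associative fps_mul.
Proof.
move=> f g h; apply: fpsP => n.
transitivity ((trunc n f * (trunc n g * trunc n h))`_n).
  rewrite coefM; apply: eq_bigr => i _; rewrite coef_poly ltnS leq_ord.
  by rewrite (fps_mul_trunc _ _ (leq_subr i n)).
rewrite mulrA coefM; apply: eq_bigr => i _.
by rewrite coef_poly ltnS leq_subr -(fps_mul_trunc _ _ (leq_ord i)).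
Qed.

Lemma fps_mul1 : left_id fps_one fps_mul.
Proof.
move=> f; apply: fpsP => n; rewrite /= big_ord_recl /= mul1r subn0.
by rewrite big1 ?addr0 // => i _; rewrite mul0r.
Qed.

Lemma fps_mulDl : left_distributive fps_mul fps_add.
Proof.
move=> f g h; apply: fpsP => n; rewrite /= -big_split.
by apply: eq_bigr => i _; rewrite mulrDl.
Qed.

Lemma fps_one_neq0 : fps_one != fps_zero.
Proof.
by apply/eqP => /(congr1 (@fps_coef k))/(congr1 (@^~ 0))/eqP; rewrite oner_eq0.
Qed.

HB.instance Definition _ := GRing.Zmodule_isComNzRing.Build fps
  fps_mulA fps_mulC fps_mul1 fps_mulDl fps_one_neq0.

Lemma fps_scaleA a b f : fps_scale a (fps_scale b f) = fps_scale (a * b) f.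
Proof. by apply: fpsP => n; exact: mulrA. Qed.
Lemma fps_scale1 : left_id 1 fps_scale.
Proof. by move=> f; apply: fpsP => n; exact: mul1r. Qed.
Lemma fps_scaleDr : right_distributive fps_scale +%R.
Proof. by move=> c f g; apply: fpsP => n; exact: mulrDr. Qed.
Lemma fps_scaleDl f : {morph fps_scale^~ f : a b / a + b}.
Proof. by move=> a b; apply: fpsP => n; exact: mulrDl. Qed.
HB.instance Definition _ := GRing.Zmodule_isLmodule.Build k fps
  fps_scaleA fps_scale1 fps_scaleDr fps_scaleDl.

Lemma fps_scaleAl c f g : c *: (f * g) = (c *: f) * g.
Proof.
apply: fpsP => n; rewrite /= mulr_sumr.
by apply: eq_bigr => i _; rewrite mulrA.
Qed.
HB.instance Definition _ := GRing.Lmodule_isLalgebra.Build k fps fps_scaleAl.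
HB.instance Definition _ := GRing.Lalgebra_isComAlgebra.Build k fps.

End PowerSeries.

Section BandModules.
Variables (k : fieldType) (e : nat).
Local Notation Lam := (Lambda k e).

Definition jordan_block (n : nat) (lam : k) : 'M[k]_n :=
  \matrix_(i, j) (lam *+ (i == j) + (i.+1 == j)%:R).

Section Representation.
Variables (n : nat) (lam : k).

(* A vector (x, y) has a component x i at each vertex i, and a second component
   y at the vertex e; alpha_i sends x i to y if it ends at e, and to the component
   at i + 1 otherwise. *)
Definition band_space := ({ffun vertex e -> 'cV[k]_n} * 'cV[k]_n)%type.

Definition band_vertex (i : vertex e) (w : band_space) : band_space :=
  ([ffun j => if j == i then w.1 j else 0], if i == ord_max then w.2 else 0).

Definition band_arrow (a : arrow e) (w : band_space) : band_space :=
  match a with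
  | Some i => if ordS i == ord_max then (0, w.1 i)
              else ([ffun j => if j == ordS i then w.1 i else 0], 0)
  | None => (0, jordan_block n lam *m w.1 ord_max)
  end.

(* V is isomorphic to B(n, lam): the total space of the representation maps
   k-linearly and bijectively to V, compatibly with vertices and arrows. *)
Definition is_band_module (V : lmodType Lam) : Prop :=
  exists phi : band_space -> V,
    [/\ bijective phi,
        forall c w w', phi (c *: w + w') = (c%:A : Lam) *: phi w + phi w',
        forall i w, phi (band_vertex i w) = L_idem k i *: phi w
      & forall a w, phi (band_arrow a w) = L_arrow k a *: phi w].

End Representation.

(* The homogeneous tubes of rank one are the components formed by the band
   modules with a fixed lam; when e = 1 the tubes of string modules also have
   rank one but are not homogeneous tubes in this sense. *)
Definition homogeneous_tube (C : lmodType Lam -> Prop) : Prop :=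
  AR_component C /\
  exists2 lam : k, lam != 0 &
    forall V, C V <-> exists2 n, (0 < n)%N & is_band_module n lam V.

End BandModules.

(* Main.v *)
Require Import Defs.
From HB Require Import structures.
From mathcomp Require Import all_boot all_algebra.
From mathcomp Require Import finmap boolp zify.
From mathcomp.multinomials Require Import monalg.

Set Implicit Arguments.
Unset Strict Implicit.
Unset Printing Implicit Defensive.

Import GRing.Theory.
Local Open Scope ring_scope.

(* Let P be the projective cover of the simple module at the vertex e, and let C
   be the cycle at e.  The module B(1, lam) is P modulo delta - lam C, and its
   syzygy, generated by delta - lam C, is B(1, -1/lam); as P is also the injective
   hull of B(1, lam), so is its cosyzygy.

   An endomorphism of B(n, lam) that factors through a projective module factors
   through the cover by copies of P, hence maps into the radical.  Two nilpotent
   endomorphisms must vanish in a stable endomorphism ring isomorphic to k: the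
   one induced by the elementary matrix E_{1n}, which forces n = 1, and, for n = 1,
   the map x |-> y, which factors through P only if 1 + lam^2 <> 0.

   In a lift of B(1, lam) over R let x lift the generator, with e_e x = x.  The
   walks applied to x form a basis, so delta x = a x + b C x with a in the maximal
   ideal and b congruent to lam.  The relations alpha_e delta = 0 and
   C^2 = delta^2 give a (1 + b^2) = 0, so a = 0: lifts are classified by b - lam,
   which is what k[[t]] represents. *)

(** The parameters lam and -1/lam alternate along the Omega-orbit, which therefore leaves the tube
    unless lam^2 = -1. The condition 1 + mu^2 <> 0 is unchanged by mu |-> -1/mu. It is extracted
    from the stable endomorphism ring at mu = lam, and at every mu of the orbit it makes 1 + b^2 a
    unit. So the orbit is followed only through mu <> 0 and 1 + mu^2 <> 0, without comparing stable
    endomorphism rings along it. A syzygy or cosyzygy is given by an arbitrary projective cover or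
    injective hull, of which only the defining property is known, and Lambda-modules carry no
    dimension. Covers and hulls are therefore identified with P by hand: P has explicit coordinates,
    a simple socle that detects injectivity, and a top coefficient that detects generators; its
    injectivity enters through the symmetrizing form of Lambda. *)

(** * Representations of Lambda *)

(* The vertex reached from the vertex e after j arrows alpha. *)
Definition vt (e : nat) (j : nat) : vertex e := iter j (@ordS _) ord_max.

Lemma val_iter_ordS n (i : 'I_n) j : (iter j (@ordS _) i : nat) = ((i + j) %% n)%N.
Proof.
case: n i => [[]//|n] i.
elim: j => [|j IH]; first by rewrite addn0 modn_small.
by rewrite iterS /= IH addnS -addn1 modnDml addn1.
Qed.

Lemma iter_ordSE e (i : vertex e) : iter e.-1.+1 (@ordS _) i = i.
Proof. by apply: val_inj; rewrite [LHS]val_iter_ordS modnDr modn_small. Qed.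

Lemma vtE e : vt e e.-1.+1 = ord_max. Proof. exact: iter_ordSE. Qed.

Lemma vtD e j l : vt e (j + l) = iter j (@ordS _) (vt e l).
Proof. exact: iterD. Qed.

Lemma vt_eq0 e j :
  (j <= e.-1.+1)%N -> vt e j = ord_max -> j = 0%N \/ j = e.-1.+1.
Proof.
move=> jE /(congr1 val); rewrite /= val_iter_ordS /= => H.
case: j jE H => [|j]; first by left.
rewrite addnS -addSn addnC modnDr => jE H; right.
have {}jE : (j <= e.-1)%N by [].
by rewrite modn_small in H; [rewrite H | rewrite ltnS].
Qed.

Section LambdaFacts.
Variables (k : fieldType) (e : nat).
Local Notation Lam := (Lambda k e).
Local Notation kQ := (path_alg k e).
Local Notation proj := (quot_proj (@star_ideal_proper k e)).
Local Notation idem := (@L_idem k e).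
Local Notation arr := (@L_arrow k e).
Local Notation E := e.-1.+1.

Lemma projM x y : proj (x * y) = proj x * proj y.
Proof. exact: rmorphM. Qed.

Lemma projZ c (x : kQ) : proj (c *: x) = c *: proj x.
Proof. exact: linearZ. Qed.

Lemma projB x y : proj (x - y) = proj x - proj y.
Proof. exact: rmorphB. Qed.

Lemma bpath_mul (p q : qpath e) : bpath k p * bpath k q = bcomp k p q.
Proof. exact: path_mulUU. Qed.

Lemma path_comp_id (p q r : qpath e) :
  path_src p = path_tgt q -> path_src r = path_src q ->
  path_word r = path_word q ++ path_word p -> bpath k p * bpath k q = bpath k r.
Proof.
move=> pq sr wr; rewrite bpath_mul /bcomp; case: path_compP => // r' _ s' w' _.
by congr bpath; apply: qpathP; rewrite ?s' ?w'.
Qed.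

Lemma path_comp_neq (p q : qpath e) :
  path_src p <> path_tgt q -> bpath k p * bpath k q = 0.
Proof.
by move=> pq; rewrite bpath_mul /bcomp; case: path_compP.
Qed.

Lemma idemM u v : idem u * idem v = if u == v then idem u else 0.
Proof.
rewrite /L_idem -projM; case: eqP => [->|uv].
  by rewrite (path_comp_id (r := triv_path v)).
by rewrite path_comp_neq ?rmorph0.
Qed.

Lemma sum_idem : \sum_v idem v = 1.
Proof. by rewrite -(rmorph_sum proj); exact: rmorph1. Qed.

Lemma arr_idem a v : arr a * idem v = if v == arrow_src a then arr a else 0.
Proof.
rewrite /L_idem -projM; case: eqP => [->|uv].
  by rewrite (path_comp_id (r := arrow_path a)).
by rewrite path_comp_neq ?rmorph0 // => vE; apply: uv; rewrite -[v]vE.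
Qed.

Lemma idem_arr a v : idem v * arr a = if v == arrow_tgt a then arr a else 0.
Proof.
rewrite /L_idem -projM; case: eqP => [->|uv].
  by rewrite (path_comp_id (r := arrow_path a)).
by rewrite path_comp_neq ?rmorph0.
Qed.

(** Composition runs from right to left, so the last arrow of a path is its left factor: growing
    paths at their end is left multiplication, the form in which linearity of maps is checked
    later. *)
Lemma Lambda_ind (Q : Lam -> Prop) :
  (forall x y, Q x -> Q y -> Q (x + y)) -> (forall c x, Q x -> Q (c *: x)) ->
  (forall v, Q (idem v)) -> (forall a x, Q x -> Q (arr a * x)) ->
  forall x, Q x.
Proof.
move=> QD QZ Qi Qa x; rewrite -[x]quot_liftK; move: (quot_lift x) => {x}.
apply: path_alg_ind => [|x y Qx Qy|c x Qx|[[v w] vw]].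
- by rewrite rmorph0 -(scale0r (idem ord_max)); apply: QZ.
- by rewrite rmorphD; apply: QD.
- by rewrite linearZ; apply: QZ.
elim/last_ind: w vw => [|w a IH] vw.
  by rewrite (_ : QPath vw = triv_path v); [exact: Qi | exact: qpathP].
have : walk v (w ++ [:: a]) by rewrite cats1.
rewrite walk_cat /= andbT => /andP[wv /eqP sa].
rewrite -(path_comp_id (p := arrow_path a) (q := @QPath e (v, w) wv)) ?projM //=.
  exact: Qa.
by rewrite /path_word /= cats1.
Qed.

Lemma rel0 x : star_rel x -> proj x = 0.
Proof.
move=> xS; rewrite -[RHS](rmorph0 proj); apply/quot_projP; rewrite subr0.
exact: ideal_gen_in.
Qed.

End LambdaFacts.

Lemma bil_mx_antimorph (k : fieldType) (V : lmodType k) (I : Type) (b : I -> V)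
    (mul : V -> V -> V) (S : comAlgType k) (N : nat) (phi : V -> 'M[S]_N) :
  (forall P : V -> Prop, P 0 -> (forall x y, P x -> P y -> P (x + y)) ->
     (forall c x, P x -> P (c *: x)) -> (forall i, P (b i)) -> forall x, P x) ->
  left_distributive mul +%R -> right_distributive mul +%R ->
  (forall c x y, c *: mul x y = mul (c *: x) y) ->
  (forall c x y, c *: mul x y = mul x (c *: y)) ->
  (forall x y, phi (x + y) = phi x + phi y) ->
  (forall c x, phi (c *: x) = (c%:A : S) *: phi x) ->
  (forall i j, phi (mul (b i) (b j)) = phi (b j) *m phi (b i)) ->
  forall x y, phi (mul x y) = phi y *m phi x.
Proof.
move=> b_ind mulDl mulDr mulZl mulZr pD pZ pb x y.
have p0 : phi 0 = 0 by rewrite -(scale0r 0) pZ !scale0r.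
elim/b_ind: x => [|x x' IH IH'|c x IH|i].
- by rewrite (bil_mul0l mulZl) p0 mulmx0.
- by rewrite mulDl !pD IH IH' mulmxDr.
- by rewrite -mulZl !pZ IH scalemxAr.
elim/b_ind: y => [|y y' IH IH'|c y IH|j]; last exact: pb.
- by rewrite (bil_mul0r mulZr) p0 mul0mx.
- by rewrite mulDr !pD IH IH' mulmxDl.
- by rewrite -mulZr !pZ IH scalemxAl.
Qed.

(* Modules are spaces of row vectors, so that a path acts by the product of the
   matrices of its arrows in order of traversal. *)
Section Representation.
Variables (k : fieldType) (e : nat) (S : comAlgType k) (N : nat).
Variables (Ev : vertex e -> 'M[S]_N) (F : arrow e -> 'M[S]_N).
Local Notation Lam := (Lambda k e).
Local Notation E := e.-1.+1.

Definition path_mx (p : qpath e) : 'M[S]_N :=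
  foldl (fun M a => M *m F a) (Ev (path_src p)) (path_word p).

Definition path_alg_mx (x : path_alg k e) : 'M[S]_N :=
  \sum_(p <- msupp x) ((x@_p)%:A : S) *: path_mx p.

Fixpoint walk_mx (i : vertex e) (n : nat) : 'M[S]_N :=
  if n is n'.+1 then walk_mx i n' *m F (Some (iter n' (@ordS _) i)) else Ev i.

Record is_rep : Prop := IsRep {
  rep_idem : forall u v, Ev u *m Ev v = if u == v then Ev u else 0;
  rep_sum : \sum_v Ev v = 1%:M;
  rep_src : forall a, Ev (arrow_src a) *m F a = F a;
  rep_tgt : forall a, F a *m Ev (arrow_tgt a) = F a;
  rep_rel_alpha : forall i, walk_mx i E *m walk_mx i E *m F (Some i) = 0;
  rep_rel_sqr : walk_mx ord_max E *m walk_mx ord_max E = F None *m F None;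
  rep_rel_alphadelta : F None *m F (Some ord_max) = 0;
  rep_rel_deltaalpha : F (Some (ord_pred ord_max)) *m F None = 0;
  rep_rel_delta3 : F None *m F None *m F None = 0 }.

Hypothesis HF : is_rep.

Lemma path_alg_mxw (d : {fset qpath e}) (x : path_alg k e) :
  (msupp x `<=` d)%fset ->
  path_alg_mx x = \sum_(p <- d) ((x@_p)%:A : S) *: path_mx p.
Proof.
move=> le; apply: big_fset_incl => // p _ /mcoeff_outdom ->.
by rewrite !scale0r.
Qed.

Lemma path_alg_mxD x y : path_alg_mx (x + y) = path_alg_mx x + path_alg_mx y.
Proof.
rewrite (path_alg_mxw (msuppD_le x y)) (path_alg_mxw (fsubsetUl _ (msupp y))).
rewrite (path_alg_mxw (fsubsetUr (msupp x) _)) -big_split.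
by apply: eq_bigr => p _; rewrite mcoeffD !scalerDl.
Qed.

Lemma path_alg_mxZ c x : path_alg_mx (c *: x) = (c%:A : S) *: path_alg_mx x.
Proof.
rewrite (path_alg_mxw (msuppZ_le c x)) scaler_sumr.
apply: eq_bigr => p _.
by rewrite mcoeffZ scalerA -scalerAl mul1r scalerA.
Qed.

Lemma path_alg_mx0 : path_alg_mx 0 = 0.
Proof. by rewrite -(scale0r 0) path_alg_mxZ !scale0r. Qed.

Lemma path_alg_mxU p : path_alg_mx (bpath k p) = path_mx p.
Proof.
by rewrite bpath.unlock (path_alg_mxw msuppU_le) big_seq_fset1 mcoeffUU !scale1r.
Qed.

Lemma path_mx_tgt p : path_mx p *m Ev (path_tgt p) = path_mx p.
Proof.
case: p => [[v w] vw]; rewrite /path_mx /path_tgt /path_src /path_word /=.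
case: {vw}w / (lastP w) => [|w a] /=; first by rewrite (rep_idem HF) eqxx.
by rewrite foldl_rcons map_rcons last_rcons -mulmxA (rep_tgt HF).
Qed.

Lemma foldl_mulmx (M : 'M[S]_N) w :
  foldl (fun M a => M *m F a) M w = M *m foldl (fun M a => M *m F a) 1%:M w.
Proof.
elim/last_ind: w => [|w a IH]; first by rewrite mulmx1.
by rewrite !foldl_rcons IH mulmxA.
Qed.

Lemma path_alg_mxM x y : path_alg_mx (x * y) = path_alg_mx y *m path_alg_mx x.
Proof.
apply: (bil_mx_antimorph (@path_alg_ind k e) (@path_mulDl k e) (@path_mulDr k e)
  (@path_scaleAl k e) (@path_scaleAr k e) path_alg_mxD path_alg_mxZ) => p q.
rewrite [path_mul _ _]bpath_mul /bcomp; case: path_compP => [r pq sr wr _|pq].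
  rewrite !path_alg_mxU {1}/path_mx sr wr foldl_cat -/(path_mx q).
  by rewrite foldl_mulmx [path_mx p]foldl_mulmx pq mulmxA path_mx_tgt.
rewrite path_alg_mx0 !path_alg_mxU -(path_mx_tgt q) [path_mx p]foldl_mulmx.
rewrite -mulmxA (mulmxA (Ev _)) (rep_idem HF) eq_sym.
by case: eqP => // _; rewrite mul0mx mulmx0.
Qed.

Lemma path_alg_mx_arrow a : path_alg_mx (bpath k (arrow_path a)) = F a.
Proof. by rewrite path_alg_mxU /path_mx /= (rep_src HF). Qed.

Lemma path_alg_mx_walk i n : path_alg_mx (alpha_walk k i n) = walk_mx i n.
Proof.
by elim: n => [|n IH] /=; rewrite ?path_alg_mxU // path_alg_mxM IH path_alg_mx_arrow.
Qed.

Lemma path_alg_mx_ideal x : ideal_gen (@star_rel k e) x -> path_alg_mx x = 0.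
Proof.
elim=> {x} [x|||a x _ IH|a x _ IH].
- have cycE i : path_alg_mx (alpha_cycle k i ^+ 2) = walk_mx i E *m walk_mx i E.
    by rewrite expr2 path_alg_mxM [path_alg_mx _]path_alg_mx_walk.
  have deltaE : path_alg_mx (delta k e ^+ 2) = F None *m F None.
    by rewrite expr2 path_alg_mxM path_alg_mx_arrow.
  case=> [i||||].
  + by rewrite path_alg_mxM cycE path_alg_mx_arrow (rep_rel_alpha HF).
  + rewrite path_alg_mxD -scaleN1r path_alg_mxZ cycE deltaE (rep_rel_sqr HF).
    by rewrite !scaleN1r addrN.
  + by rewrite path_alg_mxM !path_alg_mx_arrow (rep_rel_alphadelta HF).
  + by rewrite path_alg_mxM !path_alg_mx_arrow (rep_rel_deltaalpha HF).
  + by rewrite exprS path_alg_mxM deltaE path_alg_mx_arrow (rep_rel_delta3 HF).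
- exact: path_alg_mx0.
- by move=> x y _ IHx _ IHy; rewrite path_alg_mxD IHx IHy addr0.
- by rewrite path_alg_mxM IH mul0mx.
- by rewrite path_alg_mxM IH mulmx0.
Qed.

Definition rep_mx (a : Lam) : 'M[S]_N :=
  path_alg_mx (quot_lift (S1 := @star_ideal_proper k e) a).

Lemma rep_mx_proj x : rep_mx (quot_proj _ x) = path_alg_mx x.
Proof.
have /quot_projP/path_alg_mx_ideal := quot_liftK (quot_proj (@star_ideal_proper k e) x).
rewrite path_alg_mxD -scaleN1r path_alg_mxZ !scaleN1r => /eqP.
by rewrite subr_eq0 => /eqP.
Qed.

Lemma rep_mxD a b : rep_mx (a + b) = rep_mx a + rep_mx b.
Proof.
by rewrite -[a]quot_liftK -[b]quot_liftK -raddfD !rep_mx_proj path_alg_mxD.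
Qed.

Lemma rep_mxM a b : rep_mx (a * b) = rep_mx b *m rep_mx a.
Proof.
by rewrite -[a]quot_liftK -[b]quot_liftK -projM !rep_mx_proj path_alg_mxM.
Qed.

Lemma rep_mxZ c a : rep_mx (c *: a) = (c%:A : S) *: rep_mx a.
Proof.
have := rep_mx_proj (c *: (quot_lift (S1 := @star_ideal_proper k e) a : path_alg k e)).
by rewrite projZ quot_liftK path_alg_mxZ.
Qed.

Lemma rep_mx_idem i : rep_mx (L_idem k i) = Ev i.
Proof. by rewrite rep_mx_proj path_alg_mxU. Qed.

Lemma rep_mx_arrow a : rep_mx (L_arrow k a) = F a.
Proof. by rewrite rep_mx_proj path_alg_mx_arrow. Qed.

Lemma rep_mx1 : rep_mx 1 = 1%:M.
Proof.
rewrite -(rep_sum HF) -sum_idem.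
rewrite (big_morph rep_mx rep_mxD (id1 := 0)).
  by apply: eq_bigr => i _; exact: rep_mx_idem.
by rewrite -(scale0r 0) rep_mxZ !scale0r.
Qed.

End Representation.

(** * Modules with a basis of successive walks *)

Section Chain.
Variables (k : fieldType) (e : nat) (S : comAlgType k) (N : nat).
Variables (o : nat) (D : nat -> 'rV[S]_N).
Local Notation E := e.-1.+1.

(** Indexed by [nat], so that a row past the end is zero and a walk leaving the chain vanishes by
    itself. *)
Definition unit_row (j : nat) : 'rV[S]_N := \row_i (i == j :> nat)%:R.
Definition rows_mx (g : nat -> 'rV[S]_N) : 'M[S]_N := \matrix_(i < N) g i.

(** The rows from [o] on are the successive walks from the vertex e, and [D r] is the image of row
    [r] under delta. Rows below [o] are extra vectors killed by every alpha; truncated subtraction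
    places them at the vertex e. The projective module at e is the case [o = 1], the rank one band
    modules the case [o = 0]. *)
Definition chain_idem (i : vertex e) : 'M[S]_N :=
  rows_mx (fun r => if i == vt e (r - o) then unit_row r else 0).
Definition chain_arrow (a : arrow e) : 'M[S]_N :=
  rows_mx (fun r => if a is Some i then
    if (o <= r)%N && (i == vt e (r - o)) then unit_row r.+1 else 0 else D r).

Lemma unit_row_big j : (N <= j)%N -> unit_row j = 0.
Proof.
move=> Nj; apply/rowP => i; rewrite !mxE; case: eqP => // ij.
by move: Nj; rewrite leqNgt -ij ltn_ord.
Qed.

Lemma unit_rowE (i : 'I_N) : unit_row i = delta_mx 0 i.
Proof. by apply/rowP => j; rewrite !mxE. Qed.

Lemma unit_row_mul j (g : nat -> 'rV[S]_N) :
  ((N <= j)%N -> g j = 0) -> unit_row j *m rows_mx g = g j.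
Proof.
case: (ltnP j N) => [jN _|jN /(_ isT) ->]; last by rewrite unit_row_big // mul0mx.
by rewrite -[j]/(nat_of_ord (Ordinal jN)) unit_rowE -rowE rowK.
Qed.

Lemma unit_row_idem j i :
  unit_row j *m chain_idem i = if i == vt e (j - o) then unit_row j else 0.
Proof.
by apply: unit_row_mul => jN; case: eqP => // _; rewrite unit_row_big.
Qed.

Lemma unit_row_arrow j i :
  unit_row j *m chain_arrow (Some i) =
    if (o <= j)%N && (i == vt e (j - o)) then unit_row j.+1 else 0.
Proof.
by apply: unit_row_mul => jN; case: ifP => // _; rewrite unit_row_big // ltnW.
Qed.

Lemma unit_row_loop j : (j < N)%N -> unit_row j *m chain_arrow None = D j.
Proof. by move=> jN; apply: unit_row_mul; rewrite leqNgt jN. Qed.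

Lemma eq_unit_row (A B : 'M[S]_N) :
  (forall j, (j < N)%N -> unit_row j *m A = unit_row j *m B) -> A = B.
Proof. by move=> AB; apply/row_matrixP => i; rewrite !rowE -unit_rowE AB. Qed.

Lemma unit_row_walk j i n :
  unit_row (o + j) *m walk_mx chain_idem chain_arrow i n =
    if i == vt e j then unit_row (o + (j + n)) else 0.
Proof.
elim: n => [|n IH] /=; first by rewrite unit_row_idem addKn addn0.
rewrite mulmxA IH; case: eqP => [->|]; last by rewrite mul0mx.
have jn : vt e (j + n) = iter n (@ordS _) (vt e j) by rewrite addnC vtD.
by rewrite unit_row_arrow leq_addr addKn jn eqxx !addnS.
Qed.

Lemma unit_row_walk_lt j i n : (j < o)%N ->
  unit_row j *m walk_mx chain_idem chain_arrow i n.+1 = 0.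
Proof.
move=> jo; elim: n => [|n /= IH]; last by rewrite mulmxA IH mul0mx.
rewrite /= mulmxA unit_row_idem; case: eqP => _; last by rewrite mul0mx.
by rewrite unit_row_arrow leqNgt jo.
Qed.

Hypothesis No : (N <= o + (2 * E).+1)%N.
Hypothesis D_src : forall r, (o < r)%N -> D r = 0.
Hypothesis D_tgt : forall r, D r *m chain_idem ord_max = D r.
Hypothesis D_alpha : forall r, D r *m chain_arrow (Some ord_max) = 0.
Hypothesis D_sqr : forall r, (r <= o)%N ->
  D r *m chain_arrow None = if r == o then unit_row (o + 2 * E) else 0.

(** By [No], a walk of length 2 E + 1 leaves the chain, which gives alpha C^2 = 0. [D_sqr] makes
    delta^2 and C^2 agree on row [o] and on the extra rows, and [D_src] makes delta vanish beyond
    row [o], whence delta alpha = 0 and delta^3 = 0. *)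
Lemma chain_is_rep : is_rep chain_idem chain_arrow.
Proof.
have loopE j : unit_row j *m chain_arrow None = if (j < N)%N then D j else 0.
  by case: ltnP => jN; [rewrite unit_row_loop | rewrite unit_row_big ?mul0mx].
have D_vt j : (j <= o)%N -> ord_max = vt e (j - o).
  by rewrite -subn_eq0 => /eqP ->.
(* [walk_mx i E] unfolds to a product, which would mislead [mulmxA]. *)
have [W WE] : exists W, forall i, walk_mx chain_idem chain_arrow i E = W i.
  by exists (walk_mx chain_idem chain_arrow ^~ E).
have Wlt j i : (j < o)%N -> unit_row j *m W i = 0.
  by move=> jo; rewrite -WE unit_row_walk_lt.
have Wge j i : unit_row (o + j) *m W i =
    if i == vt e j then unit_row (o + (j + E)) else 0.
  by rewrite -WE unit_row_walk.
split; rewrite ?WE.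
- move=> u v; apply: eq_unit_row => j jN.
  rewrite mulmxA unit_row_idem; case: (eqVneq u v) => [->|uv].
    by rewrite unit_row_idem; case: eqP => uj; rewrite ?mul0mx // unit_row_idem uj eqxx.
  rewrite mulmx0; case: eqP => uj; rewrite ?mul0mx // unit_row_idem -uj.
  by rewrite eq_sym (negPf uv).
- apply: eq_unit_row => j jN; rewrite mulmx_sumr mulmx1 (bigD1 (vt e (j - o))) //=.
  rewrite unit_row_idem eqxx big1 ?addr0 // => v vj.
  by rewrite unit_row_idem (negPf vj).
- case=> [i|]; apply: eq_unit_row => j jN; rewrite mulmxA unit_row_idem.
    case: eqP => // ij; rewrite mul0mx unit_row_arrow; move/eqP/negPf: ij => ->.
    by rewrite andbF.
  case: eqP => //= jo; rewrite mul0mx unit_row_loop // D_src // ltnNge.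
  by apply/negP => /D_vt.
- case=> [i|]; apply: eq_unit_row => j jN; rewrite mulmxA; last first.
    by rewrite unit_row_loop.
  rewrite unit_row_arrow; case: andP => [[oj /eqP ->]|]; rewrite ?mul0mx //.
  by rewrite unit_row_idem subSn //= eqxx.
- move=> i; rewrite WE; apply: eq_unit_row => j jN; rewrite mulmx0 !mulmxA.
  case: (leqP o j) => [/subnKC <-|jo]; last by rewrite Wlt // !mul0mx.
  rewrite Wge; case: eqP => [->|]; last by rewrite !mul0mx.
  rewrite Wge; case: eqP => [_|]; last by rewrite !mul0mx.
  rewrite unit_row_arrow; case: ifP => // _; rewrite unit_row_big //.
  by rewrite (leq_trans No) // -addnS leq_add2l ltnS -addnA addnn -mul2n leq_addl.
- apply: eq_unit_row => j jN; rewrite !mulmxA unit_row_loop //.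
  case: (ltngtP j o) => [jo|jo|->].
  + by rewrite (Wlt _ _ jo) (D_sqr (ltnW jo)) (ltn_eqF jo) mul0mx.
  + rewrite (D_src jo) mul0mx -(subnKC (ltnW jo)) Wge.
    case: eqP => [_|]; last by rewrite mul0mx.
    rewrite Wge; case: eqP => // _; rewrite unit_row_big //.
    rewrite (leq_trans No) // leq_add2l -addnA mul2n -addnn.
    by rewrite -[_.+1]add1n leq_add2r subn_gt0.
  + rewrite D_sqr // eqxx -{1}[o]addn0 Wge eqxx Wge add0n.
    by rewrite vtE eqxx mul2n -addnn.
- by apply: eq_unit_row => j jN; rewrite mulmxA mulmx0 unit_row_loop ?D_alpha.
- apply: eq_unit_row => j jN; rewrite mulmxA mulmx0 unit_row_arrow.
  case: andP => [[oj _]|]; rewrite ?mul0mx // loopE; case: ifP => // _.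
  by rewrite D_src.
- apply: eq_unit_row => j jN; rewrite !mulmxA mulmx0 unit_row_loop //.
  case: (leqP j o) => [jo|jo]; last by rewrite D_src // !mul0mx.
  rewrite D_sqr //; case: ifP => _; rewrite ?mul0mx // loopE; case: ifP => // _.
  by rewrite D_src // -[X in (X < _)%N]addn0 ltn_add2l.
Qed.

End Chain.

(** * An abstract form of Lambda, and modules of row vectors over it *)

Record rep_morph (k : fieldType) (A : algType k) (S : comAlgType k) (N : nat)
    (rho : A -> 'M[S]_N) : Prop := RepMorph {
  rho1 : rho 1 = 1%:M;
  rhoM : forall a b, rho (a * b) = rho b *m rho a;
  rhoD : forall a b, rho (a + b) = rho a + rho b;
  rhoZ : forall c a, rho (c *: a) = (c%:A : S) *: rho a }.

Fixpoint walk_elt (k : fieldType) (e : nat) (A : algType k)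
    (idem : vertex e -> A) (arr : arrow e -> A) (i : vertex e) (n : nat) : A :=
  if n is n'.+1
  then arr (Some (iter n' (@ordS _) i)) * walk_elt idem arr i n' else idem i.

(* What is used of Lambda; an abstract algebra keeps unification from unfolding
   the quotient of the path algebra. *)
Record star_algebra (k : fieldType) (e : nat) (A : algType k)
    (idem : vertex e -> A) (arr : arrow e -> A) : Prop := StarAlgebra {
  sa_idemM : forall u v, idem u * idem v = if u == v then idem u else 0;
  sa_arr_idem : forall a v,
    arr a * idem v = if v == arrow_src a then arr a else 0;
  sa_idem_arr : forall a v,
    idem v * arr a = if v == arrow_tgt a then arr a else 0;
  sa_ind : forall Q : A -> Prop,
    (forall x y, Q x -> Q y -> Q (x + y)) -> (forall c x, Q x -> Q (c *: x)) ->
    (forall v, Q (idem v)) -> (forall a x, Q x -> Q (arr a * x)) ->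
    forall x, Q x;
  sa_alpha : forall i, arr (Some i) *
    (walk_elt idem arr i e.-1.+1 * walk_elt idem arr i e.-1.+1) = 0;
  sa_sqr : walk_elt idem arr ord_max e.-1.+1 * walk_elt idem arr ord_max e.-1.+1
    = arr None * arr None;
  sa_alphadelta : arr (Some ord_max) * arr None = 0;
  sa_deltaalpha : arr None * arr (Some (ord_pred ord_max)) = 0;
  sa_rep : forall (S : comAlgType k) (N : nat) (Ev : vertex e -> 'M[S]_N)
      (F : arrow e -> 'M[S]_N), is_rep Ev F ->
    exists rho : A -> 'M[S]_N, [/\ rep_morph rho,
      forall i, rho (idem i) = Ev i & forall a, rho (arr a) = F a] }.

Lemma Lambda_star_algebra (k : fieldType) (e : nat) :
  @star_algebra k e (Lambda k e) (@L_idem k e) (@L_arrow k e).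
Proof.
have walkE i n : walk_elt (@L_idem k e) (@L_arrow k e) i n =
    quot_proj (@star_ideal_proper k e) (alpha_walk k i n).
  by elim: n => [|n IH] //=; rewrite IH -projM.
split.
- exact: idemM.
- exact: arr_idem.
- exact: idem_arr.
- exact: Lambda_ind.
- move=> i; rewrite walkE; have := rel0 (star_rel_alpha k i).
  by rewrite projM expr2 (projM (alpha_cycle k i)).
- rewrite walkE -[LHS]projM -[RHS]projM; apply/eqP; rewrite -subr_eq0 -projB.
  by apply/eqP; have := rel0 (star_rel_sqr k e); rewrite !expr2.
- by rewrite -[LHS]projM; exact: rel0 (star_rel_alphadelta k e).
- by rewrite -[LHS]projM; exact: rel0 (star_rel_deltaalpha k e).
move=> S N Ev F HF; exists (rep_mx Ev F); split; first split.
- exact: rep_mx1.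
- exact: rep_mxM.
- exact: rep_mxD.
- exact: rep_mxZ.
- exact: rep_mx_idem.
- exact: rep_mx_arrow.
Qed.

Section RowModule.
Variables (k : fieldType) (A : algType k) (S : comAlgType k) (N : nat).
Variable rho : A -> 'M[S]_N.

(** The property of [rho] is a parameter of the type so that the module structure, whose axioms rest
    on it, can be attached to the type. *)
Definition row_module & rep_morph rho : Type := 'rV[S]_N.

Hypothesis rhoP : rep_morph rho.
HB.instance Definition _ := GRing.Zmodule.on (row_module rhoP).

Definition row_scale (a : A) (u : row_module rhoP) : row_module rhoP :=
  (u : 'rV[S]_N) *m rho a.

Lemma row_scaleA a b u : row_scale a (row_scale b u) = row_scale (a * b) u.
Proof. by rewrite /row_scale (rhoM rhoP) mulmxA. Qed.
Lemma row_scale1 : left_id 1 row_scale.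
Proof. by move=> u; rewrite /row_scale (rho1 rhoP) mulmx1. Qed.
Lemma row_scaleDr : right_distributive row_scale +%R.
Proof. by move=> a u v; rewrite /row_scale mulmxDl. Qed.
Lemma row_scaleDl u : {morph row_scale^~ u : a b / a + b}.
Proof. by move=> a b; rewrite /row_scale (rhoD rhoP) mulmxDr. Qed.
HB.instance Definition _ := GRing.Zmodule_isLmodule.Build A (row_module rhoP)
  row_scaleA row_scale1 row_scaleDr row_scaleDl.

Definition row_tmod : tensor_module A S.
Proof.
refine (@TensorModule k A S 'rV[S]_N (fun a => mulmxr (rho a)) _ _ _ _).
- by move=> m; rewrite /= (rho1 rhoP) mulmx1.
- by move=> a b m; rewrite /= (rhoM rhoP) mulmxA.
- by move=> a b m; rewrite /= (rhoD rhoP) mulmxDr.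
- by move=> c a m; rewrite /= (rhoZ rhoP) scalemxAr.
Defined.

End RowModule.

Lemma linear_of (R : pzRingType) (U V : lmodType R) (T : U -> V) :
  (forall a x y, T (a *: x + y) = a *: T x + T y) ->
  exists f : {linear U -> V}, forall x, f x = T x.
Proof.
move=> TL; pose f := HB.pack_for {linear U -> V} T
  (GRing.isLinear.Build R U V *:%R T TL).
by exists f.
Qed.

Lemma factor_surjection (R : pzRingType) (U V W : lmodType R)
    (p : {linear U -> V}) (f : {linear U -> W}) :
  surjective p -> (forall x, p x = 0 -> f x = 0) ->
  exists g : {linear V -> W}, forall x, g (p x) = f x.
Proof.
move=> p_surj pf; have [s sK] := choice p_surj.
have fE x y : p x = p y -> f x = f y.
  move=> pxy; apply/eqP; rewrite -subr_eq0 -linearB pf //.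
  by rewrite linearB pxy subrr.
have [|g gE] := @linear_of R V W (fun v => f (s v)).
  by move=> a v w; rewrite -linearP; apply: fE; rewrite linearP !sK.
by exists g => x; rewrite gE; apply: fE; rewrite sK.
Qed.

Section AlgebraModules.
Variables (k : fieldType) (A : algType k).

Lemma scalar_comm (V : lmodType A) (c : k) (a : A) (v : V) :
  a *: ((c%:A : A) *: v) = (c%:A : A) *: (a *: v).
Proof. by rewrite !scalerA -scalerAr mulr1 -scalerAl mul1r. Qed.

Lemma scale_scalar (V : lmodType A) (c : k) (a : A) (v : V) :
  (c *: a) *: v = (c%:A : A) *: (a *: v).
Proof. by rewrite scalerA -scalerAl mul1r. Qed.

Lemma scalarM (V : lmodType A) (c d : k) (v : V) :
  (c%:A : A) *: ((d%:A : A) *: v) = ((c * d)%:A : A) *: v.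
Proof. by rewrite scalerA -scalerAl mul1r scalerA. Qed.

Lemma scalarK (V : lmodType A) (c : k) (v w : V) : c != 0 ->
  (c%:A : A) *: v = w -> v = ((c^-1)%:A : A) *: w.
Proof. by move=> c0 <-; rewrite scalarM mulVf // scale1r scale1r. Qed.

Lemma scalar_commA (V : lmodType A) (c : k) (a b : A) (v : V) :
  a *: ((c%:A : A) *: (b *: v)) = (c%:A : A) *: ((a * b) *: v).
Proof. by rewrite scalar_comm (scalerA a b). Qed.

Lemma scalar_eq0 (V : lmodType A) (c : k) (v : V) : c != 0 ->
  (c%:A : A) *: v = 0 -> v = 0.
Proof. by move=> c0 /(scalarK c0); rewrite scaler0. Qed.

End AlgebraModules.

(** * Products of walks, and the projective module at the vertex e *)

Section StarAlgebraTheory.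
Variables (k : fieldType) (e : nat) (A : algType k).
Variables (idem : vertex e -> A) (arr : arrow e -> A).
Hypothesis sA : star_algebra idem arr.
Local Notation E := e.-1.+1.
Local Notation walk := (walk_elt idem arr).
Local Notation wlk := (walk ord_max).

Lemma idem_walk i j v :
  idem v * walk i j = if v == iter j (@ordS _) i then walk i j else 0.
Proof.
case: j => [|j] /=; first by rewrite (sa_idemM sA); case: eqP => [->|].
by rewrite mulrA (sa_idem_arr sA); case: eqP => // _; rewrite mul0r.
Qed.

Lemma arr_walk i j v :
  arr (Some v) * walk i j = if v == iter j (@ordS _) i then walk i j.+1 else 0.
Proof.
case: eqP => [->|/eqP vj] //.
have := idem_walk i j (iter j (@ordS _) i); rewrite eqxx => <-.
by rewrite mulrA (sa_arr_idem sA) eq_sym (negPf vj) mul0r.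
Qed.

Lemma walkD i j l : walk i (j + l) = walk (iter l (@ordS _) i) j * walk i l.
Proof.
elim: j => [|j IH]; first by rewrite /= idem_walk eqxx.
by rewrite addSn /= iterD IH mulrA.
Qed.

Lemma wlkD j l : wlk (j + l) = walk (vt e l) j * wlk l.
Proof. exact: walkD. Qed.

Lemma wlkDE j : wlk (j + E) = wlk j * wlk E.
Proof. by rewrite wlkD vtE. Qed.

Lemma wlk_2E : wlk (2 * E) = wlk E * wlk E.
Proof. by rewrite mul2n -addnn wlkDE. Qed.

(** The first 2 E + 1 arrows of a long walk spell the relation alpha_i C^2. *)
Lemma walk_long i j : (2 * E < j)%N -> walk i j = 0.
Proof.
move=> jE; rewrite -(subnK jE) walkD; set x := walk i _.
suff -> : x = 0 by rewrite mulr0.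
rewrite -[RHS](sa_alpha sA i) -[LHS]/(arr _ * walk i (2 * E)).
rewrite mul2n -addnn walkD iterD !iter_ordSE.
by [].
Qed.

Lemma delta_sq : arr None * arr None = wlk (2 * E).
Proof. by rewrite wlk_2E (sa_sqr sA). Qed.

(** For alpha_e this is a defining relation; the other arrows do not start at e, where the loop
    ends. *)
Lemma alpha_delta i : arr (Some i) * arr None = 0.
Proof.
have [->|iN] := eqVneq i ord_max; first exact: sa_alphadelta sA.
have := sa_idem_arr sA None ord_max; rewrite eqxx => <-.
by rewrite mulrA (sa_arr_idem sA) /= eq_sym (negPf iN) mul0r.
Qed.

Lemma delta_alpha i : arr None * arr (Some i) = 0.
Proof.
have [iE|iN] := eqVneq (ordS i) ord_max.
  by have := sa_deltaalpha sA; rewrite -iE ordSK.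
have := sa_idem_arr sA (Some i) (ordS i); rewrite eqxx => <-.
by rewrite mulrA (sa_arr_idem sA) /= (negPf iN) mul0r.
Qed.

Lemma walk_delta i j : walk i j.+1 * arr None = 0.
Proof.
elim: j => [|j IH]; rewrite /= -mulrA ?IH ?mulr0 //= (sa_idem_arr sA).
by case: eqP => [->|]; rewrite ?mulr0 ?alpha_delta.
Qed.

Lemma delta_walk i j : arr None * walk i j.+1 = 0.
Proof. by rewrite /= mulrA delta_alpha mul0r. Qed.

(** The elements of [A] that commute with [T] contain the idempotents and are stable under the
    operations of [sa_ind]. *)
Lemma star_linear (U V : lmodType A) (T : U -> V) :
  (forall c x y, T ((c%:A : A) *: x + y) = (c%:A : A) *: T x + T y) ->
  (forall i x, T (idem i *: x) = idem i *: T x) ->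
  (forall a x, T (arr a *: x) = arr a *: T x) ->
  exists f : {linear U -> V}, forall x, f x = T x.
Proof.
move=> TP Ti Ta; have TD x y : T (x + y) = T x + T y.
  by have := TP 1 x y; rewrite !scale1r.
have T0 : T 0 = 0 by apply: (addrI (T 0)); rewrite -TD !addr0.
apply: linear_of => a x y; rewrite TD; congr (_ + _).
elim/(sa_ind sA): a x => [a b IHa IHb|c a IH|v|b a IH] x.
- by rewrite !scalerDl TD IHa IHb.
- rewrite (scale_scalar c a x) (scale_scalar c a (T x)) -IH; have := TP c (a *: x) 0.
  by rewrite T0 !addr0.
- exact: Ti.
- by rewrite -!scalerA Ta IH.
Qed.

(* The indecomposable projective module at the vertex e, with a basis made of the
   loop [td] and the walks [tw j] of length j <= 2 e from that vertex. *)
Record top_module (P : lmodType A) (td : P) (tw : nat -> P) (dc : P -> k)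
    (wc : P -> nat -> k) : Prop := TopModule {
  idem_td : forall i, idem i *: td = if i == ord_max then td else 0;
  idem_tw : forall i j, idem i *: tw j = if i == vt e j then tw j else 0;
  alpha_td : forall i, arr (Some i) *: td = 0;
  alpha_tw : forall i j, arr (Some i) *: tw j = if i == vt e j then tw j.+1 else 0;
  delta_td : arr None *: td = tw (2 * E);
  delta_tw : forall j, arr None *: tw j = if j == 0%N then td else 0;
  tw_big : forall j, (2 * E < j)%N -> tw j = 0;
  dcP : forall c u v, dc ((c%:A : A) *: u + v) = c * dc u + dc v;
  wcP : forall c u v j, wc ((c%:A : A) *: u + v) j = c * wc u j + wc v j;
  dc_td : dc td = 1;
  wc_td : forall j, (j <= 2 * E)%N -> wc td j = 0;
  dc_tw : forall j, dc (tw j) = 0;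
  wc_tw : forall i j, (j <= 2 * E)%N -> wc (tw i) j = (i == j)%:R;
  top_decomp : forall u, u =
    ((dc u)%:A : A) *: td + \sum_(j < (2 * E).+1) ((wc u j)%:A : A) *: tw j }.

Lemma top_module_exists : exists (P : lmodType A) (td : P) (tw : nat -> P)
  (dc : P -> k) (wc : P -> nat -> k), top_module td tw dc wc.
Proof.
(* Row 0 is the loop and row [j.+1] the walk of length [j]. Delta sends the trivial walk to the
   loop, and the loop to the last row, which is C^2. *)
pose ur := unit_row k^o (2 * E).+2.
pose D r := if r == 1%N then ur 0 else if r == 0%N then ur (2 * E).+1 else 0.
have Dr : is_rep (@chain_idem k e k^o (2 * E).+2 1) (chain_arrow 1 D).
  apply: chain_is_rep => //.
  - by case=> [|[]].
  - move=> r; rewrite /D; case: eqP => _; first by rewrite unit_row_idem eqxx.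
    case: eqP => _; last by rewrite mul0mx.
    have v2E : vt e (2 * E) = ord_max by rewrite mul2n -addnn vtD !vtE iter_ordSE.
    by rewrite unit_row_idem subn1 v2E eqxx.
  - move=> r; rewrite /D; case: eqP => _; first by rewrite unit_row_arrow.
    case: eqP => _; last by rewrite mul0mx.
    by rewrite unit_row_arrow; case: ifP => // _; rewrite unit_row_big.
  - by case=> [|[]] // _; rewrite /D /= unit_row_loop.
have [rho [rhoP rhoi rhoa]] := sa_rep sA Dr.
have sE c (u : row_module rhoP) : (c%:A : A) *: u = (c *: (u : 'rV[k^o]_(2 * E).+2) : 'rV_ _).
  rewrite -[LHS]/((u : 'rV[k^o]_(2 * E).+2) *m rho _) (rhoZ rhoP) (rho1 rhoP).
  by rewrite -scalemxAr mulmx1 [c%:A]mulr1.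
exists (row_module rhoP), (ur 0), (fun j => ur j.+1).
exists (fun u => (u : 'rV[k^o]_(2 * E).+2) 0 0).
(* Beyond [2 * E], [inord] falls back to the index 0 of the loop, hence the bounds on [j] in the
   fields on [wc]. *)
exists (fun u j => (u : 'rV[k^o]_(2 * E).+2) 0 (inord j.+1)); split.
- by move=> i; rewrite -[LHS]/(_ *m rho _) rhoi unit_row_idem.
- by move=> i j; rewrite -[LHS]/(_ *m rho _) rhoi unit_row_idem subn1.
- by move=> i; rewrite -[LHS]/(_ *m rho _) rhoa unit_row_arrow.
- by move=> i j; rewrite -[LHS]/(_ *m rho _) rhoa unit_row_arrow subn1.
- by rewrite -[LHS]/(_ *m rho _) rhoa unit_row_loop.
- move=> j; rewrite -[LHS]/(_ *m rho _) rhoa.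
  case: (ltnP j (2 * E).+1) => jE; first by rewrite unit_row_loop //; case: j jE.
  by rewrite /ur unit_row_big ?mul0mx //; case: j jE.
- by move=> j jE; rewrite /ur unit_row_big.
- by move=> c u v; rewrite sE !mxE.
- by move=> c u v j; rewrite sE !mxE.
- by rewrite mxE.
- by move=> j jE; rewrite mxE inordK.
- by move=> j; rewrite mxE.
- by move=> i j jE; rewrite mxE inordK // eqSS eq_sym.
move=> u; rewrite -[LHS]/(u : 'rV[k^o]_(2 * E).+2) [LHS]row_sum_delta big_ord_recl.
congr (_ + _); first by rewrite sE -unit_rowE.
apply: eq_bigr => j _; rewrite sE -unit_rowE lift0.
have -> // : lift ord0 j = inord j.+1.
by apply: val_inj; rewrite /= inordK // ltnS.
Qed.

Section TopModule.
Variables (P : lmodType A) (td : P) (tw : nat -> P) (dc : P -> k).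
Variable wc : P -> nat -> k.
Hypothesis tP : top_module td tw dc wc.

Lemma walk_tw i n j :
  walk i n *: tw j = if i == vt e j then tw (j + n) else 0.
Proof.
elim: n => [|n IH] /=; first by rewrite (idem_tw tP) addn0.
rewrite -scalerA IH; case: eqP => [->|]; last by rewrite scaler0.
have jn : vt e (j + n) = iter n (@ordS _) (vt e j) by rewrite addnC vtD.
by rewrite (alpha_tw tP) jn eqxx addnS.
Qed.

Lemma walk_td i n : walk i n.+1 *: td = 0.
Proof.
elim: n => [|n IH]; rewrite /= -scalerA ?IH ?scaler0 //.
by rewrite (idem_td tP); case: eqP => _; rewrite ?scaler0 ?(alpha_td tP).
Qed.

Lemma wlk_tw0 j : wlk j *: tw 0 = tw j.
Proof. by rewrite walk_tw eqxx. Qed.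

Lemma top_gen u :
  u = (dc u *: arr None + \sum_(j < (2 * E).+1) wc u j *: wlk j) *: tw 0.
Proof.
rewrite scalerDl scaler_suml {1}[u](top_decomp tP) (scale_scalar _ (arr None)) (delta_tw tP).
by congr (_ + _); apply: eq_bigr => j _; rewrite (scale_scalar _ (wlk j)) wlk_tw0.
Qed.

Lemma dc0 : dc 0 = 0.
Proof. by have := dcP tP (-1) td td; rewrite scaleN1r scaleN1r addNr mulN1r addNr. Qed.

Lemma dcZ c u : dc ((c%:A : A) *: u) = c * dc u.
Proof. by have := dcP tP c u 0; rewrite dc0 !addr0. Qed.

Lemma dcD u v : dc (u + v) = dc u + dc v.
Proof. by have := dcP tP 1 u v; rewrite !scale1r mul1r. Qed.

Lemma wc0 j : wc 0 j = 0.
Proof. by have := wcP tP (-1) td td j; rewrite scaleN1r scaleN1r addNr mulN1r addNr. Qed.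

Lemma wcZ c u j : wc ((c%:A : A) *: u) j = c * wc u j.
Proof. by have := wcP tP c u 0 j; rewrite wc0 !addr0. Qed.

Lemma wcD u v j : wc (u + v) j = wc u j + wc v j.
Proof. by have := wcP tP 1 u v j; rewrite !scale1r mul1r. Qed.

Lemma top_hom_formula (X : lmodType A) (f : {linear P -> X}) u :
  f u = ((dc u)%:A : A) *: (arr None *: f (tw 0))
        + \sum_(j < (2 * E).+1) ((wc u j)%:A : A) *: (wlk j *: f (tw 0)).
Proof.
rewrite {1}[u]top_gen linearZ /= scalerDl scaler_suml (scale_scalar _ (arr None)).
by congr (_ + _); apply: eq_bigr => j _; rewrite (scale_scalar _ (wlk j)).
Qed.

(** P is A e_e, so a map out of it is given by an element of e_e X. [T] is the only candidate, by
    [top_hom_formula], and its compatibility with the arrows is checked on the basis. *)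
Lemma top_hom (X : lmodType A) (x : X) : idem ord_max *: x = x ->
  exists f : {linear P -> X}, f (tw 0) = x.
Proof.
move=> x0.
pose T u := ((dc u)%:A : A) *: (arr None *: x)
            + \sum_(j < (2 * E).+1) ((wc u j)%:A : A) *: (wlk j *: x).
have TP c u v : T ((c%:A : A) *: u + v) = (c%:A : A) *: T u + T v.
  rewrite /T scalerDr scaler_sumr addrACA -big_split /= scalarM -!scalerDl.
  rewrite (dcP tP) ; congr (_ + _).
  by apply: eq_bigr => j _; rewrite (wcP tP) scalarM -!scalerDl.
have TD u v : T (u + v) = T u + T v by have := TP 1 u v; rewrite !scale1r.
have T0 : T 0 = 0 by apply: (addrI (T 0)); rewrite -TD !addr0.
have TZ c u : T ((c%:A : A) *: u) = (c%:A : A) *: T u.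
  by have := TP c u 0; rewrite T0 !addr0.
have Tw j : T (tw j) = wlk j *: x.
  case: (ltnP (2 * E) j) => jE; first by rewrite (tw_big tP) // T0 walk_long // scale0r.
  rewrite /T (dc_tw tP) !scale0r add0r (bigD1 (Ordinal (jE : j < (2 * E).+1)%N)) //=.
  rewrite (wc_tw tP) // eqxx !scale1r big1 ?addr0 // => i ij.
  by rewrite (wc_tw tP) -1?ltnS // eq_sym [(_ == _ :> nat)](negPf ij) !scale0r.
have Td : T td = arr None *: x.
  rewrite /T (dc_td tP) !scale1r big1 ?addr0 // => i _.
  by rewrite (wc_td tP) -1?ltnS // !scale0r.
have Tsum (F : 'I_(2 * E).+1 -> P) : T (\sum_j F j) = \sum_j T (F j).
  by rewrite (big_morph T TD T0).
have Tgen (a : A) : T (a *: td) = a *: T td ->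
    (forall j, T (a *: tw j) = a *: T (tw j)) -> forall u, T (a *: u) = a *: T u.
  move=> ad aw u; rewrite [u](top_decomp tP) scalerDr scaler_sumr !TD !Tsum.
  rewrite scalerDr scaler_sumr; congr (_ + _).
    by rewrite scalar_comm !TZ ad scalar_comm.
  by apply: eq_bigr => j _; rewrite scalar_comm !TZ aw scalar_comm.
have [f fE] : exists f : {linear P -> X}, forall u, f u = T u.
  apply: (star_linear TP) => [i|[i|]]; apply: Tgen => [|j].
  - rewrite (idem_td tP) Td scalerA (sa_idem_arr sA) /=.
    by case: eqP; rewrite ?T0 ?scale0r.
  - by rewrite (idem_tw tP) Tw scalerA idem_walk; case: eqP; rewrite ?T0 ?scale0r.
  - by rewrite (alpha_td tP) Td scalerA alpha_delta T0 scale0r.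
  - by rewrite (alpha_tw tP) Tw scalerA arr_walk; case: eqP; rewrite ?T0 ?scale0r.
  - by rewrite (delta_td tP) Tw Td scalerA delta_sq.
  - rewrite (delta_tw tP) Tw scalerA; case: j => [|j] /=.
      by rewrite Td (sa_arr_idem sA) eqxx.
    by rewrite T0 mulrA delta_alpha mul0r scale0r.
by exists f; rewrite fE Tw.
Qed.

Lemma top_projective : projective P.
Proof.
move=> X Y g h g_surj; have [x xE] := g_surj (h (tw 0)).
have [|l lE] := @top_hom X (idem ord_max *: x).
  by rewrite scalerA (sa_idemM sA) eqxx.
exists l => u; rewrite [u]top_gen !linearZ /= lE linearZ /= xE.
by rewrite -linearZ (idem_tw tP) eqxx.
Qed.

Lemma top_fin_gen : fin_gen P.
Proof.
exists 1%N, (fun=> tw 0) => u.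
exists (fun=> dc u *: arr None + \sum_(j < (2 * E).+1) wc u j *: wlk j).
by rewrite big_ord1 -top_gen.
Qed.

End TopModule.
End StarAlgebraTheory.

(** * Modules generated by a top element *)

Section LinearForms.
Variables (k : fieldType) (A : algType k).

Definition spanned_by (X : lmodType A) (T : finType) (b : T -> X) (B : {set T}) :=
  forall x, exists c : T -> k, x = \sum_(t in B) ((c t)%:A : A) *: b t.

(** A minimal spanning subset of the finite family is independent, so the coordinates chosen in it
    are linear, and one of them does not vanish at [x0]. *)
Lemma linear_form_neq0 (X : lmodType A) (T : finType) (b : T -> X) (x0 : X) :
  spanned_by b [set: T] -> x0 <> 0 ->
  exists psi : X -> k, psi x0 != 0 /\
    forall c x y, psi ((c%:A : A) *: x + y) = c * psi x + psi y.
Proof.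
move=> spT x0N; have spB B : reflect (spanned_by b B) `[< spanned_by b B >] := asboolP _.
have [B /minsetP[/spB sp minB]] : {B | minset (fun B => `[< spanned_by b B >]) B}.
  by apply: ex_minset; exists [set: T]; apply/spB.
have indep c : \sum_(t in B) ((c t)%:A : A) *: b t = 0 -> forall t, t \in B -> c t = 0.
  move=> c0 s sB; apply/eqP/negPn/negP => cs.
  suff /spB/minB BE : spanned_by b (B :\ s).
    by have := sB; rewrite -BE ?subD1set // setD11.
  move: c0; rewrite (bigD1 s) //= addrC => /eqP; rewrite addr_eq0 => /eqP c0.
  move=> x; have [d ->] := sp x.
  (* The relation [c] eliminates [b s] from the expansion [d], against minimality. *)
  exists (fun t => d t - d s / c s * c t); rewrite (bigD1 s) //=.
  rewrite [RHS](eq_bigl (fun t => (t \in B) && (t != s))); last first.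
    by move=> t; rewrite !inE andbC.
  have -> : ((d s)%:A : A) *: b s =
      - \sum_(t in B | t != s) ((d s / c s * c t)%:A : A) *: b t.
    have -> : ((d s)%:A : A) *: b s =
        ((d s / c s)%:A : A) *: (((c s)%:A : A) *: b s).
      by rewrite scalarM divfK.
    rewrite -[((c s)%:A : A) *: b s]opprK -c0 scalerN scaler_sumr; congr (- _).
    by apply: eq_bigr => t _; rewrite scalarM.
  rewrite addrC -sumrB; apply: eq_bigr => t _.
  by rewrite -scalerBl -scalerBl.
have [f fE] := choice sp.
have [t tB ft] : exists2 t, t \in B & f x0 t != 0.
  apply: contrapT => N; apply: x0N; rewrite [x0]fE big1 // => t tB.
  case: (eqVneq (f x0 t) 0) => [->|ft]; first by rewrite !scale0r.
  by case: N; exists t.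
exists (f^~ t); split=> // c x y.
suff /(_ t tB)/eqP : forall t, t \in B -> f ((c%:A : A) *: x + y) t - (c * f x t + f y t) = 0.
  by rewrite subr_eq0 => /eqP.
apply: indep; under eq_bigr => s _ do rewrite scalerBl scalerBl scalerDl scalerDl -scalarM.
by rewrite sumrB big_split /= -scaler_sumr -!fE subrr.
Qed.

End LinearForms.

Section CyclicSubmodule.
Variables (R : pzRingType) (V : lmodType R) (y : V).

Definition cyc (x : V) : Prop := exists a : R, x = a *: y.

Lemma cycD u v : cyc u -> cyc v -> cyc (u + v).
Proof. by move=> [a ->] [b ->]; exists (a + b); rewrite scalerDl. Qed.

Lemma cycZ a u : cyc u -> cyc (a *: u).
Proof. by move=> [b ->]; exists (a * b); rewrite scalerA. Qed.

Lemma cyc_sum (I : Type) (r : seq I) (Q : pred I) (F : I -> V) :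
  (forall i, Q i -> cyc (F i)) -> cyc (\sum_(i <- r | Q i) F i).
Proof.
move=> cF; elim/big_ind: _ => //; first by exists 0; rewrite scale0r.
by move=> u v; exact: cycD.
Qed.

End CyclicSubmodule.

Section BandGenerators.
Variables (k : fieldType) (e : nat) (A : algType k).
Variables (idem : vertex e -> A) (arr : arrow e -> A).
Hypothesis sA : star_algebra idem arr.
Local Notation E := e.-1.+1.
Local Notation walk := (walk_elt idem arr).
Local Notation wlk := (walk ord_max).

Lemma walk_wlk i n j : walk i n * wlk j = if i == vt e j then wlk (n + j) else 0.
Proof.
case: eqP => [->|/eqP ij]; first by rewrite (wlkD sA).
have := idem_walk sA ord_max j (vt e j); rewrite eqxx => <-; rewrite mulrA.
suff -> : walk i n * idem (vt e j) = 0 by rewrite mul0r.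
elim: n => [|n IH] /=; last by rewrite -mulrA IH mulr0.
by rewrite (sa_idemM sA) (negPf ij).
Qed.

Lemma walk_idem i n v : walk i n * idem v = if v == i then walk i n else 0.
Proof.
elim: n => [|n IH] /=; last by rewrite -mulrA IH; case: eqP; rewrite ?mulr0.
by rewrite (sa_idemM sA) eq_sym; case: eqP.
Qed.

Lemma walk_arr i n v :
  walk v n * arr (Some i) = if v == ordS i then walk i n.+1 else 0.
Proof.
have <- : walk i 1 = arr (Some i) by rewrite /= (sa_arr_idem sA) eqxx.
case: eqP => [->|/eqP vi]; first by rewrite -(walkD sA i n 1) addn1.
have := idem_walk sA i 1 (ordS i); rewrite eqxx => <-.
by rewrite mulrA walk_idem eq_sym (negPf vi) mul0r.
Qed.

Section GeneratedModule.
Variables (mu : k) (V : lmodType A) (v : V).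

(** B(1, mu) described by a top element. Unlike an explicit representation, this can be verified
    inside the kernel of an arbitrary cover or the cokernel of an arbitrary hull. *)
Record band_gen : Prop := BandGen {
  bg_idem : idem ord_max *: v = v;
  bg_delta : arr None *: v = (mu%:A : A) *: (wlk E *: v);
  bg_neq0 : wlk E *: v <> 0;
  bg_gen : forall x, cyc v x }.

Hypotheses (mu0 : mu != 0) (vP : band_gen).

(** Up to the nonzero factor mu, C v is delta v, and every walk of positive length kills delta. *)
Lemma bg_walk j : (E < j)%N -> wlk j *: v = 0.
Proof.
move=> jE; rewrite -(subnK (ltnW jE)) (wlkDE sA) -scalerA.
apply: (scalar_eq0 mu0); rewrite -scalar_comm -(bg_delta vP) scalerA.
by move: jE; rewrite -subn_gt0; case: (j - E)%N => // l _; rewrite (walk_delta sA) scale0r.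
Qed.

Lemma bg_surj x : exists c : nat -> k,
  x = \sum_(j < E.+1) ((c j)%:A : A) *: (wlk j *: v).
Proof.
have [a ->] := bg_gen vP x; elim/(sa_ind sA): a => {x}.
- move=> a b [c cE] [d dE]; exists (fun j => c j + d j).
  rewrite scalerDl cE dE -big_split; apply: eq_bigr => j _.
  by rewrite /= -scalerDl -scalerDl.
- move=> c a [d dE]; exists (fun j => c * d j).
  by rewrite scale_scalar dE scaler_sumr; apply: eq_bigr => j _; rewrite scalarM.
- move=> i; exists (fun j => ((j == 0%N) && (i == ord_max))%:R).
  rewrite big_ord_recl big1 => [|j _]; last by rewrite !scale0r.
  rewrite addr0 eqxx /= (bg_idem vP) -{1}(bg_idem vP) scalerA (sa_idemM sA).
  by case: eqP => [->|]; rewrite ?scale1r ?scale1r ?scale0r ?(bg_idem vP) ?scale0r.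
move=> [i|] a [d dE]; rewrite -scalerA dE scaler_sumr.
  exists (fun j => if j is j'.+1 then if i == vt e j' then d j' else 0 else 0).
  rewrite big_ord_recr [RHS]big_ord_recl !scale0r add0r.
  rewrite scalar_commA (arr_walk sA) -/(vt e _).
  rewrite [X in _ + X = _](_ : _ = 0) ?addr0; last first.
    by case: eqP => _; rewrite ?scale0r ?scaler0 // bg_walk ?scaler0.
  apply: eq_bigr => j _; rewrite scalar_commA (arr_walk sA) -/(vt e _) lift0.
  rewrite -[nat_of_ord (widen_ord _ _)]/(nat_of_ord j).
  by case: eqP => _; rewrite ?scale0r ?scaler0 // !scale0r.
exists (fun j => if j == E then d 0%N * mu else 0).
rewrite [LHS]big_ord_recl [RHS]big_ord_recr eqxx big1 => [|j _]; last first.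
  by rewrite scalar_commA (delta_walk sA) scale0r scaler0.
rewrite [X in _ = X + _]big1 => [|j _]; last by rewrite (ltn_eqF (ltn_ord j)) !scale0r.
by rewrite addr0 add0r scalar_comm (bg_idem vP) (bg_delta vP) scalarM.
Qed.

(** Induction on [j]: the walk of length E - j starting at the end of the j-th one sends the j-th
    term to a multiple of C v, which is nonzero, and pushes the later terms beyond length E, where
    they vanish. *)
Lemma bg_inj (c : nat -> k) :
  \sum_(j < E.+1) ((c j)%:A : A) *: (wlk j *: v) = 0 ->
  forall j, (j <= E)%N -> c j = 0.
Proof.
move=> c0; elim/ltn_ind => j IH jE.
have := congr1 (fun x => walk (vt e j) (E - j) *: x) c0; rewrite scaler0 scaler_sumr.
rewrite (bigD1 (Ordinal (jE : j < E.+1)%N)) //= big1 => [|i ij].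
  rewrite addr0 scalar_commA walk_wlk eqxx subnK // => cj.
  by case: (eqVneq (c j) 0) => // /scalar_eq0 /(_ cj)/(bg_neq0 vP).
rewrite scalar_commA walk_wlk; case: eqP => _; last by rewrite scale0r scaler0.
case: (ltngtP i j) => [lij|lij|/eqP]; last by rewrite [(_ == _ :> nat)](negPf ij).
  by rewrite IH ?scale0r // (leq_trans (ltnW lij)).
by rewrite bg_walk ?scaler0 //; lia.
Qed.

End GeneratedModule.

Section TopModuleTheory.
Variables (P : lmodType A) (td : P) (tw : nat -> P) (dc : P -> k) (wc : P -> nat -> k).
Hypothesis tP : top_module idem arr td tw dc wc.

Lemma wc_sum (I : finType) (F : I -> P) j : wc (\sum_i F i) j = \sum_i wc (F i) j.
Proof.
exact: (big_morph (wc^~ j) (fun u v => wcD tP u v j) (wc0 tP j)).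
Qed.

Lemma dc_sum (I : finType) (F : I -> P) : dc (\sum_i F i) = \sum_i dc (F i).
Proof.
exact: (big_morph dc (dcD tP) (dc0 tP)).
Qed.

Lemma tw_neq0 j : (j <= 2 * E)%N -> tw j <> 0.
Proof.
move=> jE tw0; have := wc_tw tP j jE; rewrite tw0 eqxx (wc0 tP).
by move/eqP; rewrite eq_sym oner_eq0.
Qed.

Lemma wlk_top n u : (0 < n)%N -> wlk n *: u =
  \sum_(j < (2 * E).+1) ((wc u j)%:A : A) *: (if vt e j == ord_max then tw (j + n) else 0).
Proof.
case: n => // n _; rewrite {1}[u](top_decomp tP) scalerDr scalar_comm (walk_td tP) scaler0.
rewrite add0r scaler_sumr; apply: eq_bigr => j _.
by rewrite scalar_comm (walk_tw tP) eq_sym.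
Qed.

Lemma delta_top u :
  arr None *: u = ((dc u)%:A : A) *: tw (2 * E) + ((wc u 0)%:A : A) *: td.
Proof.
rewrite {1}[u](top_decomp tP) scalerDr scalar_comm (delta_td tP) scaler_sumr.
rewrite big_ord_recl big1 ?addr0 => [|j _].
  by rewrite scalar_comm (delta_tw tP).
by rewrite scalar_comm (delta_tw tP) scaler0.
Qed.

Lemma wlk_top_2E u : wlk (2 * E) *: u = ((wc u 0)%:A : A) *: tw (2 * E).
Proof.
rewrite wlk_top // big_ord_recl big1 ?addr0 ?eqxx // => j _.
by rewrite (tw_big tP) ?if_same ?scaler0 // lift0 addSn ltnS leq_addl.
Qed.

(** C sends a basis walk of positive length to zero or to a walk longer than E, which [f] kills.
    Thus C f(u) reads off the top coefficient of [u]. *)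
Lemma wlk_E_hom (X : lmodType A) (f : {linear P -> X}) u :
  (forall j, (E < j)%N -> wlk j *: f (tw 0) = 0) ->
  wlk E *: f u = ((wc u 0)%:A : A) *: (wlk E *: f (tw 0)).
Proof.
move=> fE; have ftw j : f (tw j) = wlk j *: f (tw 0).
  by rewrite -linearZ (wlk_tw0 tP).
have fZ a x : f (a *: x) = a *: f x by rewrite linearZ.
have fS (F : 'I_(2 * E).+1 -> P) : f (\sum_j F j) = \sum_j f (F j).
  exact: raddf_sum.
rewrite -fZ wlk_top // fS big_ord_recl big1 ?addr0 => [|j _].
  by rewrite eqxx fZ ftw.
rewrite fZ; case: eqP => _; rewrite ?linear0 ?scaler0 // ftw fE ?scaler0 //.
by rewrite lift0 addSn ltnS leq_addl.
Qed.

(** The socle of P is the line of [tw (2 * E)]. A nonzero top coefficient is brought there by C^2;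
    failing that, a loop coefficient by delta; failing both, the shortest walk occurring in [u] by
    its complement, which the longer walks overshoot. *)
Lemma top_socle u : u <> 0 -> exists (a : A) (c : k),
  c != 0 /\ a *: u = (c%:A : A) *: tw (2 * E).
Proof.
move=> u0; case: (eqVneq (wc u 0) 0) => [wc0|wc0]; last first.
  by exists (wlk (2 * E)), (wc u 0); rewrite wlk_top_2E.
case: (eqVneq (dc u) 0) => [dc0|dc0]; last first.
  exists (arr None), (dc u); split=> //.
  by rewrite delta_top wc0 !scale0r addr0.
have [|j /andP[jE wj] minj] := @ex_minnP (fun j => (j <= 2 * E)%N && (wc u j != 0)).
  apply: contrapT => N; apply: u0; rewrite [u](top_decomp tP) dc0 !scale0r add0r.
  rewrite big1 // => j _; case: (eqVneq (wc u j) 0) => [->|wj]; first by rewrite !scale0r.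
  by case: N; exists j; rewrite wj -ltnS ltn_ord.
exists (walk (vt e j) (2 * E - j)), (wc u j); split=> //.
rewrite {1}[u](top_decomp tP) dc0 !scale0r add0r scaler_sumr.
rewrite (bigD1 (Ordinal (jE : j < (2 * E).+1)%N)) //= big1 ?addr0 => [|i ij].
  by rewrite scalar_comm (walk_tw tP) eqxx subnKC.
rewrite scalar_comm (walk_tw tP); case: (ltngtP i j) => [lij|lij|/eqP].
- case: (eqVneq (wc u i) 0) => [->|wi]; first by rewrite !scale0r.
  by have := minj i; rewrite wi (leq_trans (ltnW lij) jE) leqNgt lij => /(_ isT).
- case: eqP => _; rewrite ?scaler0 // (tw_big tP) ?scaler0 //; lia.
by rewrite [(_ == _ :> nat)](negPf ij).
Qed.

Lemma top_hom_inj (X : lmodType A) (f : {linear P -> X}) :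
  f (tw (2 * E)) <> 0 -> injective f.
Proof.
move=> f0 u u' fu; apply/eqP; rewrite -subr_eq0; apply/eqP; apply: contrapT.
move=> N; have [a [c [c0 aE]]] := top_socle N; apply: f0; apply: (scalar_eq0 c0).
have fZ b x : f (b *: x) = b *: f x by rewrite linearZ.
by rewrite -fZ -aE fZ linearB fu subrr scaler0.
Qed.

(** An explicit Nakayama argument: up to longer walks, the walk of length m applied to [y] is a
    nonzero multiple of [tw m]. The induction variable [n] is the colength 2 E - m, so that longer
    walks come earlier. *)
Lemma top_gen_of y : wc y 0 != 0 -> forall x, cyc y x.
Proof.
move=> y0; have twn n : (n <= 2 * E)%N -> cyc y (tw (2 * E - n)).
  elim/ltn_ind: n => n IH nE; case: (eqVneq n (2 * E)%N) => [n2E|nN].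
    (* At length 0 the loop must be subtracted as well; it is recovered from delta y up to the
       socle. *)
    rewrite n2E subnn; have ctd : cyc y td.
      suff -> : td = ((wc y 0)^-1%:A : A) *: (arr None *: y
          - ((dc y)%:A : A) *: tw (2 * E)).
        apply: cycZ; apply: cycD; first by exists (arr None).
        rewrite -scaleNr; apply: cycZ.
        exists (((wc y 0)^-1%:A : A) * wlk (2 * E)).
        by rewrite -scalerA wlk_top_2E scalarM mulVf // !scale1r.
      by rewrite delta_top addrC addKr scalarM mulVf // !scale1r.
    suff -> : tw 0 = ((wc y 0)^-1%:A : A) *: (y - (((dc y)%:A : A) *: td +
        \sum_(j < 2 * E) ((wc y j.+1)%:A : A) *: tw j.+1)).
      apply: cycZ; apply: cycD; first by exists 1; rewrite scale1r.
      rewrite -scaleN1r; apply: cycZ; apply: cycD; first exact: cycZ.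
      apply: cyc_sum => j _; apply: cycZ; rewrite -(subKn (ltn_ord j)).
      by have := ltn_ord j => jE; apply: IH; lia.
    rewrite {2}[y](top_decomp tP) big_ord_recl addrCA addrK.
    by rewrite scalarM mulVf // !scale1r.
  have nlt : (n < 2 * E)%N by rewrite ltn_neqAle nN.
  have m0 : (0 < 2 * E - n)%N by rewrite subn_gt0.
  suff -> : tw (2 * E - n) = ((wc y 0)^-1%:A : A) *: (wlk (2 * E - n) *: y
      - \sum_(j < 2 * E) ((wc y j.+1)%:A : A) *:
          (if vt e j.+1 == ord_max then tw (j.+1 + (2 * E - n)) else 0)).
    apply: cycZ; apply: cycD; first by exists (wlk (2 * E - n)).
    rewrite -scaleN1r; apply: cycZ; apply: cyc_sum => j _; apply: cycZ.
    case: eqP => _; last by exists 0; rewrite scale0r.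
    case: (leqP n j) => nj.
      rewrite (tw_big tP); first by exists 0; rewrite scale0r.
      lia.
    have -> : (j.+1 + (2 * E - n) = 2 * E - (n - j.+1))%N by lia.
    by apply: IH; lia.
  rewrite wlk_top // big_ord_recl addrK eqxx add0n.
  by rewrite scalarM mulVf // !scale1r.
move=> x; rewrite [x](top_decomp tP); apply: cycD; last first.
  apply: cyc_sum => j _; apply: cycZ; have jE : (j <= 2 * E)%N by rewrite -ltnS.
  by rewrite -(subKn jE); apply: twn; rewrite leq_subr.
have := twn (2 * E)%N (leqnn _); rewrite subnn => c0; apply: cycZ.
by have := delta_tw tP 0; rewrite eqxx => <-; apply: cycZ.
Qed.

(* The Lambda-linear map attached to a linear form by the symmetrizing form of
   Lambda: walks of complementary lengths are dual to each other. *)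
Lemma top_coinduced (X : lmodType A) (psi : X -> k) :
  (forall c x y, psi ((c%:A : A) *: x + y) = c * psi x + psi y) ->
  exists r : {linear X -> P}, forall x, wc (r x) 0 = psi (wlk (2 * E) *: x).
Proof.
move=> psiP; have psiD x y : psi (x + y) = psi x + psi y.
  by have := psiP 1 x y; rewrite !scale1r mul1r.
have psi0 : psi 0 = 0 by apply: (addrI (psi 0)); rewrite -psiD !addr0.
(* Delta is its own dual, because delta^2 is the socle element; this gives the coefficient at
   [td]. *)
pose T x := ((psi (arr None *: x))%:A : A) *: td + \sum_(j < (2 * E).+1)
  ((psi (walk (vt e j) (2 * E - j) *: x))%:A : A) *: tw j.
have v2E : vt e (2 * E) = ord_max by rewrite mul2n -addnn vtD !vtE iter_ordSE.
have [r rE] : exists r : {linear X -> P}, forall x, r x = T x.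
  apply: (star_linear sA) => [c x y|i x|[i|] x].
  - have psia a : psi (a *: ((c%:A : A) *: x + y)) = c * psi (a *: x) + psi (a *: y).
      by rewrite scalerDr scalar_comm psiP.
    rewrite /T [X in _ = X + _]scalerDr scaler_sumr addrACA -big_split /=.
    rewrite scalarM -!scalerDl psia; congr (_ + _).
    by apply: eq_bigr => j _; rewrite psia scalarM -!scalerDl.
  - rewrite /T scalerDr scaler_sumr scalar_comm (idem_td tP); congr (_ + _).
      rewrite scalerA (sa_arr_idem sA) /=; case: eqP => _ //.
      by rewrite scale0r psi0 !scale0r scaler0.
    apply: eq_bigr => j _; rewrite scalar_comm (idem_tw tP) scalerA walk_idem.
    by case: eqP => _ //; rewrite scale0r psi0 !scale0r scaler0.
  - rewrite /T scalerDr scaler_sumr scalar_comm (alpha_td tP) scaler0 add0r.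
    rewrite scalerA (delta_alpha sA) scale0r psi0 !scale0r add0r.
    rewrite [LHS]big_ord_recl [RHS]big_ord_recr.
    rewrite [X in X + _ = _](_ : _ = 0) ?add0r; last first.
      rewrite scalerA walk_arr (walk_long sA) ?if_same; last by rewrite ltnS subn0.
      by rewrite scale0r psi0 !scale0r.
    rewrite [X in _ = _ + X](_ : _ = 0) ?addr0; last first.
      by rewrite scalar_comm (alpha_tw tP) (tw_big tP (ltnSn _)) if_same scaler0.
    apply: eq_bigr => j _; rewrite scalar_comm (alpha_tw tP) scalerA walk_arr lift0.
    rewrite -[nat_of_ord (widen_ord _ _)]/(nat_of_ord j).
    rewrite -[vt e j.+1]/(ordS (vt e j)) (can_eq (@ordSK _)) eq_sym subnSK //.
    by case: eqP => [->|_] //; rewrite scale0r psi0 !scale0r scaler0.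
  rewrite /T scalerDr scaler_sumr scalar_comm (delta_td tP) addrC.
  rewrite [X in X + _ = _]big_ord_recr [X in _ = _ + X]big_ord_recl.
  rewrite [X in X + _ + _ = _]big1 ?add0r => [|j _]; last first.
    rewrite scalerA -[nat_of_ord (widen_ord _ _)]/(nat_of_ord j).
    have : (0 < 2 * E - j)%N by rewrite subn_gt0.
    case: (2 * E - j)%N => // n _.
    by rewrite (walk_delta sA) scale0r psi0 !scale0r.
  rewrite [X in _ = _ + (_ + X)]big1 ?addr0 => [|j _]; last first.
    by rewrite scalar_comm (delta_tw tP) scaler0.
  rewrite subnn subn0 v2E scalerA [walk _ 0 * _](sa_idem_arr sA) eqxx; congr (_ + _).
  by rewrite scalar_comm (delta_tw tP) scalerA (delta_sq sA).
exists r => x; rewrite rE /T (wcD tP) (wcZ tP) (wc_td tP) // mulr0 add0r wc_sum.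
rewrite big_ord_recl big1 ?addr0 => [|j _]; last by rewrite (wcZ tP) (wc_tw tP) // mulr0.
by rewrite (wcZ tP) (wc_tw tP) // eqxx mulr1 subn0.
Qed.

End TopModuleTheory.
End BandGenerators.

(** * Syzygies and cosyzygies *)

Section Syzygies.
Variables (k : fieldType) (e : nat) (A : algType k).
Variables (idem : vertex e -> A) (arr : arrow e -> A).
Hypothesis sA : star_algebra idem arr.
Local Notation E := e.-1.+1.
Local Notation walk := (walk_elt idem arr).
Local Notation wlk := (walk ord_max).
Local Notation band_gen := (band_gen idem arr).

Lemma band_gen_iso mu (V W : lmodType A) (v : V) :
  mod_iso V W -> band_gen mu v -> exists w : W, band_gen mu w.
Proof.
move=> [f [g gK fK]] vP; have fZ a x : f (a *: x) = a *: f x by rewrite linearZ.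
exists (f v); split.
- by rewrite -fZ (bg_idem vP).
- by rewrite -fZ (bg_delta vP) !fZ.
- move=> fv0; apply: (bg_neq0 vP); apply: (can_inj gK).
  by rewrite fZ fv0 linear0.
move=> x; have [a aE] := bg_gen vP (g x).
by exists a; rewrite -fZ -aE fK.
Qed.

(** A finite spanning family of [A], stable up to zero under left multiplication by arrows; through
    it, finitely generated modules have finite dimension over k. *)
Definition star_family (t : option (vertex e * 'I_(2 * E).+1)) : A :=
  if t is Some (i, j) then walk i j else arr None.

Lemma star_family_span (a : A) : exists c, a = \sum_t c t *: star_family t.
Proof.
have single t : exists c, star_family t = \sum_u c u *: star_family u.
  exists (fun u => (u == t)%:R); rewrite (bigD1 t) //= eqxx scale1r big1 ?addr0 //.
  by move=> u /negPf ->; rewrite scale0r.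
have zero : exists c, 0 = \sum_u c u *: star_family u.
  by exists (fun=> 0); rewrite big1 // => u _; rewrite scale0r.
have add x y : (exists c, x = \sum_u c u *: star_family u) ->
    (exists c, y = \sum_u c u *: star_family u) ->
    exists c, x + y = \sum_u c u *: star_family u.
  move=> [c ->] [d ->]; exists (fun t => c t + d t); rewrite -big_split.
  by apply: eq_bigr => t _; rewrite scalerDl.
have scale c x : (exists d, x = \sum_u d u *: star_family u) ->
    exists d, c *: x = \sum_u d u *: star_family u.
  move=> [d ->]; exists (fun t => c * d t); rewrite scaler_sumr.
  by apply: eq_bigr => t _; rewrite scalerA.
have sum (F : _ -> A) : (forall u, exists c, F u = \sum_u c u *: star_family u) ->
    exists c, \sum_u F u = \sum_u c u *: star_family u.
  by move=> FP; elim/big_ind: _.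
elim/(sa_ind sA): a => [||v|a x [c ->]] //.
  by apply: (single (Some (v, ord0))).
rewrite mulr_sumr; apply: sum => t; rewrite -scalerAr; apply: scale.
case: t a => [[i j]|] [v|] /=.
- rewrite (arr_walk sA); case: eqP => _ //.
  case: (ltnP j (2 * E)) => jE; last by rewrite (walk_long sA).
  exact: (single (Some (i, Ordinal (jE : j.+1 < (2 * E).+1)%N))).
- case: j => [[|j] jE]; last by rewrite (delta_walk sA).
  rewrite /= (sa_arr_idem sA); case: eqP => _ //; exact: (single None).
- by rewrite (alpha_delta sA).
rewrite (delta_sq sA); exact: (single (Some (ord_max, ord_max))).
Qed.

Lemma star_linear_form (X : lmodType A) (x0 : X) : fin_gen X -> x0 <> 0 ->
  exists psi : X -> k, psi x0 != 0 /\
    forall c x y, psi ((c%:A : A) *: x + y) = c * psi x + psi y.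
Proof.
move=> [n [g gP]]; apply: (@linear_form_neq0 k A X _ (fun t => star_family t.1 *: g t.2)).
move=> x; have [a ->] := gP x; have [c cE] := choice (fun i => star_family_span (a i)).
exists (fun t => c t.2 t.1); under [RHS]eq_bigl => t do rewrite inE.
under [LHS]eq_bigr => i _ do rewrite cE scaler_suml.
rewrite exchange_big pair_bigA /=; apply: eq_bigr => -[t i] _ /=.
by rewrite (scale_scalar _ (star_family t)).
Qed.

Section WithTop.
Variables (P : lmodType A) (td : P) (tw : nat -> P) (dc : P -> k) (wc : P -> nat -> k).
Hypothesis tP : top_module idem arr td tw dc wc.

Section Kernel.
Variables (mu : k) (V : lmodType A) (v : V).
Hypotheses (mu0 : mu != 0) (vP : band_gen mu v).

Let kap : P := td - (mu%:A : A) *: tw E.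

Lemma delta_kap : arr None *: kap = tw (2 * E).
Proof.
by rewrite /kap scalerBr (delta_td tP) scalar_comm (delta_tw tP) scaler0 subr0.
Qed.

Lemma wlk_kap j : (0 < j)%N -> wlk j *: kap = - ((mu%:A : A) *: tw (E + j)).
Proof.
case: j => // j _; rewrite /kap scalerBr (walk_td tP) scalar_comm (walk_tw tP).
by rewrite vtE eqxx sub0r.
Qed.

Variable pi : {linear P -> V}.
Hypothesis piE : pi (tw 0) = v.

Lemma cover_surj : surjective pi.
Proof.
move=> x; have [a ->] := bg_gen vP x; exists (a *: tw 0).
by rewrite linearZ piE.
Qed.

(** As delta v = mu C v, the loop coefficient, multiplied by mu, is added to that of C; the walks
    longer than E vanish on [v]. *)
Lemma cover_formula u : pi u = \sum_(j < E.+1)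
  ((wc u j + (if j == E :> nat then mu * dc u else 0))%:A : A) *: (wlk j *: v).
Proof.
rewrite (top_hom_formula tP) piE (bg_delta vP) scalarM.
rewrite -(big_mkord xpredT (fun j => ((wc u j)%:A : A) *: (wlk j *: v))).
rewrite (@big_cat_nat _ _ _ E.+1) //; last by lia.
rewrite [X in _ + (_ + X)]big_nat_cond.
rewrite [X in _ + (_ + X)]big1 ?addr0 => [|j /andP[/andP[jE _] _]]; last first.
  by rewrite (bg_walk sA mu0 vP) // scaler0.
rewrite big_mkord [X in _ + X = _]big_ord_recr [RHS]big_ord_recr eqxx addrCA.
congr (_ + _).
  by apply: eq_bigr => j _; rewrite (ltn_eqF (ltn_ord j)) addr0.
by rewrite addrC -scalerDl -scalerDl mulrC.
Qed.

Lemma cover_kap : pi kap = 0.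
Proof.
rewrite cover_formula big1 // => j _; have jE : (j <= 2 * E)%N by have := ltn_ord j; lia.
rewrite /kap -scaleNr -scaleNr [td + _]addrC (wcP tP) (dcP tP) (wc_td tP) // (dc_td tP).
rewrite (dc_tw tP) (wc_tw tP) // addr0 mulr0 add0r mulr1 eq_sym.
by case: eqP => _; rewrite ?mulr1 ?mulr0 ?addNr ?addr0 !scale0r.
Qed.

(** Subtracting [dc u] times [kap] removes the loop. The coefficients left on walks of length at
    most E vanish by [bg_inj], and longer walks are multiples of [kap] because mu <> 0. *)
Lemma cover_ker u : pi u = 0 -> cyc kap u.
Proof.
rewrite cover_formula => u0.
have {}u0 := bg_inj sA mu0 vP
  (c := fun j => wc u j + (if j == E then mu * dc u else 0)) u0.
have -> : u = ((dc u)%:A : A) *: kap + \sum_(j < (2 * E).+1)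
   ((wc u j + (if j == E :> nat then mu * dc u else 0))%:A : A) *: tw j.
  rewrite {1}[u](top_decomp tP) /kap scalerBr -addrA; congr (_ + _).
  have EE : (E < (2 * E).+1)%N by lia.
  rewrite (bigD1 (Ordinal EE)) //= [in RHS](bigD1 (Ordinal EE)) //= eqxx.
  rewrite scalerDl scalerDl -[X in _ = _ + X]addrA [X in _ = _ + X]addrCA scalarM.
  rewrite (mulrC mu) addKr; congr (_ + _).
  apply: eq_bigr => j jE; rewrite ifN ?addr0 //.
apply: cycD; first by apply: cycZ; exists 1; rewrite scale1r.
apply: cyc_sum => j _; case: (leqP j E) => jE.
  by exists 0; rewrite u0 // !scale0r.
apply: cycZ; exists (- (((mu^-1)%:A : A) * wlk (j - E))).
rewrite scaleNr -scalerA wlk_kap ?subn_gt0 // scalerN opprK scalarM mulVf //.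
by rewrite !scale1r subnKC // ltnW.
Qed.

End Kernel.

Lemma band_top mu (V : lmodType A) (v : V) : band_gen mu v ->
  exists pi : {linear P -> V}, pi (tw 0) = v.
Proof. by move=> vP; apply: (top_hom sA tP (bg_idem vP)). Qed.

Lemma syzygy_band mu (V W : lmodType A) (v : V) : mu != 0 -> band_gen mu v ->
  is_syzygy V W -> exists w : W, band_gen (- mu^-1) w.
Proof.
move=> mu0 vP [Q [i [p [[_ Q_proj p_surj p_sup] [i_inj _ i_ker]]]]].
have [pi piE] := band_top vP.
have [l lE] := top_projective sA tP pi p_surj.
have l_surj : surjective l.
  apply: p_sup => [|x].
    split=> [|a _ _ [x <-] [y <-]]; first by exists 0; rewrite linear0.
    by exists (a *: x + y); rewrite linearP.
  have [y yE] := cover_surj vP piE (p x); exists (l y), (x - l y); split.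
  - by exists y.
  - by rewrite linearB lE yE subrr.
  - by rewrite addrC subrK.
have [s sK] := Q_proj _ _ l idfun l_surj.
have l_inj : injective l.
  (* It suffices that s l does not kill the socle of P. As pi (s (l (tw 0))) = v and C v <> 0, the
     element s (l (tw 0)) has a nonzero top coefficient, which C^2 carries to the socle. *)
  have sl : injective (s \o l).
    apply: (top_hom_inj tP) => /= sl0.
    have slv : pi (s (l (tw 0))) = v by rewrite -lE sK lE.
    have := wlk_E_hom tP (f := pi) (s (l (tw 0))).
    rewrite piE slv => /(_ (bg_walk sA mu0 vP)) wE.
    have wc0 : wc (s (l (tw 0))) 0 = 0.
      have := wlk_top_2E tP (s (l (tw 0))).
      have sZ a x : s (l (a *: x)) = a *: s (l x) by rewrite !linearZ.
      rewrite -sZ (wlk_tw0 tP) sl0 => /esym/eqP.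
      case: (eqVneq (wc (s (l (tw 0))) 0) 0) => // w0 /eqP /(scalar_eq0 w0).
      by move/(tw_neq0 tP (leqnn _)).
    by apply: (bg_neq0 vP); rewrite wE wc0 !scale0r.
  by move=> x y xy; apply: sl; rewrite /= xy.
pose kap := td - (mu%:A : A) *: tw E.
have [w wE] : exists w, i w = l kap.
  by apply/i_ker; rewrite lE (cover_kap mu0 vP piE).
have iZ a x : i (a *: x) = a *: i x by rewrite linearZ.
have lZ a x : l (a *: x) = a *: l x by rewrite linearZ.
exists w; split.
- apply: i_inj; rewrite iZ wE -lZ; congr (l _).
  rewrite /kap scalerBr (idem_td tP) scalar_comm (idem_tw tP) vtE.
  by rewrite !eqxx.
- apply: i_inj; rewrite !iZ wE -!lZ; congr (l _).
  rewrite delta_kap wlk_kap // scalerN scalarM mulNr mulVf //.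
  by rewrite scaleN1r scaleN1r opprK mul2n addnn.
- move=> w0; have := congr1 i w0; rewrite iZ wE -lZ linear0 wlk_kap //.
  rewrite -(linear0 l) => /l_inj/eqP; rewrite oppr_eq0 addnn -mul2n => /eqP.
  by move/(scalar_eq0 mu0)/(tw_neq0 tP (leqnn _)).
move=> x; have [u uE] := l_surj (i x).
have [|a aE] := cover_ker mu0 vP piE (u := u).
  by rewrite -lE uE; apply/i_ker; exists x.
by exists a; apply: i_inj; rewrite iZ wE -lZ -[kap]/(td - _) -aE.
Qed.

(** V is itself the syzygy of B(1, -1/mu), so it embeds by [j] in P as the submodule generated by
    delta + C / mu. The extension [l] of this embedding identifies P with the given hull [I], and W
    becomes P modulo that submodule. *)
Lemma cosyzygy_band mu (V W : lmodType A) (v : V) : mu != 0 -> band_gen mu v ->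
  is_cosyzygy V W -> exists w : W, band_gen (- mu^-1) w.
Proof.
move=> mu0 vP [I [i [p [[I_fg I_inj i_inj i_ess] [_ p_surj p_ker]]]]].
have [pi piE] := band_top vP.
pose kap := td - ((- mu^-1)%:A : A) *: tw E.
have nu0 : - mu^-1 != 0 by rewrite oppr_eq0 invr_eq0.
have kap_idem : idem ord_max *: kap = kap.
  by rewrite /kap scalerBr (idem_td tP) scalar_comm (idem_tw tP) vtE !eqxx.
have [f fE] := top_hom sA tP kap_idem.
have fZ a x : f (a *: x) = a *: f x by rewrite linearZ.
have ftd : f td = tw (2 * E).
  by have := delta_tw tP 0; rewrite eqxx => <-; rewrite fZ fE delta_kap.
have ftw : f (tw E) = (mu^-1%:A : A) *: tw (2 * E).
  by rewrite -(wlk_tw0 tP E) fZ fE wlk_kap // -scaleNr -scaleNr opprK addnn mul2n.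
have [|j jE] := @factor_surjection _ _ _ _ pi f (cover_surj vP piE).
  move=> x /(cover_ker mu0 vP piE)[a ->].
  by rewrite fZ linearB [f (_ *: tw E)]fZ ftd ftw scalarM mulfV // !scale1r
    subrr scaler0.
have jZ a x : j (a *: x) = a *: j x by rewrite linearZ.
have jv : j v = kap by rewrite -piE jE.
have jC : j (wlk E *: v) = (mu^-1%:A : A) *: tw (2 * E).
  by rewrite jZ jv wlk_kap // -scaleNr -scaleNr opprK addnn mul2n.
have jw l : j (wlk l *: v) =
    (((l == 0%N)%:R : k)%:A : A) *: td + (mu^-1%:A : A) *: tw (E + l).
  case: l => [|l]; last first.
    by rewrite jZ jv wlk_kap // -scaleNr -scaleNr opprK !scale0r add0r.
  by rewrite (bg_idem vP) jv addn0 !scale1r /kap -scaleNr -scaleNr opprK.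
have j_sum (c : nat -> k) : j (\sum_(l < E.+1) ((c l)%:A : A) *: (wlk l *: v)) =
    \sum_(l < E.+1) ((c l)%:A : A) *: j (wlk l *: v).
  by rewrite linear_sum; apply: eq_bigr => l _; rewrite linearZ.
(* In the image of [j] the coefficient [c m] is read at the walk of length E + m, up to 1/mu; [c 0]
   is read a second time at the loop. *)
have j_dc (c : nat -> k) : dc (j (\sum_(l < E.+1) ((c l)%:A : A) *: (wlk l *: v))) = c 0%N.
  rewrite j_sum (dc_sum tP) big_ord_recl big1 => [|l _].
    by rewrite (dcZ tP) jw (dcP tP) (dcZ tP) (dc_td tP) (dc_tw tP) !mulr1 mulr0 !addr0 mulr1.
  by rewrite (dcZ tP) jw (dcP tP) (dcZ tP) (dc_tw tP) !mulr0 mul0r addr0 mulr0.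
have j_wc (c : nat -> k) m : (m <= E)%N ->
    wc (j (\sum_(l < E.+1) ((c l)%:A : A) *: (wlk l *: v))) (E + m) = c m * mu^-1.
  move=> mE; have m2E : (E + m <= 2 * E)%N by lia.
  rewrite j_sum (wc_sum tP) (bigD1 (Ordinal (mE : m < E.+1)%N)) //= big1 => [|l lm].
    rewrite (wcZ tP) jw (wcP tP) (wcZ tP) (wc_td tP) // (wc_tw tP) // eqxx.
    by rewrite mulr0 add0r mulr1 addr0.
  rewrite (wcZ tP) jw (wcP tP) (wcZ tP) (wc_td tP) // mulr0 add0r.
  by rewrite (wc_tw tP) // eqn_add2l [(_ == _ :> nat)](negPf lm) !mulr0.
have j_inj : injective j.
  move=> x y xy; apply/eqP; rewrite -subr_eq0; apply/eqP.
  have [c cE] := bg_surj sA mu0 vP (x - y); rewrite cE big1 // => l _.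
  have := j_wc c l (leq_ord l); rewrite -cE linearB xy subrr.
  rewrite (wc0 tP) => /esym/eqP.
  by rewrite mulf_eq0 invr_eq0 (negPf mu0) orbF => /eqP ->; rewrite !scale0r.
have [l lE] := I_inj _ _ j i j_inj.
have lZ a x : l (a *: x) = a *: l x by rewrite linearZ.
have l2E : l (tw (2 * E)) <> 0.
  move=> l0; apply: (bg_neq0 vP); apply: i_inj.
  by rewrite -lE jC lZ l0 scaler0 linear0.
have l_inj : injective l := top_hom_inj tP l2E.
(* The form is nonzero on [l] of the socle, so the coinduced map [r] sends l (tw 0) to a generator
   of P. Then r l is bijective, [r] is injective because [i] is essential, and [l] is onto. *)
have [psi [psi0 psiP]] := star_linear_form I_fg l2E.
have [r rE] := top_coinduced sA tP psiP.
have wcrl : wc (r (l (tw 0))) 0 != 0.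
  by rewrite rE -lZ (wlk_tw0 tP).
have rlZ a x : r (l (a *: x)) = a *: r (l x) by rewrite !linearZ.
have rl_inj : injective (r \o l).
  apply: (top_hom_inj tP); rewrite /= -(wlk_tw0 tP) rlZ (wlk_top_2E tP).
  by move/(scalar_eq0 wcrl); apply: (tw_neq0 tP).
have r_inj x : r x = 0 -> x = 0.
  apply: (i_ess (fun x => r x = 0)) x => [|x rx [y yx]].
    by split=> [|a x y rx ry]; rewrite ?linear0 // linearP rx ry scaler0 addr0.
  rewrite -yx -lE; suff -> : j y = 0 by rewrite linear0.
  by apply: rl_inj; rewrite /= lE yx rx !linear0.
have l_surj : surjective l.
  move=> z; have [a aE] := top_gen_of tP wcrl (r z); exists (a *: tw 0).
  apply/eqP; rewrite eq_sym -subr_eq0; apply/eqP; apply: r_inj.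
  by rewrite linearB rlZ aE subrr.
have plZ a x : p (l (a *: x)) = a *: p (l x) by rewrite !linearZ.
have plkap : p (l kap) = 0 by apply/p_ker; exists v; rewrite -lE jv.
exists (p (l (tw 0))); split.
- by rewrite -plZ (idem_tw tP) eqxx.
- have ->: (- mu^-1)%:A *: (wlk E *: p (l (tw 0))) = p (l ((- mu^-1)%:A *: tw E)).
    by rewrite -!plZ (wlk_tw0 tP).
  apply/eqP; rewrite -subr_eq0 -plZ (delta_tw tP) eqxx; apply/eqP.
  by rewrite -plkap /kap !linearB.
- rewrite -plZ (wlk_tw0 tP) => /p_ker[y]; rewrite -lE => /l_inj jy.
  (* If tw E were j y, its loop coefficient would give c 0 = 0, and its coefficient at the walk of
     length E would give c 0 / mu = 1. *)
  have [c cE] := bg_surj sA mu0 vP y.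
  have := j_wc c 0%N (leq0n _); rewrite -(j_dc c) -cE jy (dc_tw tP) addn0.
  by rewrite (wc_tw tP) ?eqxx ?mul0r => [/eqP|]; [rewrite oner_eq0 | lia].
move=> x; have [y yx] := p_surj x; have [u uy] := l_surj y.
exists (dc u *: arr None + \sum_(j < (2 * E).+1) wc u j *: wlk j).
by rewrite -plZ -(top_gen tP) uy yx.
Qed.

End WithTop.
End Syzygies.

(** * Stable endomorphism rings of band modules *)

Section StableEndomorphisms.
Variables (k : fieldType) (e : nat) (A : algType k).
Variables (idem : vertex e -> A) (arr : arrow e -> A).
Hypothesis sA : star_algebra idem arr.
Local Notation E := e.-1.+1.
Local Notation walk := (walk_elt idem arr).
Local Notation wlk := (walk ord_max).
Local Notation band_gen := (band_gen idem arr).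

(* [is_band_module] over an abstract algebra. *)
Definition band_iso (n : nat) (lam : k) (V : lmodType A)
    (phi : band_space k e n -> V) : Prop :=
  [/\ bijective phi,
      forall c w w', phi (c *: w + w') = (c%:A : A) *: phi w + phi w',
      forall i w, phi (band_vertex i w) = idem i *: phi w
    & forall a w, phi (band_arrow lam a w) = arr a *: phi w].

(** A field has no nonzero nilpotent. P only serves as a projective module through which the zero
    map f f factors. *)
Lemma square_zero_factors (V : lmodType A) (f : {linear V -> V}) :
  stable_End_iso k V -> (forall v, f (f v) = 0) -> factors_through_projective f.
Proof.
move=> [r [_ rM _ _ r0]] ff; apply/r0; apply/eqP.
suff : r f * r f == 0 by rewrite mulf_eq0 orbb.
apply/eqP; rewrite -rM; apply/r0.
have [P [td [tw [dc [wc tP]]]]] := top_module_exists sA.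
have [|g gE] := @linear_of A V P (fun=> 0); first by move=> *; rewrite scaler0 addr0.
have [|h hE] := @linear_of A P V (fun=> 0); first by move=> *; rewrite scaler0 addr0.
exists P, g, h; split; [exact: top_fin_gen tP|exact (top_projective sA tP)|].
by move=> v; rewrite hE /= ff.
Qed.

Section BandModule.
Variables (n : nat) (lam : k) (V : lmodType A) (phi : band_space k e n -> V).
Hypothesis phiP : band_iso lam phi.

Definition band_at (i : vertex e) (c : 'cV[k]_n) : band_space k e n :=
  ([ffun j => if j == i then c else 0], 0).
Definition band_top_elt (c : 'cV[k]_n) : V := phi (band_at ord_max c).
Local Notation X := band_top_elt.
Local Notation J := (jordan_block n lam).

Lemma band_iso_linear c w w' : phi (c *: w + w') = (c%:A : A) *: phi w + phi w'.
Proof. by case: phiP. Qed.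

Lemma band_isoD w w' : phi (w + w') = phi w + phi w'.
Proof. by have := band_iso_linear 1 w w'; rewrite !scale1r. Qed.

Lemma band_iso0 : phi 0 = 0.
Proof. by apply: (addrI (phi 0)); rewrite -band_isoD !addr0. Qed.

Lemma band_iso_inj : injective phi.
Proof. by case: phiP => /bij_inj. Qed.

Lemma band_at_linear i c u v : band_at i (c *: u + v) = c *: band_at i u + band_at i v.
Proof.
congr (_, _); last by rewrite /= scaler0 addr0.
by apply/ffunP => j; rewrite !ffunE; case: eqP => _ //; rewrite scaler0 addr0.
Qed.

Lemma top_elt_linear c u v : X (c *: u + v) = (c%:A : A) *: X u + X v.
Proof. by rewrite /X band_at_linear band_iso_linear. Qed.

Lemma top_elt_scale c u : X (c *: u) = (c%:A : A) *: X u.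
Proof.
have X0 : X 0 = 0.
  by apply: (addrI (X 0)); have := top_elt_linear 1 0 0; rewrite !scale1r !addr0.
by have := top_elt_linear c u 0; rewrite X0 !addr0.
Qed.

Lemma top_elt_sum_delta c : X c = \sum_i ((c i 0)%:A : A) *: X (delta_mx i 0).
Proof.
have XD u v : X (u + v) = X u + X v by have := top_elt_linear 1 u v; rewrite !scale1r.
have X0 : X 0 = 0 by rewrite -(scale0r 0) top_elt_scale !scale0r.
rewrite {1}[c]matrix_sum_delta (big_morph X XD X0); apply: eq_bigr => i _.
by rewrite big_ord1 top_elt_scale.
Qed.

Lemma top_elt_idem c : idem ord_max *: X c = X c.
Proof.
case: phiP => _ _ phi_i _; rewrite /X -phi_i; congr phi; congr (_, _); last by rewrite eqxx.
by apply/ffunP => j; rewrite !ffunE; case: eqP.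
Qed.

Lemma wlk_top_elt_lt j c : (j < E)%N -> wlk j *: X c = phi (band_at (vt e j) c).
Proof.
elim: j => [|j IH] jE; first by rewrite top_elt_idem.
rewrite [wlk _]/= -scalerA IH; last exact: ltnW.
case: phiP => _ _ _ phi_a; rewrite -phi_a; congr phi; rewrite /=.
case: eqP => [vj|_]; last first.
  by congr (_, _); apply/ffunP => l; rewrite !ffunE eqxx.
have := @vt_eq0 e j.+1 (ltnW jE) vj; lia.
Qed.

Lemma wlk_E_top_elt c : wlk E *: X c = phi (0, c).
Proof.
rewrite [wlk E]/= -scalerA wlk_top_elt_lt //.
case: phiP => _ _ _ phi_a; rewrite -phi_a; congr phi; rewrite /=.
have := vtE e; rewrite /vt /= => ->; rewrite eqxx; congr (_, _).
by rewrite ffunE eqxx.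
Qed.

Lemma wlk_top_elt_big j c : (E < j)%N -> wlk j *: X c = 0.
Proof.
move=> jE; have -> : j = ((j - E.+1).+1 + E)%N by lia.
rewrite (wlkDE sA) -scalerA wlk_E_top_elt; elim: (j - E.+1)%N => [|l IH]; last first.
  by rewrite [wlk _]/= -scalerA IH scaler0.
rewrite [wlk 1]/= (sa_arr_idem sA) eqxx; case: phiP => _ _ _ phi_a.
rewrite -phi_a -band_iso0; congr phi; rewrite /= ffunE.
by case: eqP => // _; congr (_, _); apply/ffunP => l; rewrite !ffunE if_same.
Qed.

Lemma top_elt_delta c : arr None *: X c = wlk E *: X (J *m c).
Proof.
rewrite wlk_E_top_elt; case: phiP => _ _ _ phi_a; rewrite -phi_a; congr phi.
by congr (_, _); rewrite /= ffunE eqxx.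
Qed.

Lemma wlk_E_top_elt_eq0 c : wlk E *: X c = 0 -> c = 0.
Proof. by rewrite wlk_E_top_elt -band_iso0 => /band_iso_inj[]. Qed.

Lemma band_ind (Q : V -> Prop) :
  (forall x y, Q x -> Q y -> Q (x + y)) ->
  (forall j c, Q (wlk j *: X c)) -> forall x, Q x.
Proof.
move=> QD QX x; have [[psi _ psiK] _ _ _] := phiP.
rewrite -[x]psiK; case: (psi x) => f y.
have -> : (f, y) = \sum_i band_at i (f i) + (0, y) :> band_space k e n.
  have sE : \sum_i band_at i (f i) = (f, 0) :> band_space k e n.
    have e1 (F : vertex e -> band_space k e n) : (\sum_i F i).1 = \sum_i (F i).1.
      by rewrite (big_morph fst (id1 := 0) (op1 := +%R)).
    have e2 (F : vertex e -> band_space k e n) : (\sum_i F i).2 = \sum_i (F i).2.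
      by rewrite (big_morph snd (id1 := 0) (op1 := +%R)).
    rewrite [LHS]surjective_pairing e1 e2; congr (_, _); last by rewrite big1.
    apply/ffunP => j; rewrite sum_ffunE (bigD1 j) //= ffunE eqxx big1 ?addr0 //.
    by move=> i ij; rewrite ffunE eq_sym (negPf ij).
  by rewrite sE; congr (_, _); rewrite /= ?addr0 ?add0r.
rewrite band_isoD; apply: (QD); last by rewrite -wlk_E_top_elt.
have Q0 : Q 0 by rewrite -(wlk_top_elt_big 0 (ltnSn E)).
elim/big_rec: _ => [|i w _ Qw]; first by rewrite band_iso0.
rewrite band_isoD; apply: (QD) => //.
(* Vertices being numbered from 0, i + 1 arrows lead from e to [i]; the remainder replaces the full
   turn at e by the walk of length 0. *)
have -> : i = vt e (i.+1 %% E).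
  apply: val_inj; rewrite /= val_iter_ordS /= modnDmr addnS -addSn addnC modnDr.
  by rewrite modn_small.
by rewrite -wlk_top_elt_lt // ltn_mod.
Qed.

Lemma band_endo (T : band_space k e n -> band_space k e n) :
  (forall c w w', T (c *: w + w') = c *: T w + T w') ->
  (forall i w, T (band_vertex i w) = band_vertex i (T w)) ->
  (forall a w, T (band_arrow lam a w) = band_arrow lam a (T w)) ->
  exists f : {linear V -> V}, forall w, f (phi w) = phi (T w).
Proof.
move=> TP Ti Ta; have [[psi phiK psiK] phiL phi_i phi_a] := phiP.
have [|i x|a x|f fE] := @star_linear k e A _ _ sA V V (fun x => phi (T (psi x))).
- move=> c x y; rewrite -phiL -TP; congr (phi (T _)).
  by apply: (can_inj phiK); rewrite phiL !psiK.
- rewrite -phi_i -Ti; congr (phi (T _)).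
  by apply: (can_inj phiK); rewrite phi_i !psiK.
- rewrite -phi_a -Ta; congr (phi (T _)).
  by apply: (can_inj phiK); rewrite phi_a !psiK.
by exists f => w; rewrite fE phiK.
Qed.

Section WithTop.
Variables (P : lmodType A) (td : P) (tw : nat -> P) (dc : P -> k) (wc : P -> nat -> k).
Hypothesis tP : top_module idem arr td tw dc wc.

Lemma dc_wlk_E u : dc (wlk E *: u) = 0.
Proof.
rewrite (wlk_top tP) // (dc_sum tP) big1 // => j _; rewrite (dcZ tP).
by case: eqP => _; rewrite ?(dc_tw tP) ?(dc0 tP) mulr0.
Qed.

Lemma dc_delta u : dc (arr None *: u) = wc u 0.
Proof.
by rewrite (delta_top tP) (dcP tP) (dcZ tP) (dc_tw tP) (dc_td tP) mulr0 add0r mulr1.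
Qed.

(** After lifting to copies of P, the equation delta X(c) = C X(J c) is compared at the loop: delta
    u has the top coefficient of u there, and C u has 0. So the lift has no top coefficient. *)
Lemma factor_radical (f : {linear V -> V}) c :
  factors_through_projective f -> wlk E *: f (X c) = 0.
Proof.
move=> [Q [g [h [_ Q_proj fE]]]].
have [pi piE] := choice (fun j : 'I_n => top_hom sA tP (top_elt_idem (delta_mx j 0))).
have [|Pi PiE] := @linear_of A {ffun 'I_n -> P} V (fun F => \sum_j pi j (F j)).
  move=> a F G; rewrite scaler_sumr -big_split; apply: eq_bigr => j _.
  by rewrite !ffunE linearP.
have Pi_surj : surjective Pi.
  apply: band_ind => [x y [F <-] [G <-]|j d]; first by exists (F + G); rewrite linearD.
  exists [ffun i => ((d i 0)%:A : A) *: (wlk j *: tw 0)]; rewrite PiE.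
  rewrite top_elt_sum_delta scaler_sumr; apply: eq_bigr => i _.
  by rewrite ffunE !linearZ /= piE scalar_comm.
have [h' h'E] := Q_proj _ _ Pi h Pi_surj.
have GZ a x : h' (g (a *: x)) = a *: h' (g x) by rewrite !linearZ.
have wc0 j : wc (h' (g (X c)) j) 0 = 0.
  have := GZ (arr None) (X c); rewrite top_elt_delta GZ => /ffunP/(_ j).
  by rewrite !ffunE => /(congr1 dc); rewrite dc_wlk_E dc_delta.
rewrite fE -h'E PiE scaler_sumr big1 // => j _.
rewrite (wlk_E_hom tP) ?wc0 ?scale0r ?scale0r // => l lE.
by rewrite piE wlk_top_elt_big.
Qed.

End WithTop.

Lemma band_rank1 : (0 < n)%N -> stable_End_iso k V -> n = 1%N.
Proof.
move=> n0 sV; case: (ltngtP n 1) => // n1; first by move: n0; rewrite lt0n; case: n n1.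
(* This is (J - lam)^(n-1), whence it commutes with J; it squares to 0 as n > 1. *)
pose D : 'M[k]_n := delta_mx (Ordinal n0) (rev_ord (Ordinal n0)).
have DJ : D *m J = J *m D.
  apply/matrixP => i j; rewrite !mxE (bigD1 (rev_ord (Ordinal n0))) //= big1 => [|l lN].
    rewrite (bigD1 (Ordinal n0)) //= big1 => [|l lN].
      have jn := ltn_ord j; rewrite !mxE !eqxx andbT [X in _ = X]addr0 [X in X = _]addr0.
      have -> : ((rev_ord (Ordinal n0)).+1 == j) = false by apply/eqP => /=; lia.
      rewrite !addr0 [j == _]eq_sym.
      by case: (i == _); case: (_ == j); rewrite ?mulr1n ?mulr0n ?mul1r ?mulr1 ?mul0r ?mulr0.
    by rewrite !mxE (negPf lN) mulr0.
  by rewrite !mxE (negPf lN) andbF mul0r.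
have DD : D *m D = 0.
  rewrite mul_delta_mx_0 //; apply/eqP => /(congr1 val) /=; lia.
have [|||f fE] := @band_endo (fun w => ([ffun j => D *m w.1 j], D *m w.2)).
- move=> c [x y] [x' y']; congr (_, _); rewrite /= ?linearP //.
  by apply/ffunP => j; rewrite !ffunE linearP.
- move=> i [x y]; congr (_, _); rewrite /= ?ffunE; last by case: eqP; rewrite ?mulmx0.
  by apply/ffunP => j; rewrite !ffunE; case: eqP; rewrite ?mulmx0.
- move=> [i|] [x y]; rewrite /=; last first.
    by congr (_, _); [apply/ffunP => j; rewrite !ffunE mulmx0 | rewrite ffunE !mulmxA DJ].
  case: eqP => _; congr (_, _); rewrite /= ?ffunE ?mulmx0 //.
    by apply/ffunP => j; rewrite !ffunE mulmx0.
  by apply/ffunP => j; rewrite !ffunE; case: eqP; rewrite ?mulmx0.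
have ff v : f (f v) = 0.
  have [[psi _ psiK] _ _ _] := phiP; rewrite -[v]psiK !fE -band_iso0; congr phi.
  congr (_, _); rewrite /= ?mulmxA ?DD ?mul0mx //.
  by apply/ffunP => j; rewrite !ffunE mulmxA DD mul0mx.
have [P [td [tw [dc [wc tP]]]]] := top_module_exists sA.
have := factor_radical tP (delta_mx (rev_ord (Ordinal n0)) 0) (square_zero_factors sV ff).
have -> c : f (X c) = X (D *m c).
  rewrite /X fE; congr phi; congr (_, _); last by rewrite mulmx0.
  by apply/ffunP => j; rewrite !ffunE; case: eqP; rewrite ?mulmx0.
move/wlk_E_top_elt_eq0; rewrite mul_delta_mx => /matrixP/(_ (Ordinal n0) 0).
by rewrite !mxE !eqxx => /eqP; rewrite oner_eq0.
Qed.

End BandModule.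

Lemma band1_gen lam (V : lmodType A) (phi : band_space k e 1 -> V) :
  band_iso lam phi -> band_gen lam (band_top_elt phi 1).
Proof.
move=> phiP; have X1 (c : 'cV[k]_1) :
    band_top_elt phi c = ((c 0 0)%:A : A) *: band_top_elt phi 1.
  by rewrite -(top_elt_scale phiP) scalemx1 -mx11_scalar.
split.
- exact: top_elt_idem phiP _.
- by rewrite (top_elt_delta phiP) X1 scalar_comm mulmx1 !mxE eqxx addr0.
- by move/(wlk_E_top_elt_eq0 phiP)/eqP; rewrite oner_eq0.
apply: (band_ind phiP) => [x y|j c]; first exact: cycD.
by rewrite (X1 c); apply: cycZ; apply: cycZ; exists 1; rewrite scale1r.
Qed.

Lemma band1_stable lam (V : lmodType A) (phi : band_space k e 1 -> V) :
  band_iso lam phi -> lam != 0 -> stable_End_iso k V -> 1 + lam * lam != 0.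
Proof.
move=> phiP lam0 sV; have vP := band1_gen phiP; set v := band_top_elt phi 1 in vP.
have [|||f fE] := band_endo phiP (T := fun w => (0, w.1 ord_max)).
- by move=> c [x y] [x' y']; congr (_, _); rewrite /= ?ffunE // scaler0 addr0.
- move=> i [x y]; congr (_, _); rewrite /= ?ffunE 1?eq_sym //.
  by apply/ffunP => j; rewrite !ffunE if_same.
- move=> [i|] [x y]; rewrite /=; last by rewrite !ffunE mulmx0.
  rewrite ffunE; case: eqP => // iN; rewrite ?ffunE //= ?ffunE.
  rewrite eq_sym; case: eqP => // _; congr (_, _).
  by apply/ffunP => j; rewrite !ffunE if_same.
have ff x : f (f x) = 0.
  have [[psi _ psiK] _ _ _] := phiP; rewrite -[x]psiK !fE -(band_iso0 phiP); congr phi.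
  by rewrite /= ffunE.
have [Q [g [h [_ Q_proj fgh]]]] := square_zero_factors sV ff.
have [P [td [tw [dc [wc tP]]]]] := top_module_exists sA.
have [pi piE] := band_top sA tP vP.
have [h' h'E] := Q_proj _ _ pi h (cover_surj vP piE).
pose u := h' (g v); have GZ a x : h' (g (a *: x)) = a *: h' (g x) by rewrite !linearZ.
have piu : pi u = wlk E *: v.
  by rewrite h'E -fgh fE (wlk_E_top_elt phiP) /= ffunE eqxx.
(* The equation delta v = lam C v passes to [u]. At the socle of P, delta u has the loop coefficient
   of [u], and C u its coefficient at the walk of length E. *)
have du : dc u = lam * wc u E.
  have := GZ (arr None) v; rewrite (bg_delta vP) !GZ -/u (delta_top tP).
  move=> /(congr1 (fun x => wc x (2 * E)%N)).
  rewrite (wcP tP) !(wcZ tP) (wc_tw tP) // (wc_td tP) // eqxx mulr1 mulr0 addr0 => <-.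
  congr (_ * _); rewrite (wlk_top tP) // (wc_sum tP).
  have EE : (E < (2 * E).+1)%N by lia.
  rewrite (bigD1 (Ordinal EE)) // big1 ?addr0 => [|j /= jE]; rewrite (wcZ tP).
    rewrite -[nat_of_ord (Ordinal EE)]/E vtE eqxx addnn -mul2n (wc_tw tP) //.
    by rewrite eqxx mulr1 [LHS]addr0.
  case: eqP => _; last by rewrite (wc0 tP) mulr0.
  have {}jE : (j != E :> nat) by [].
  by rewrite (wc_tw tP) // [(_ == _)](_ : _ = false) ?mulr0 //; lia.
have := cover_formula sA tP lam0 vP piE u; rewrite piu => piuE.
(* These are the coefficients of pi u - C v = 0; the one at E is (1 + lam^2) [wc u E] - 1. *)
pose c j := wc u j + (if j == E then lam * dc u else 0) - (j == E)%:R.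
have c0 : \sum_(j < E.+1) ((c j)%:A : A) *: (wlk j *: v) = 0.
  under eq_bigr => j _ do rewrite scalerBl scalerBl.
  rewrite sumrB -piuE (bigD1 ord_max) // big1 => [|j jE].
    by rewrite eqxx !scale1r [X in _ - X]addr0 subrr.
  by rewrite [(_ == _ :> nat)](negPf jE) !scale0r.
have /eqP := bg_inj sA lam0 vP c0 (leqnn E).
rewrite /c eqxx du mulrA -{1}[wc u E]mul1r -mulrDl subr_eq0 => uE.
by apply/eqP => lam2; move: uE; rewrite lam2 mul0r eq_sym oner_eq0.
Qed.

End StableEndomorphisms.

(** * The ring of power series *)

Section IdealPowers.
Variables (k : fieldType) (R : comAlgType k) (I : R -> Prop).

Lemma ideal_pow_mul n x : I x -> forall a, ideal_pow I n (a * x ^+ n).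
Proof.
move=> xI a; exists 1%N, (fun=> a), (fun _ _ => x); split=> //.
by rewrite big_ord1 prodr_const card_ord.
Qed.

Lemma ideal_powMl n a x : ideal_pow I n x -> ideal_pow I n (a * x).
Proof.
move=> [s [b [c [cI ->]]]]; exists s, (fun i => a * b i), c; split=> //.
by rewrite mulr_sumr; apply: eq_bigr => i _; rewrite mulrA.
Qed.

Lemma ideal_powD n x y : ideal_pow I n x -> ideal_pow I n y -> ideal_pow I n (x + y).
Proof.
move=> [s [b [c [cI ->]]]] [s' [b' [c' [cI' ->]]]]; exists (s + s')%N.
exists (fun i => match split i with inl j => b j | inr j => b' j end).
exists (fun i => match split i with inl j => c j | inr j => c' j end); split.
  by move=> i; case: (split i).
rewrite big_split_ord; congr (_ + _); apply: eq_bigr => i _.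
  by case: splitP => j /= ij; [have -> : i = j by apply: val_inj | have := ltn_ord i; lia].
case: splitP => j /= ij; first by have := ltn_ord j; lia.
by have -> : i = j by apply: val_inj => /=; lia.
Qed.

Lemma ideal_powN n x : ideal_pow I n x -> ideal_pow I n (- x).
Proof. by move=> xI; rewrite -mulN1r; apply: ideal_powMl. Qed.

End IdealPowers.

Section PowerSeriesRing.
Variable k : fieldType.
Local Notation fps := (fps k).

Lemma fps_coefB (x y : fps) n : fps_coef (x - y) n = fps_coef x n - fps_coef y n.
Proof. by []. Qed.
Lemma fps_coefM (x y : fps) n :
  fps_coef (x * y) n = \sum_(i < n.+1) fps_coef x i * fps_coef y (n - i).
Proof. by []. Qed.
Lemma fps_coefZ c (x : fps) n : fps_coef (c *: x) n = c * fps_coef x n.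
Proof. by []. Qed.
Lemma fps_coef1 n : fps_coef (1 : fps) n = (n == 0%N)%:R.
Proof. by []. Qed.

Lemma fps_coef_sum (J : Type) (r : seq J) (Q : pred J) (F : J -> fps) n :
  fps_coef (\sum_(j <- r | Q j) F j) n = \sum_(j <- r | Q j) fps_coef (F j) n.
Proof. by apply: (big_morph (fun x : fps => fps_coef x n)). Qed.

Definition fps_t : fps := FPS (fun n => (n == 1%N)%:R).
Definition fps_shift n (x : fps) : fps := FPS (fun i => fps_coef x (i + n)).
Definition fps_low n (x : fps) := forall i, (i < n)%N -> fps_coef x i = 0.

Lemma fps_lowM m n x y : fps_low m x -> fps_low n y -> fps_low (m + n) (x * y).
Proof.
move=> xm yn i imn; rewrite fps_coefM big1 // => j _.
case: (ltnP j m) => jm; first by rewrite xm // mul0r.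
by rewrite yn ?mulr0 //; have := ltn_ord j; lia.
Qed.

Lemma fps_tX n : fps_t ^+ n = FPS (fun i => (i == n)%:R).
Proof.
elim: n => [|n IH]; apply: fpsP => i //.
rewrite exprS IH fps_coefM; case: i => [|i] /=; first by rewrite big_ord1 mul0r.
rewrite big_ord_recl big_ord_recl /= mul0r add0r mul1r big1 ?addr0 => [|j _].
  by rewrite subSS subn0.
by rewrite mul0r.
Qed.

Lemma fps_shiftP n x : fps_low n x -> x = fps_shift n x * fps_t ^+ n.
Proof.
move=> xn; apply: fpsP => i; rewrite fps_tX fps_coefM /=.
case: (ltnP i n) => ni.
  rewrite xn // big1 // => j _.
  by rewrite [(_ == _)](_ : _ = false) ?mulr0 //; lia.
have jn : (i - n < i.+1)%N by lia.
rewrite (bigD1 (Ordinal jn)) //= subnK // big1 ?addr0 => [|j].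
  by rewrite [(_ == _)](_ : _ = true) ?mulr1 //; lia.
rewrite -val_eqE /= => jN; rewrite [(_ == _)](_ : _ = false) ?mulr0 //.
by have := ltn_ord j; lia.
Qed.

(** The geometric series in [h], which has no constant term: coefficient n no longer changes after
    the partial sum [G n], so [g] takes the diagonal. *)
Lemma fps_inv (x : fps) : fps_coef x 0 != 0 -> exists y, x * y = 1.
Proof.
move=> x0; pose h := 1 - (fps_coef x 0)^-1 *: x.
have h1 : fps_low 1 h.
  by case=> // _; rewrite fps_coefB fps_coefZ mulVf // subrr.
have hn n : fps_low n (h ^+ n).
  by elim: n => // n IH; rewrite exprS -add1n; apply: fps_lowM.
pose G n : fps := \sum_(i < n.+1) h ^+ i.
pose g : fps := FPS (fun n => fps_coef (G n) n).
have gG n i : (i <= n)%N -> fps_coef g i = fps_coef (G n) i.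
  move=> /subnK <-; elim: (n - i)%N => // l ->.
  by rewrite addSn /G !fps_coef_sum [RHS]big_ord_recr /= hn ?addr0 // ltnS leq_addl.
exists ((fps_coef x 0)^-1 *: g).
have -> : x * ((fps_coef x 0)^-1 *: g) = (1 - h) * g.
  by rewrite /h subKr -scalerAl scalerAr.
apply: fpsP => n; have <- : fps_coef ((1 - h) * G n) n = fps_coef ((1 - h) * g) n.
  by rewrite !fps_coefM; apply: eq_bigr => i _; rewrite (gG n) // leq_subr.
have geo (a : fps) : (1 - a) * \sum_(i < n.+1) a ^+ i = 1 - a ^+ n.+1.
  by rewrite -[RHS]opprB subrX1 -mulNr opprB.
rewrite geo.
by rewrite fps_coefB hn // subr0.
Qed.

Definition fps_residue (x : fps) : k^o := fps_coef x 0.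
Lemma fps_residueB : zmod_morphism fps_residue.
Proof. by []. Qed.
HB.instance Definition _ := GRing.isZmodMorphism.Build fps k^o fps_residue fps_residueB.
Lemma fps_residueM : monoid_morphism fps_residue.
Proof. by split=> // x y; rewrite /fps_residue fps_coefM big_ord1. Qed.
HB.instance Definition _ := GRing.isMonoidMorphism.Build fps k^o fps_residue fps_residueM.
Lemma fps_residueZ : scalable fps_residue.
Proof. by []. Qed.
HB.instance Definition _ := GRing.isScalable.Build k fps k^o *:%R fps_residue fps_residueZ.

Local Notation mfps := (fun x : fps => fps_residue x = 0).

Lemma fps_ideal_pow n x : ideal_pow mfps n x <-> fps_low n x.
Proof.
split=> [[s [a [c [cI ->]]]] i iN|xn]; last first.
  by rewrite (fps_shiftP xn); apply: ideal_pow_mul.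
rewrite fps_coef_sum big1 // => l _.
suff prod_low m (d : 'I_m -> fps) : (forall j, mfps (d j)) -> fps_low m (\prod_j d j).
  by have /= -> // := @fps_lowM 0 n (a l) (\prod_j c l j) _ (prod_low _ _ (cI l)) i iN.
elim: m d => [|m IH] d dI; first by [].
rewrite big_ord_recl; apply: (@fps_lowM 1 m); last exact: IH.
by case=> // _; exact: dI.
Qed.

Lemma fps_local (x : fps) : fps_residue x <> 0 -> exists y, x * y = 1.
Proof. by move=> /eqP; exact: fps_inv. Qed.

(** A nonzero ideal is generated by t^n, where n is the least order of its elements, since a series
    of order n is t^n times a unit. *)
Lemma fps_noetherian : noetherian fps.
Proof.
move=> I [I0 IP]; have IM a x : I x -> I (a * x).
  by move=> xI; rewrite -[a * x]addr0; apply: IP.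
case: (pselect (exists2 x, I x & x <> 0)) => [[x xI x0]|N]; last first.
  exists 0%N, (fun=> 0) => x; split=> [xI|[a ->]]; last by rewrite big_ord0.
  exists (fun=> 0); rewrite big_ord0; apply: contrapT => x0; apply: N.
  by exists x.
pose Q n := `[< exists2 y, I y & fps_coef y n != 0 >].
have exQ : exists n, Q n.
  apply: contrapT => N; apply: x0; apply: fpsP => n; apply/eqP/negPn/negP => xn.
  by apply: N; exists n; apply/asboolP; exists x.
case: (ex_minnP exQ) => n /asboolP[y yI yn] nmin.
have low z : I z -> fps_low n z.
  move=> zI i iN; apply/eqP/negPn/negP => zi; have := nmin i.
  by rewrite leqNgt iN => H; have /H : Q i by apply/asboolP; exists z.
have [u uE] : exists u, fps_shift n y * u = 1 by apply: fps_inv.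
exists 1%N, (fun=> fps_t ^+ n) => z; split=> [zI|[a ->]].
  by exists (fun=> fps_shift n z); rewrite big_ord1 -fps_shiftP //; apply: low.
rewrite big_ord1; apply: (IM); suff -> : fps_t ^+ n = u * y by apply: (IM).
by rewrite {1}(fps_shiftP (low y yI)) mulrA [u * _]mulrC uE mul1r.
Qed.

Lemma fps_complete : adic_complete mfps.
Proof.
split=> [x xP|u uP].
  by apply: fpsP => i; have /fps_ideal_pow := xP i.+1; apply.
(* From [u i.+1] on, consecutive differences have order greater than i, so coefficient i is final
   there. *)
exists (FPS (fun i => fps_coef (u i.+1) i)) => n; apply/fps_ideal_pow => i iN.
rewrite fps_coefB /=; apply/eqP; rewrite subr_eq0; apply/eqP.
rewrite -(subnK iN); elim: (n - i.+1)%N => // l ->; rewrite addSn.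
have /fps_ideal_pow/(_ i) := uP (l + i.+1)%N; rewrite fps_coefB => uE.
by apply/eqP; rewrite eq_sym -subr_eq0 uE // addnS ltnS leq_addl.
Qed.

Definition fps_Chat : Chat k :=
  @MkChat k fps fps_residue fps_local fps_noetherian fps_complete.

(** * Morphisms from k[[t]] to a complete local ring *)

Section Hom.
Variable S : Chat k.
Local Notation mS := (fun x : S => residue S x = 0).

Lemma Chat_separated (x y : S) : (forall n, ideal_pow mS n (x - y)) -> x = y.
Proof.
have [sep _] := chat_complete S.
by move=> xy; apply/eqP; rewrite -subr_eq0; apply/eqP/sep.
Qed.

Lemma fps_decomp (x : fps) :
  x = fps_coef x 0 *: 1 + fps_t * fps_shift 1 x.
Proof.
rewrite [_ * _]mulrC -[X in _ * X]expr1.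
have -> : fps_shift 1 x = fps_shift 1 (x - fps_coef x 0 *: 1).
  apply: fpsP => i; rewrite -[RHS]/(fps_coef (x - fps_coef x 0 *: 1) (i + 1)).
  by rewrite addn1 fps_coefB fps_coefZ fps_coef1 mulr0 subr0 -(addn1 i).
rewrite -fps_shiftP ?subrKC //; last first.
by case=> // _; rewrite fps_coefB fps_coefZ fps_coef1 mulr1 subrr.
Qed.

(** No continuity is assumed: splitting off the constant coefficient n times makes f x - g x a
    multiple of f(t)^n, and the intersection of the powers of the maximal ideal of S is zero. *)
Lemma Chat_hom_ext (f g : Chat_hom fps_Chat S) :
  sval f fps_t = sval g fps_t -> sval f =1 sval g.
Proof.
have split_t (h : {lrmorphism fps -> S}) y :
    h y = fps_coef y 0 *: 1 + h fps_t * h (fps_shift 1 y).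
  by rewrite {1}[y]fps_decomp linearD linearZ rmorphM /= rmorph1.
case: f g => [f fP] [g gP] /= fg x; apply: Chat_separated => n.
have [y ->] : exists y, f x - g x = (f y - g y) * f fps_t ^+ n.
  elim: n => [|n [y ->]]; first by exists x; rewrite mulr1.
  exists (fps_shift 1 y); rewrite (split_t f) (split_t g) -fg.
  rewrite opprD addrACA subrr add0r -mulrBr exprS.
  by rewrite mulrA [f fps_t * _]mulrC.
by apply: ideal_pow_mul; rewrite fP.
Qed.

(** The value at a series is the limit of its truncations evaluated at [s]. By separatedness [lcong]
    characterizes this limit, so each morphism law reduces to one for polynomials modulo a power of
    the maximal ideal. *)
Lemma Chat_hom_exists (s : S) : residue S s = 0 ->
  exists f : Chat_hom fps_Chat S, sval f fps_t = s.
Proof.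
move=> s0; pose tr n (x : fps) : {poly k} := \poly_(i < n) fps_coef x i.
pose ev (p : {poly k}) : S := horner_alg s p.
have evB p q : ev (p - q) = ev p - ev q by rewrite /ev rmorphB.
have evM p q : ev (p * q) = ev p * ev q by rewrite /ev rmorphM.
have evZ c p : ev (c *: p) = c *: ev p by rewrite /ev linearZ /= mulr_algl.
have evlow n (p : {poly k}) : (forall i, (i < n)%N -> p`_i = 0) -> ideal_pow mS n (ev p).
  move=> p0; rewrite -[p](poly_take_drop n) [take_poly _ _](_ : _ = 0); last first.
    by apply/polyP => i; rewrite coef_take_poly coef0; case: ifP => // /p0.
  rewrite add0r evM [ev 'X^n]rmorphXn /= horner_algX.
  exact: ideal_pow_mul.
have [sep lim] := chat_complete S.
have [l lE] : exists l : fps -> S, forall x n, ideal_pow mS n (l x - ev (tr n x)).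
  have [|l lE] := choice (P := fun x l => forall n, ideal_pow mS n (l - ev (tr n x))).
    move=> x; apply: lim => n; rewrite -evB; apply: evlow => i iN.
    by rewrite coefB !coef_poly iN (ltn_trans iN (ltnSn n)) subrr.
  by exists l.
have lcong x z : (forall n, ideal_pow mS n (z - ev (tr n x))) -> l x = z.
  move=> zx; apply: Chat_separated => n.
  by have := ideal_powD (lE x n) (ideal_powN (zx n)); rewrite opprB addrA subrK.
have lB : zmod_morphism l.
  move=> x y; apply: lcong => n.
  have -> : tr n (x - y) = tr n x - tr n y.
    by apply/polyP => i; rewrite coefB !coef_poly; case: ifP; rewrite ?subr0.
  have := ideal_powD (lE x n) (ideal_powN (lE y n)).
  by rewrite evB [X in _ -> ideal_pow _ _ (_ + X)]opprD addrACA -opprD.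
have lM : monoid_morphism l.
  split=> [|x y]; apply: lcong => n.
    rewrite -[X in X - _](rmorph1 (horner_alg s)) -evB; apply: evlow => i iN.
    by rewrite coefB coef1 coef_poly iN fps_coef1 subrr.
  have -> : l x * l y - ev (tr n (x * y)) =
      l y * (l x - ev (tr n x)) + ev (tr n x) * (l y - ev (tr n y))
      + ev (tr n x * tr n y - tr n (x * y)).
    rewrite evB evM !mulrBr (mulrC (l y) (l x)) (mulrC (l y) (ev _)).
    by rewrite !subrKA.
  apply: ideal_powD; first by apply: ideal_powD; apply: ideal_powMl.
  apply: evlow => i; case: n => // n iN.
  by rewrite coefB coef_poly iN -fps_mul_trunc // subrr.
have lZ : scalable l.
  move=> c x; apply: lcong => n.
  have -> : tr n (c *: x) = c *: tr n x.
    by apply/polyP => i; rewrite coefZ !coef_poly; case: ifP; rewrite ?mulr0.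
  by rewrite evZ -scalerBr -mulr_algl; apply: ideal_powMl.
pose f := HB.pack_for {lrmorphism fps -> S} l
  (GRing.isZmodMorphism.Build _ _ l lB) (GRing.isMonoidMorphism.Build _ _ l lM)
  (GRing.isScalable.Build _ _ _ _ l lZ).
have fres x : residue S (f x) = fps_residue x.
  (* Modulo the first power of the maximal ideal, l x is the constant coefficient of x. *)
  have [r [a [c [cI]]]] := lE x 1%N.
  have -> : tr 1 x = (fps_coef x 0)%:P.
    by apply/polyP => i; rewrite coefC coef_poly; case: i.
  rewrite /ev horner_algC => /(congr1 (residue S)).
  rewrite linearB linearZ rmorph1 raddf_sum /= big1 => [/eqP|i _].
    by rewrite subr_eq0 => /eqP ->; rewrite [LHS]mulr1.
  by rewrite rmorphM big_ord1 /= cI mulr0.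
exists (exist _ f fres); apply: lcong => n.
rewrite -[X in X - _](horner_algX s) -evB; apply: evlow => i iN.
by rewrite coefB coefX coef_poly iN subrr.
Qed.

End Hom.
End PowerSeriesRing.

(** * Lifts *)

Section Semilinear.
Variables (k : fieldType) (R S : comAlgType k) (f : {lrmorphism R -> S}).
Variables (M : lmodType R) (N : lmodType S) (g : M -> N).
Hypothesis gf : Defs.semilinear f g.

Lemma semilinearD x y : g (x + y) = g x + g y.
Proof. by have := gf 1 x y; rewrite rmorph1 !scale1r. Qed.

Lemma semilinear0 : g 0 = 0.
Proof. by apply: (addrI (g 0)); rewrite -semilinearD !addr0. Qed.

Lemma semilinearZ r x : g (r *: x) = f r *: g x.
Proof. by have := gf r x 0; rewrite semilinear0 !addr0. Qed.

Lemma semilinear_sum (I : finType) (F : I -> M) : g (\sum_i F i) = \sum_i g (F i).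
Proof. exact: (big_morph g semilinearD semilinear0). Qed.

Lemma semilinear_row n (T : {linear 'rV[R]_n -> M}) u :
  g (T u) = \sum_j f (u 0 j) *: g (T (delta_mx 0 j)).
Proof.
rewrite {1}[u]row_sum_delta linear_sum semilinear_sum; apply: eq_bigr => j _.
by rewrite linearZ semilinearZ.
Qed.

End Semilinear.

Section BaseChange.
Variables (k : fieldType) (A : algType k).

Lemma free_base_change (R S : comAlgType k) (f : {lrmorphism R -> S})
    (M : tensor_module A R) (N : tensor_module A S) (n : nat)
    (T : {linear 'rV[R]_n -> M}) (U : {linear 'rV[S]_n -> N}) (b : M -> N) :
  bijective T -> bijective U -> (forall u, b (T u) = U (map_mx f u)) ->
  (forall a x, b (act M a x) = act N a (b x)) -> is_base_change f b.
Proof.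
move=> [Ti TiK TK] [Ui UiK UK] bT bact.
have bf : Defs.semilinear f b.
  move=> r x y; rewrite -[x]TK -[y]TK -linearP !bT -linearP; congr (U _).
  by apply/rowP => j; rewrite !mxE rmorphD rmorphM.
have UiP r x y : Ui (r *: x + y) = r *: Ui x + Ui y.
  by apply: (can_inj UiK); rewrite linearP !UK.
split=> // Q g gf.
pose h y := \sum_j (Ui y) 0 j *: g (T (delta_mx 0 j)).
have [|H HE] := @linear_of S N Q h.
  move=> a x y; rewrite /h UiP scaler_sumr -big_split; apply: eq_bigr => j _.
  by rewrite !mxE scalerDl scalerA.
exists H; split=> [x|h' h'E y].
  rewrite HE /h -{2}[x]TK (semilinear_row gf) -{1}[x]TK bT UiK.
  by apply: eq_bigr => j _; rewrite mxE.
rewrite HE /h -{1}[y]UK {1}[Ui y]row_sum_delta !linear_sum; apply: eq_bigr => j _.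
rewrite !linearZ /=; congr (_ *: _); rewrite -h'E bT; congr (h' (U _)).
by apply/rowP => l; rewrite !mxE rmorph_nat.
Qed.

(** [U] lifts coordinates to constants before applying T and b. The universal property, applied to
    the reduced coordinates of M, provides [h] with h U = id; its uniqueness clause, applied to b,
    gives U h = id. *)
Lemma base_change_free (R : Chat k) (M : tensor_module A R) (N : tensor_module A k^o)
    (n : nat) (T : {linear 'rV[R]_n -> M}) (b : M -> N) :
  bijective T -> is_base_change (residue R) b ->
  exists U : {linear 'rV[k^o]_n -> N},
    bijective U /\ forall u, b (T u) = U (map_mx (residue R) u).
Proof.
move=> [Ti TiK TK] [bf _ buniv]; pose lift_row (c : 'rV[k^o]_n) : 'rV[R]_n :=
  map_mx (fun x : k => x%:A) c.
have resA (c : k) : residue R c%:A = c by rewrite linearZ rmorph1 [LHS]mulr1.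
have res_lift c : map_mx (residue R) (lift_row c) = c.
  by apply/rowP => j; rewrite !mxE resA.
have bTE u : b (T u) = \sum_j residue R (u 0 j) *: b (T (delta_mx 0 j)).
  exact: semilinear_row.
have [|U UE] := @linear_of k^o 'rV[k^o]_n N (fun c => b (T (lift_row c))).
  move=> a c d; rewrite !bTE scaler_sumr -big_split; apply: eq_bigr => j _.
  by rewrite !mxE !resA scalerDl scalerA.
have UbT u : b (T u) = U (map_mx (residue R) u).
  by rewrite UE !bTE; apply: eq_bigr => j _; rewrite !mxE resA.
have [|h [hE _]] := buniv 'rV[k^o]_n (fun x => map_mx (residue R) (Ti x)).
  move=> r x y; apply/rowP => j; rewrite !mxE.
  have -> : Ti (r *: x + y) = r *: Ti x + Ti y.
    by apply: (can_inj TiK); rewrite linearP !TK.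
  by rewrite !mxE rmorphD rmorphM.
exists U; split=> //; exists h => [c|y].
  by rewrite -{1}[c]res_lift -UbT hE TiK res_lift.
have [h' [_ h'uniq]] := buniv N b bf.
have [|Uh UhE] := @linear_of k^o N N (fun y => U (h y)).
  by move=> a x z; rewrite !linearP.
have e1 := h'uniq Uh _ y; have e2 := h'uniq idfun _ y.
rewrite -UhE e1 => [|x]; last by rewrite UhE hE -UbT TK.
by rewrite -e2.
Qed.

Lemma residue_mx_invertible (S : Chat k) (n : nat) (M : 'M[S]_n) :
  map_mx (residue S) M = 1%:M -> exists M', M *m M' = 1%:M /\ M' *m M = 1%:M.
Proof.
move=> M1; have [y yE] : exists y, \det M * y = 1.
  apply: chat_local; rewrite -det_map_mx M1 det1; apply/eqP; exact: oner_neq0.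
exists (y *: \adj M); rewrite -scalemxAr -scalemxAl mul_mx_adj mul_adj_mx.
by rewrite scale_scalar_mx mulrC yE.
Qed.

End BaseChange.

(** * Lifts of B(1, mu) and their parameter *)

Section BandLifts.
Variables (k : fieldType) (e : nat) (A : algType k).
Variables (idem : vertex e -> A) (arr : arrow e -> A).
Hypothesis sA : star_algebra idem arr.
Local Notation E := e.-1.+1.
Local Notation walk := (walk_elt idem arr).
Local Notation wlk := (walk ord_max).
Local Notation band_gen := (band_gen idem arr).

Section BandRepresentation.
Variables (S : comAlgType k) (nu : S).

(** B(1, nu) over any coefficient ring: a chain of E + 1 rows where delta acts on the first row as
    nu C. *)
Definition band_loop_row (r : nat) : 'rV[S]_E.+1 :=
  if r == 0%N then nu *: unit_row S E.+1 E else 0.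

Lemma band_is_rep :
  is_rep (@chain_idem k e S E.+1 0) (chain_arrow 0 band_loop_row).
Proof.
apply: chain_is_rep => //.
- by rewrite add0n ltnS; lia.
- by case.
- move=> r; rewrite /band_loop_row; case: eqP => _; last by rewrite mul0mx.
  by rewrite -scalemxAl unit_row_idem subn0 vtE eqxx.
- move=> r; rewrite /band_loop_row; case: eqP => _; last by rewrite mul0mx.
  by rewrite -scalemxAl unit_row_arrow unit_row_big // if_same scaler0.
case=> // _; rewrite /band_loop_row /= -scalemxAl unit_row_loop // scaler0.
by rewrite unit_row_big //; lia.
Qed.

Definition band_rep : A -> 'M[S]_E.+1 := projT1 (cid (sa_rep sA band_is_rep)).

Lemma band_repP : rep_morph band_rep.
Proof. by rewrite /band_rep; case: cid => rho []. Qed.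

Local Notation b := (unit_row S E.+1).

Lemma band_rep_idem j i :
  b j *m band_rep (idem i) = if i == vt e j then b j else 0.
Proof.
rewrite /band_rep; case: cid => rho [_ rhoi _] /=.
by rewrite rhoi unit_row_idem subn0.
Qed.

Lemma band_rep_alpha j i :
  b j *m band_rep (arr (Some i)) = if i == vt e j then b j.+1 else 0.
Proof.
rewrite /band_rep; case: cid => rho [_ _ rhoa] /=.
by rewrite rhoa unit_row_arrow subn0.
Qed.

Lemma band_rep_delta j : (j <= E)%N ->
  b j *m band_rep (arr None) = if j == 0%N then nu *: b E else 0.
Proof.
rewrite /band_rep; case: cid => rho [_ _ rhoa] /= jE.
by rewrite rhoa unit_row_loop.
Qed.

Lemma row_unit_sum (u : 'rV[S]_E.+1) : u = \sum_(j < E.+1) u 0 j *: b j.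
Proof. by rewrite {1}[u]row_sum_delta; apply: eq_bigr => j _; rewrite unit_rowE. Qed.

Lemma band_rep_walk j i n :
  b j *m band_rep (walk i n) = if i == vt e j then b (j + n) else 0.
Proof.
elim: n => [|n IH] /=; first by rewrite band_rep_idem addn0.
rewrite (rhoM band_repP) mulmxA IH; case: eqP => [->|]; last by rewrite mul0mx.
have jn : vt e (j + n) = iter n (@ordS _) (vt e j) by rewrite addnC vtD.
by rewrite band_rep_alpha jn eqxx addnS.
Qed.

Lemma row_wlk_E u : u *m band_rep (wlk E) = u 0 0 *: b E.
Proof.
rewrite {1}[u]row_unit_sum mulmx_suml big_ord_recl big1 => [|j _].
  by rewrite -scalemxAl band_rep_walk eqxx addr0.
rewrite -scalemxAl band_rep_walk unit_row_big ?if_same ?scaler0 //.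
by rewrite lift0 addSn ltnS leq_addl.
Qed.

Lemma row_delta u : u *m band_rep (arr None) = (u 0 0 * nu) *: b E.
Proof.
rewrite {1}[u]row_unit_sum mulmx_suml big_ord_recl big1 => [|j _].
  by rewrite -scalemxAl band_rep_delta //= scalerA addr0.
by rewrite -scalemxAl band_rep_delta ?lift0 ?scaler0 //; have := ltn_ord j; lia.
Qed.

Definition band_tmod : tensor_module A S := row_tmod band_repP.

(** One criterion for reduction to V, for base change between lifts, and for isomorphisms onto an
    arbitrary lift. [n] lists the images of the basis rows and must vanish at E + 1, where the chain
    ends. *)
Lemma band_semilinear_act (S' : comAlgType k) (f : {lrmorphism S -> S'})
    (N : tensor_module A S') (g : band_tmod -> N) (n : nat -> N) :
  Defs.semilinear f g -> (forall j, (j <= E)%N -> g (b j) = n j) -> n E.+1 = 0 ->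
  (forall i j, (j <= E)%N -> act N (idem i) (n j) = if i == vt e j then n j else 0) ->
  (forall i j, (j <= E)%N ->
     act N (arr (Some i)) (n j) = if i == vt e j then n j.+1 else 0) ->
  (forall j, (j <= E)%N ->
     act N (arr None) (n j) = if j == 0%N then f nu *: n E else 0) ->
  forall a u, g (act band_tmod a u) = act N a (g u).
Proof.
move=> gf gb nE n_idem n_alpha n_delta.
have gb' j : (j <= E.+1)%N -> g (b j) = n j.
  rewrite leq_eqVlt => /orP[/eqP ->|]; last exact: gb.
  by rewrite unit_row_big // nE; exact: semilinear0 gf.
have g0 : g 0 = 0 by exact: semilinear0 gf.
have basis a : (forall j, (j <= E)%N -> g (act band_tmod a (b j)) = act N a (n j)) ->
    forall u, g (act band_tmod a u) = act N a (g u).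
  move=> ab u; rewrite {1 2}[u]row_unit_sum linear_sum !(semilinear_sum gf) linear_sum.
  apply: eq_bigr => j _; rewrite linearZ !(semilinearZ gf) linearZ ab ?gb //; exact: leq_ord.
elim/(sa_ind sA) => [a a' IH IH' u|c a IH u|i|a a' IH u].
- by rewrite !actD (semilinearD gf) IH IH'.
- by rewrite !actZ (semilinearZ gf) IH linearZ rmorph1.
- apply: basis => j jE; rewrite n_idem // -gb // -[act _ _ _]/(_ *m band_rep _).
  by rewrite band_rep_idem; case: eqP.
rewrite !actM -IH; move: (act band_tmod a' u) => {IH a'}u.
case: a => [i|]; apply: basis => j jE; rewrite -[act band_tmod _ _]/(_ *m band_rep _).
  by rewrite n_alpha // band_rep_alpha; case: eqP => // _; rewrite gb'.
rewrite n_delta // band_rep_delta //; case: eqP => // _.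
by rewrite (semilinearZ gf) gb.
Qed.

End BandRepresentation.

Section Universal.
Variables (mu : k) (V : lmodType A) (v : V).
Hypotheses (mu0 : mu != 0) (mu2 : 1 + mu * mu != 0) (vP : band_gen mu v).

Lemma band_basis : exists U : {linear 'rV[k^o]_E.+1 -> restr V}, bijective U /\
  forall u, U u = \sum_(j < E.+1) ((u 0 j)%:A : A) *: (wlk j *: v).
Proof.
pose B (u : 'rV[k^o]_E.+1) : V := \sum_(j < E.+1) ((u 0 j)%:A : A) *: (wlk j *: v).
have [|U UE] := @linear_of k^o 'rV[k^o]_E.+1 (restr V) B.
  move=> a u w; rewrite -[a *: (B u : restr V)]/((a%:A : A) *: B u) scaler_sumr -big_split.
  by apply: eq_bigr => j _; rewrite scalarM !mxE scalerDl scalerDl.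
exists U; split=> //.
have U_surj (y : V) : exists u, U u = y.
  have [c ->] := bg_surj sA mu0 vP y; exists (\row_j c j).
  by rewrite UE; apply: eq_bigr => j _; rewrite mxE.
have [s sK] := choice U_surj; exists s => // u.
have : U (s (U u) - u) = 0 by rewrite linearB sK subrr.
rewrite UE; set w := _ - u => w0; apply/eqP; rewrite -subr_eq0; apply/eqP.
apply/rowP => j; rewrite [RHS]mxE.
have wj : w 0 (inord j) = 0.
  apply: (bg_inj sA mu0 vP (c := fun i => w 0 (inord i)) _ (leq_ord j)).
  by rewrite -[RHS]w0; apply: eq_bigr => i _; rewrite inord_val.
by move: wj; rewrite inord_val.
Qed.

Let UV := projT1 (cid band_basis).
Lemma band_basis_bij : bijective UV.
Proof. by rewrite /UV; case: cid => U []. Qed.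
Lemma band_basisE u : UV u = \sum_(j < E.+1) ((u 0 j)%:A : A) *: (wlk j *: v).
Proof. by rewrite /UV; case: cid => U []. Qed.

Lemma band_basis_unit j : (j <= E)%N -> UV (unit_row k^o E.+1 j) = wlk j *: v.
Proof.
move=> jE; rewrite band_basisE (bigD1 (Ordinal (jE : j < E.+1)%N)) //= big1 => [|i ij].
  by rewrite mxE eqxx addr0 scale1r scale1r.
by rewrite mxE [(_ == _ :> nat)](negPf ij) !scale0r.
Qed.

Section OneLift.
Variables (S : Chat k) (s : S).
Hypothesis s0 : residue S s = 0.

Let nu : S := mu%:A + s.

Lemma residue_nu : residue S nu = mu.
Proof. by rewrite /nu linearD linearZ rmorph1 /= s0 addr0 [LHS]mulr1. Qed.

Definition band_red (u : band_tmod nu) : V := UV (map_mx (residue S) u).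

Lemma band_red_semilinear :
  Defs.semilinear (residue S) (band_red : _ -> restr V).
Proof.
move=> r x y; rewrite /band_red -linearP; congr (UV _).
by apply/rowP => j; rewrite !mxE rmorphD rmorphM.
Qed.

Lemma band_red_unit j : (j <= E)%N -> band_red (unit_row S E.+1 j) = wlk j *: v.
Proof.
move=> jE; rewrite -band_basis_unit // /band_red; congr (UV _).
by apply/rowP => i; rewrite !mxE rmorph_nat.
Qed.

Lemma band_redP : is_base_change (N := restr_tmod V) (residue S) band_red.
Proof.
have act_red := @band_semilinear_act S nu k^o (residue S) (restr_tmod V) band_red
  (fun j => wlk j *: v) band_red_semilinear band_red_unit.
pose T : {linear 'rV[S]_E.+1 -> band_tmod nu} := idfun.
apply: (@free_base_change k A S k^o (residue S) (band_tmod nu) (restr_tmod V) E.+1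
  T UV band_red) => //.
- by exists idfun.
- exact: band_basis_bij.
apply: act_red => [|i j _|i j _|j _].
- by rewrite (bg_walk sA mu0 vP).
- rewrite -[LHS]/(idem i *: (wlk j *: v)) scalerA (idem_walk sA).
  by case: eqP => // _; rewrite scale0r.
- rewrite -[LHS]/(arr (Some i) *: (wlk j *: v)) scalerA (arr_walk sA).
  by case: eqP => // _; rewrite scale0r.
rewrite -[LHS]/(arr None *: (wlk j *: v)); case: j => [|j].
  by rewrite (bg_idem vP) (bg_delta vP) residue_nu.
by rewrite scalerA (delta_walk sA) scale0r.
Qed.

Lemma band_free : exists (d : nat) (f : {linear 'rV[S]_d -> band_tmod nu}), bijective f.
Proof. by exists E.+1, idfun; exists idfun. Qed.

Definition band_lift : Defs.lift V S := Lift band_free band_redP.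

End OneLift.

Lemma residue_unit (S : Chat k) (x : S) : residue S x <> 0 -> forall y, x * y = 0 -> y = 0.
Proof.
by move=> /chat_local[z xz] y xy; rewrite -[y]mul1r -xz mulrAC xy mul0r.
Qed.

(** Let u0 be the first coordinate of F(b 0). Applying C gives F(b E) = u0 b E, and applying delta
    then gives (mu + s) u0 = u0 (mu + s'). Since F reduces to the identity of V, u0 is a unit. *)
Lemma band_lift_param (S : Chat k) (s s' : S) (hs : residue S s = 0)
    (hs' : residue S s' = 0) :
  lift_iso (band_lift hs) (band_lift hs') -> s = s'.
Proof.
move=> [F [_ F_act F_red]]; pose b := unit_row S E.+1.
pose u : 'rV[S]_E.+1 := F (b 0%N).
have Fb : F (b E) = u 0 0 *: b E.
  rewrite -(row_wlk_E (mu%:A + s')).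
  rewrite -[RHS]/(act (band_lift hs') (wlk E) (F (b 0%N))) -F_act; congr (F _).
  by rewrite -[RHS]/(_ *m band_rep _ _) band_rep_walk eqxx.
have key : (mu%:A + s) *: (u 0 0 *: b E) = (u 0 0 * (mu%:A + s')) *: b E.
  rewrite -row_delta -[RHS]/(act (band_lift hs') (arr None) (F (b 0%N))) -F_act -Fb.
  rewrite -[LHS]linearZ; congr (F _); rewrite -[RHS]/(_ *m band_rep _ _).
  by rewrite band_rep_delta.
have u0 : residue S (u 0 0) <> 0.
  have : UV (map_mx (residue S) u) = UV (unit_row k^o E.+1 0).
    rewrite -[LHS]/(band_red (u : band_tmod (mu%:A + s'))).
    have := F_red (b 0%N); rewrite -[LHS]/(band_red (u : band_tmod (mu%:A + s'))) => ->.
    rewrite band_basis_unit // -[LHS]/(band_red (b 0%N : band_tmod (mu%:A + s))).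
    by rewrite band_red_unit.
  move/(bij_inj band_basis_bij)/rowP/(_ 0); rewrite !mxE eqxx => ->.
  by apply/eqP; exact: oner_neq0.
move/rowP/(_ ord_max): key; rewrite !mxE eqxx !mulr1 mulrC => /eqP.
rewrite -subr_eq0 -mulrBr => /eqP/(residue_unit u0)/eqP.
by rewrite opprD addrACA subrr add0r subr_eq0 => /eqP.
Qed.

Lemma band_lift_push (S S' : Chat k) (g : Chat_hom S S') (s : S) (s' : S')
    (hs : residue S s = 0) (hs' : residue S' s' = 0) :
  sval g s = s' -> lift_pushforward g (band_lift hs) (band_lift hs').
Proof.
move=> gs; case: g gs => g gP /= gs; exists (map_mx g); split; last first.
  move=> x; congr (UV _); apply/rowP => j; rewrite !mxE; exact: gP.
have g_semi : Defs.semilinear g (map_mx g : band_tmod (mu%:A + s) -> band_tmod (mu%:A + s')).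
  by move=> r x y; apply/rowP => j; rewrite !mxE rmorphD rmorphM.
pose T : {linear 'rV[S]_E.+1 -> band_tmod (mu%:A + s)} := idfun.
pose U : {linear 'rV[S']_E.+1 -> band_tmod (mu%:A + s')} := idfun.
apply: (@free_base_change k A S S' g _ _ E.+1 T U) => //; try by exists idfun.
apply: (@band_semilinear_act S _ S' g (band_tmod (mu%:A + s')) _
  (unit_row S' E.+1) g_semi) => [j _||i j _|i j _|j jE].
- by apply/rowP => i; rewrite !mxE rmorph_nat.
- by rewrite unit_row_big.
- by rewrite -[LHS]/(_ *m band_rep _ _) band_rep_idem.
- by rewrite -[LHS]/(_ *m band_rep _ _) band_rep_alpha.
rewrite -[LHS]/(_ *m band_rep _ _) band_rep_delta //.
by rewrite rmorphD /= gs linearZ rmorph1.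
Qed.

Local Notation lred L := (@lift_red k A V _ L).

Section AnyLift.
Variables (S : Chat k) (L : Defs.lift V S).

Lemma lift_generator : exists m0 : L, act L (idem ord_max) m0 = m0 /\ lred L m0 = v.
Proof.
have [d [T Tb]] := lift_free L.
have [U [[Ui UiK UK] UE]] := base_change_free Tb (lift_redP L).
have [_ red_act _] := lift_redP L.
pose m : L := T (map_mx (fun x : k => x%:A) (Ui v)).
have mv : lred L m = v.
  rewrite UE -[RHS]UK; congr (U _); apply/rowP => j; rewrite !mxE.
  by rewrite linearZ rmorph1 [LHS]mulr1.
exists (act L (idem ord_max) m); split.
  by rewrite -actM (sa_idemM sA) eqxx.
by rewrite red_act mv; exact: (bg_idem vP).
Qed.

Variable m0 : L.
Hypotheses (m0_idem : act L (idem ord_max) m0 = m0) (m0_red : lred L m0 = v).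

Let m (j : nat) : L := act L (wlk j) m0.

Lemma lift_red_semilinear : Defs.semilinear (residue S) (lred L : _ -> restr V).
Proof. by have [] := lift_redP L. Qed.

Lemma lift_red_walk j : lred L (m j) = wlk j *: v.
Proof. by have [_ red_act _] := lift_redP L; rewrite red_act m0_red. Qed.

Lemma act_wlk a j : act L a (m j) = act L (a * wlk j) m0.
Proof. by rewrite actM. Qed.

Lemma act_idem_wlk i j : act L (idem i) (m j) = if i == vt e j then m j else 0.
Proof.
rewrite act_wlk (idem_walk sA) -/(vt e j); case: eqP => // _.
by rewrite -(scale0r 0) actZ !scale0r.
Qed.

Lemma act_scale a r x : act L a (r *: x) = r *: act L a x.
Proof. by rewrite linearZ. Qed.

Lemma act_add a x y : act L a (x + y) = act L a x + act L a y.
Proof. by rewrite linearD. Qed.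

Lemma act0 x : act L 0 x = 0.
Proof. by rewrite -(scale0r 0) actZ !scale0r. Qed.

(** Nakayama's lemma in matrix form. The rank [d] of the lift is not known to be E + 1, so the
    matrix of F is rectangular and is inverted on both sides. *)
Lemma lift_basis : exists F : {linear 'rV[S]_E.+1 -> L},
  [/\ bijective F, forall u, F u = \sum_(j < E.+1) u 0 j *: m j,
      forall j, (j <= E)%N -> F (unit_row S E.+1 j) = m j
    & forall u, lred L (F u) = UV (map_mx (residue S) u)].
Proof.
have [|F FE] := @linear_of S 'rV[S]_E.+1 L (fun u => \sum_(j < E.+1) u 0 j *: m j).
  move=> a u w; rewrite scaler_sumr -big_split; apply: eq_bigr => j _.
  by rewrite !mxE scalerDl scalerA.
have F_red u : lred L (F u) = UV (map_mx (residue S) u).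
  rewrite FE band_basisE (semilinear_sum lift_red_semilinear); apply: eq_bigr => j _.
  by rewrite (semilinearZ lift_red_semilinear) lift_red_walk mxE.
have Fm j : (j <= E)%N -> F (unit_row S E.+1 j) = m j.
  move=> jE; rewrite FE (bigD1 (Ordinal (jE : j < E.+1)%N)) //= big1 => [|i ij].
    by rewrite mxE eqxx addr0 scale1r.
  by rewrite mxE [(_ == _ :> nat)](negPf ij) scale0r.
exists F; split=> //.
have [d [T Tb]] := lift_free L.
have [U [[Ui UiK UK] UE]] := base_change_free Tb (lift_redP L).
have [Ti TiK TK] := Tb.
have [UVi UViK UVK] := band_basis_bij.
pose M : 'M[S]_(E.+1, d) := \matrix_j Ti (m j).
have FT u : F u = T (u *m M).
  rewrite mulmx_sum_row linear_sum FE; apply: eq_bigr => j _.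
  by rewrite linearZ rowK TK.
pose Mk := map_mx (residue S) M.
have lift_k n (c : 'rV[k^o]_n) : exists c' : 'rV[S]_n, map_mx (residue S) c' = c.
  exists (map_mx (fun x : k => x%:A) c); apply/rowP => j; rewrite !mxE.
  by rewrite linearZ rmorph1 [LHS]mulr1.
have UMk c : U (c *m Mk) = UV c.
  by have [u <-] := lift_k _ c; rewrite -F_red FT UE map_mxM.
pose Nk : 'M[k^o]_(d, E.+1) := \matrix_i UVi (U (delta_mx 0 i)).
have NM : Nk *m Mk = 1%:M.
  apply/row_matrixP => i; rewrite row_mul rowK row1; apply: (can_inj UiK).
  by rewrite UMk UVK.
have MN : Mk *m Nk = 1%:M.
  apply/row_matrixP => j; rewrite row_mul row1; apply: (can_inj UViK).
  rewrite -!UMk -mulmxA NM mulmx1; congr (U _).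
  by rewrite -rowE.
(* A constant lift of the inverse of M modulo the maximal ideal: M N and N M reduce to identity
   matrices, hence are invertible. *)
pose N : 'M[S]_(d, E.+1) := map_mx (fun x : k => x%:A) Nk.
have resN : map_mx (residue S) N = Nk.
  by apply/matrixP => i j; rewrite !mxE linearZ rmorph1 [LHS]mulr1.
have [Q [MNQ QMN]] : exists Q, (M *m N) *m Q = 1%:M /\ Q *m (M *m N) = 1%:M.
  by apply: residue_mx_invertible; rewrite map_mxM resN.
have [Q' [NMQ QNM]] : exists Q, (N *m M) *m Q = 1%:M /\ Q *m (N *m M) = 1%:M.
  by apply: residue_mx_invertible; rewrite map_mxM resN.
exists (fun x => Ti x *m (Q' *m N)) => [u|x].
  rewrite FT TiK -mulmxA; have -> : M *m (Q' *m N) = 1%:M; last by rewrite mulmx1.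
  rewrite -[LHS]mulmx1 -MNQ !mulmxA -(mulmxA _ N M) -(mulmxA M Q') .
  by rewrite QNM mulmx1.
by rewrite FT -!mulmxA QNM mulmx1 TK.
Qed.

Lemma lift_delta : exists b : S, residue S b = mu /\
  act L (arr None) m0 = b *: m E.
Proof.
have [F [F_bij FE Fm F_red]] := lift_basis; have [Fi FiK FK] := F_bij.
pose c := Fi (act L (arr None) m0).
have cE : act L (arr None) m0 = \sum_(j < E.+1) c 0 j *: m j by rewrite -FE FK.
(* Delta m0 is fixed by e_e, so only the walks ending at e, of lengths 0 and E, can occur in it. *)
have c_eq0 (j : 'I_E.+1) : vt e j <> ord_max -> c 0 j = 0.
  move=> vj; have : act L (idem ord_max) (act L (arr None) m0) = act L (arr None) m0.
    by rewrite -actM (sa_idem_arr sA) eqxx.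
  rewrite {1}cE linear_sum.
  have -> : \sum_(i < E.+1) act L (idem ord_max) (c 0 i *: m i) =
      F (\row_i if ord_max == vt e i then c 0 i else 0).
    rewrite FE; apply: eq_bigr => i _; rewrite act_scale mxE act_idem_wlk.
    by case: eqP => _; rewrite ?scaler0 ?scale0r.
  move/(congr1 Fi); rewrite FiK -/c => /rowP/(_ j); rewrite mxE.
  by case: eqP => // /esym.
pose a := c 0 ord0; pose b := c 0 ord_max.
have mE : act L (arr None) m0 = a *: m0 + b *: m E.
  rewrite cE big_ord_recl big_ord_recr big1 => [|j _]; last first.
    have jE := ltn_ord j; rewrite c_eq0 ?scale0r // => vj.
    by case: (vt_eq0 _ vj); rewrite lift0 /=; lia.
  have -> : lift ord0 ord_max = ord_max :> 'I_E.+1 by apply: val_inj.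
  by rewrite [X in _ + X]add0r [m ord0]m0_idem.
have red_c : map_mx (residue S) c = mu *: (unit_row k^o E.+1 E).
  apply: (bij_inj band_basis_bij); rewrite -F_red FK linearZ band_basis_unit //.
  have [_ red_act _] := lift_redP L; rewrite red_act m0_red.
  exact: (bg_delta vP).
have res_b : residue S b = mu.
  by move/rowP/(_ ord_max): red_c; rewrite !mxE eqxx mulr1.
have dmE : act L (arr None) (m E) = 0 by rewrite act_wlk (delta_walk sA) act0.
(* C m_E is C^2 m0 = delta^2 m0, expanded with delta m_E = 0. *)
have wmE : act L (wlk E) (m E) = (a * a) *: m0 + (a * b) *: m E.
  rewrite act_wlk -(wlk_2E sA) -(delta_sq sA) actM mE act_add !act_scale.
  by rewrite dmE scaler0 addr0 mE scalerDr !scalerA.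
(* C delta m0 = 0, and C^2 m0 = delta^2 m0. *)
have ab : a *: m E + b *: ((a * a) *: m0 + (a * b) *: m E) = 0.
  have := act0 m0; rewrite -(walk_delta sA ord_max e.-1) actM mE act_add !act_scale.
  by rewrite wmE.
have a0 : a = 0.
  (* The coefficient of m_E in [ab] is (1 + b^2) a, and 1 + b^2 is a unit because its residue is 1 +
     mu^2. *)
  have : F ((b * (a * a)) *: unit_row S E.+1 0 + (a + b * (a * b)) *: unit_row S E.+1 E) = F 0.
    have FP r r' x y : F (r *: x + r' *: y) = r *: F x + r' *: F y.
      by rewrite linearD !linearZ.
    rewrite linear0 -ab FP !Fm // scalerDl scalerDr !scalerA addrCA.
    by congr (_ + (_ *: _ + _)); exact: m0_idem.
  move/(bij_inj F_bij)/rowP/(_ ord_max); rewrite !mxE eqxx mulr0 add0r mulr1.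
  rewrite [a * b]mulrC mulrA -{1}[a]mul1r -mulrDl; apply: residue_unit.
  by rewrite rmorphD rmorphM rmorph1 /= res_b; apply/eqP.
by exists b; split=> //; rewrite mE a0 scale0r add0r.
Qed.

Lemma lift_band : exists (s : S) (hs : residue S s = 0), lift_iso (band_lift hs) L.
Proof.
have [F [F_bij FE Fm F_red]] := lift_basis.
have [b [res_b bE]] := lift_delta.
have hs : residue S (b - mu%:A) = 0.
  by rewrite linearB linearZ rmorph1 /= res_b [_ *: _]mulr1 subrr.
exists (b - mu%:A), hs, F; split=> //.
have F_semi : Defs.semilinear idfun (F : band_tmod (mu%:A + (b - mu%:A)) -> L).
  by move=> r x y; rewrite linearP.
apply: (@band_semilinear_act S _ S idfun L _ m F_semi Fm) => [|i j _|i j _|[|j] _].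
(* The chain ends at E: b m_(E+1) = alpha_e delta m0 = 0, and b is a unit because mu <> 0. *)
- have /chat_local[z bz] : residue S b <> 0 by rewrite res_b; apply/eqP.
  have bm : b *: m E.+1 = 0.
    have := act0 m0; rewrite -(alpha_delta sA ord_max) actM bE act_scale act_wlk.
    by rewrite (arr_walk sA) -/(vt e E) vtE eqxx.
  by rewrite -[m _]scale1r -bz mulrC -scalerA bm scaler0.
- exact: act_idem_wlk.
- by rewrite act_wlk (arr_walk sA) -/(vt e j); case: eqP => // _; rewrite act0.
- by rewrite [m 0]m0_idem bE addrC subrK.
- by rewrite act_wlk (delta_walk sA) act0.
Qed.

End AnyLift.

Theorem band_universal : is_universal_deformation_ring V (fps_Chat k).
Proof.
have res_t (S : Chat k) (f : Chat_hom (fps_Chat k) S) : residue S (sval f (fps_t k)) = 0.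
  by case: f => f fP /=; rewrite fP.
exists (fun S f => band_lift (res_t S f)); split.
- by move=> S f g /band_lift_param/Chat_hom_ext.
- move=> S L; have [m0 [m0_idem m0_red]] := lift_generator L.
  have [s [hs iso]] := lift_band m0_idem m0_red.
  have [f fs] := Chat_hom_exists hs; exists f; subst s.
  (* The two lifts differ only in the proof that their parameter lies in the maximal ideal. *)
  by rewrite (Prop_irrelevance (res_t S f) hs).
move=> S T f g h hE; apply: band_lift_push; by rewrite hE.
Qed.

End Universal.
End BandLifts.

(** * The Omega-orbit of B(1, lam) *)

Section OmegaOrbit.
Variables (k : fieldType) (e : nat) (A : algType k).
Variables (idem : vertex e -> A) (arr : arrow e -> A).
Hypothesis sA : star_algebra idem arr.

(** The hypotheses of [band_universal], with the parameter left free so that they persist along the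
    whole orbit. *)
Definition rigid_band (V : lmodType A) : Prop :=
  exists mu : k, [/\ mu != 0, 1 + mu * mu != 0
    & exists v : V, band_gen idem arr mu v].

(** The condition is kept because 1 + mu^2 is mu^2 times 1 + (-1/mu)^2. *)
Lemma rigid_band_inv (V W : lmodType A) :
  (forall mu (v : V), mu != 0 -> band_gen idem arr mu v ->
     exists w : W, band_gen idem arr (- mu^-1) w) ->
  rigid_band V -> rigid_band W.
Proof.
move=> VW [mu [mu0 mu2 [v vP]]]; exists (- mu^-1); split; last exact: VW vP.
  by rewrite oppr_eq0 invr_eq0.
rewrite mulrNN; apply: contra mu2 => /eqP mu2; apply/eqP.
have -> : 1 + mu * mu = mu * mu * (1 + mu^-1 * mu^-1).
  by rewrite mulrDr mulr1 mulrACA !mulfV // mulr1 addrC.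
by rewrite mu2 mulr0.
Qed.

Lemma rigid_band_Omega (V W : lmodType A) :
  rigid_band V -> in_Omega_orbit V W -> rigid_band W.
Proof.
have [P [td [tw [dc [wc tP]]]]] := top_module_exists sA.
have iso_case (U U' : lmodType A) : rigid_band U -> mod_iso U U' -> rigid_band U'.
  move=> [mu [mu0 mu2 [u uP]]] iso; exists mu; split=> //.
  exact: band_gen_iso iso uP.
have iter r n (U : lmodType A) : (forall U1 U2, rigid_band U1 -> r U1 U2 -> rigid_band U2) ->
    rigid_band V -> iter_rel r n V U -> rigid_band U.
  move=> rP V_band; elim: n U => [|n IH] U /=; first exact: iso_case.
  by move=> [U' /IH]; exact: rP.
move=> V_band [[n|n] VW]; apply: iter V_band VW => U1 U2 U1_band U12.
  by apply: rigid_band_inv U1_band => mu v mu0 vP; apply: (syzygy_band sA tP mu0 vP U12).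
by apply: rigid_band_inv U1_band => mu v mu0 vP; apply: (cosyzygy_band sA tP mu0 vP U12).
Qed.

End OmegaOrbit.

Theorem proposition5p3 (k : closedFieldType) (e : nat) (he : (1 <= e)%N)
    (C : lmodType (Lambda k e) -> Prop) (hC : homogeneous_tube C) :
  (forall V W : lmodType (Lambda k e),
     C V -> stable_End_iso k V -> C W -> stable_End_iso k W ->
     in_Omega_orbit V W) /\
  (forall V W : lmodType (Lambda k e),
     C V -> stable_End_iso k V -> in_Omega_orbit V W ->
     exists2 R : Chat k, is_universal_deformation_ring W R &
       exists f : {lrmorphism R -> fps k}, bijective f).
Proof.
have sA := Lambda_star_algebra k e; case: hC => _ [lam lam0 CE].
have stable_band (V : lmodType (Lambda k e)) : C V -> stable_End_iso k V ->
    exists phi : band_space k e 1 -> V, band_iso (@L_idem k e) (@L_arrow k e) lam phi.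
  move=> /CE[n n0 [phi phiP]] sV; have n1 := band_rank1 sA phiP n0 sV.
  by subst n; exists phi.
split=> [V W CV sV CW sW | V W CV sV VW].
  have [phi phiP] := stable_band V CV sV; have [psi psiP] := stable_band W CW sW.
  (* Both modules are B(1, lam), so the zeroth power of Omega, an isomorphism, relates them. *)
  exists 0; case: phiP => -[phi' phiK phi'K] phiL phi_i phi_a.
  case: psiP => -[psi' psiK psi'K] psiL psi_i psi_a.
  have [|i x|a x|f fE] := @star_linear k e _ _ _ sA V W (fun x => psi (phi' x)).
  - move=> c x y; rewrite -psiL; congr (psi _).
    by apply: (can_inj phiK); rewrite phiL !phi'K.
  - by rewrite -psi_i; congr (psi _); apply: (can_inj phiK); rewrite phi_i !phi'K.
  - by rewrite -psi_a; congr (psi _); apply: (can_inj phiK); rewrite phi_a !phi'K.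
  exists f; exists (fun y => phi (psi' y)) => [x|y]; rewrite fE.
    by rewrite psiK phi'K.
  by rewrite phiK psi'K.
have [phi phiP] := stable_band V CV sV.
have [mu [mu0 mu2 [w wP]]] : rigid_band (@L_idem k e) (@L_arrow k e) W.
  apply: (rigid_band_Omega sA _ VW); exists lam; split=> //.
    exact (band1_stable sA phiP lam0 sV).
  by exists (band_top_elt phi 1); exact: band1_gen phiP.
exists (fps_Chat k); first exact (band_universal sA mu0 mu2 wP).
by exists idfun; exists idfun.
Qed.
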